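(* Assume the family $\{f_t\}_t$ is Newton-admissible. Then, in a sufficiently small neighbourhood of the origin of $\mathbb{C}\times\mathbb{C}^n$, the canonical toric stratification $\mathcal{S}$ of $V(f)=f^{-1}(0)$ is a Whitney $(b)$-regular stratification. In particular, the family of hypersurfaces $\{V(f_t)\}_t$ is Whitney equisingular, i.e. $V(f)$ admits near the origin a Whitney $(b)$-regular stratification having the $t$-axis $\mathbb{C}\times\{\mathbf{0}\}$ as a stratum.
   Context: Let $(t,\mathbf{z})=(t,z_1,\ldots,z_n)$ be coordinates on $\mathbb{C}\times\mathbb{C}^n$. For $k\in K_0:=\{1,\ldots,k_0\}$ let $f^k\colon\mathbb{C}\times\mathbb{C}^n\to\mathbb{C}$ be a non-constant polynomial with $f^k(t,\mathbf{0})=0$ for all $t$; put $f:=f^1\cdots f^{k_0}$, $f_t(\mathbf{z}):=f(t,\mathbf{z})$, $f^k_t(\mathbf{z}):=f^k(t,\mathbf{z})$. All statements concern germs at the origin. Newton data: for a polynomial $g(\mathbf{z})=\sum_\alpha c_\alpha\mathbf{z}^\alpha$ with $g(\mathbf{0})=0$, $\Gamma_+(g)$ is the convex hull in $\mathbb{R}^n_+$ of $\bigcup_{c_\alpha\neq0}(\alpha+\mathbb{R}^n_+)$, and the Newton boundary $\Gamma(g)$ is the union of its compact faces. For a weight vector $\mathbf{w}=(w_1,\ldots,w_n)\in\mathbb{N}^n\setminus\{\mathbf{0}\}$ (nonnegative integers), $d(\mathbf{w};g):=\min\{\sum_i w_ix_i : x\in\Gamma_+(g)\}$, $\Delta(\mathbf{w};g)$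 is the face of $\Gamma_+(g)$ where this minimum is attained, $g_{\mathbf{w}}:=\sum_{\alpha\in\Delta(\mathbf{w};g)}c_\alpha\mathbf{z}^\alpha$ is the face function, and $I(\mathbf{w}):=\{i: w_i=0\}$. $\mathbf w$ is positive if all $w_i>0$. For $I\subseteq\{1,\ldots,n\}$, $\mathbb{C}^I:=\{\mathbf{z}: z_i=0 \text{ for } i\notin I\}$ and $\mathbb{C}^{*I}:=\{\mathbf{z}: z_i=0\iff i\notin I\}$; $\mathbb{C}^{*n}=\mathbb{C}^{*\{1,\ldots,n\}}$. $\mathcal{V}_g$ is the set of $I$ with $g|_{\mathbb{C}^I}\equiv0$. For $i_1,\ldots,i_m$ and $u_{i_j}\in\mathbb{C}^*$, $\mathbb{C}^{*n}(u_{i_1},\ldots,u_{i_m}):=\{\mathbf{z}\in\mathbb{C}^{*n}: z_{i_j}=u_{i_j},\ 1\le j\le m\}$. Non-degenerate complete intersection: polynomials $g^1,\ldots,g^p$ vanishing at $\mathbf 0$ define a non-degenerate complete intersection germ $V(g^1,\ldots,g^p)$ if for every positive weight vector $\mathbf{w}$, the $p$-form $dg^1_{\mathbf{w}}\wedge\cdots\wedge dg^p_{\mathbf{w}}$ is nowhere zero on $V^*(g^1_{\mathbf{w}},\ldots,g^p_{\mathbf{w}}):=\{\mathbf{z}\in\mathbb{C}^{*n}: g^1_{\mathbf{w}}(\mathbf{z})=\cdots=g^p_{\mathbf{w}}(\mathbf{z})=0\}$. Local tameness: $R>0$ is a radius of local tameness of $\{g^1,\ldots,g^p\}$ if for every nonempty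 $I=\{i_1,\ldots,i_m\}\in\mathcal{V}_{g^1}\cap\cdots\cap\mathcal{V}_{g^p}$, every $\mathbf{w}\in\mathbb{N}^n\setminus\{\mathbf 0\}$ with $I(\mathbf{w})=I$ and every $u_{i_1},\ldots,u_{i_m}\in\mathbb{C}^*$ with $\sum_j|u_{i_j}|^2<R$, the set $V^*(g^1_{\mathbf{w}},\ldots,g^p_{\mathbf{w}})\cap\mathbb{C}^{*n}(u_{i_1},\ldots,u_{i_m})$ is a reduced non-singular complete intersection in $\mathbb{C}^{*n}(u_{i_1},\ldots,u_{i_m})$, i.e. the differentials of $g^1_{\mathbf{w}},\ldots,g^p_{\mathbf{w}}$ with respect to the variables $(z_i)_{i\notin I}$ are linearly independent at each of its points; the germ is locally tame if such $R$ exists. Newton-admissible: $\{f_t\}_t$ is Newton-admissible if there is $R>0$ such that for all sufficiently small $t$: (i) for each $k\in K_0$, $\Gamma(f^k_t)$ is independent of $t$; (ii) for every nonempty $\{k_1,\ldots,k_p\}\subseteq K_0$, $V(f^{k_1}_t,\ldots,f^{k_p}_t)$ is a non-degenerate, locally tame complete intersection germ having a radius of local tameness greater than $R$ ($R$ independent of $t$ and of the subset). Canonical toric stratification: $\mathcal{S}$ is the collection of nonempty sets $S^I(K):=\{(t,\mathbf{z})\in\mathbb{C}\times\mathbb{C}^{*I}: f^k(t,\mathbf{z})=0\iff k\in K\}$ for $I\subseteq\{1,\ldots,n\}$, $K\subseteq K_0$ (near the origin these are non-singular, and $S^{\emptyset}(K_0)=\mathbb{C}\times\{\mathbf 0\}$).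 *)

(* Defs.v *)
From HB Require Import structures.
From mathcomp Require Import all_boot all_order all_algebra.
From mathcomp Require Import complex.
From mathcomp Require Import mpoly.
From mathcomp Require Import Rstruct.
From Stdlib Require Rdefinitions.

Set Implicit Arguments.
Unset Strict Implicit.
Unset Printing Implicit Defensive.

Import Order.TTheory GRing.Theory Num.Theory.
Local Open Scope ring_scope.

Definition R : rcfType := Rdefinitions.R.
Definition C : numClosedFieldType := R[i].

Definition toC (r : R) : C := real_complex R r.

Definition normsq (N : nat) (x : 'rV[C]_N) : C := \sum_(i < N) `|x ord0 i| ^+ 2.

Definition cvg_to (N : nat) (u : nat -> 'rV[C]_N) (y : 'rV[C]_N) : Prop :=
  forall e : C, 0 < e -> exists k0 : nat, forall k, (k0 <= k)%N -> normsq (u k - y) < e.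

Definition evr (N : nat) (p : {mpoly C[N]}) (x : 'rV[C]_N) : C :=
  p.@[fun i => x ord0 i].

(* Tangent space of a set X at x, defined intrinsically as the        *)
(* (Bouligand) tangent cone: limits of t_k (x_k - x), x_k in X, x_k->x,*)
(* t_k > 0 real.  For a submanifold this is its tangent space T_x X.  *)
Definition tangent_space (N : nat) (X : 'rV[C]_N -> Prop) (x : 'rV[C]_N)
    (v : 'rV[C]_N) : Prop :=
  exists (xs : nat -> 'rV[C]_N) (ts : nat -> C),
    (forall k, X (xs k) /\ 0 < ts k) /\ cvg_to xs x /\
    cvg_to (fun k => ts k *: (xs k - x)) v.

Definition cline (N : nat) (v : 'rV[C]_N) (w : 'rV[C]_N) : Prop :=
  exists c : C, w = c *: v.

(* Convergence of a sequence of (linear) subsets of C^N to T in the   *)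
(* Painleve-Kuratowski sense; for linear subspaces of a fixed         *)
(* dimension this is convergence in the Grassmannian.                 *)
Definition set_cvg (N : nat) (Ts : nat -> 'rV[C]_N -> Prop) (T : 'rV[C]_N -> Prop)
  : Prop :=
  (forall v, T v -> exists vs : nat -> 'rV[C]_N, (forall k, Ts k (vs k)) /\ cvg_to vs v)
  /\
  (forall (phi : nat -> nat) (vs : nat -> 'rV[C]_N) (v : 'rV[C]_N),
      (forall k, (phi k < phi k.+1)%N) -> (forall k, Ts (phi k) (vs k)) ->
      cvg_to vs v -> T v).

Definition whitney_b_at (N : nat) (X Y : 'rV[C]_N -> Prop) (y : 'rV[C]_N) : Prop :=
  forall (xs ys : nat -> 'rV[C]_N),
    (forall k, X (xs k) /\ Y (ys k) /\ xs k != ys k) ->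
    cvg_to xs y -> cvg_to ys y ->
    forall (T L : 'rV[C]_N -> Prop),
      set_cvg (fun k => tangent_space X (xs k)) T ->
      set_cvg (fun k => cline (xs k - ys k)) L ->
      forall v, L v -> T v.

Definition complex_submanifold (N : nat) (X : 'rV[C]_N -> Prop) : Prop :=
  forall x, X x ->
    exists (d : nat) (r : C) (h : 'I_(N - d) -> {mpoly C[N]}),
      (d <= N)%N /\ 0 < r /\
      (forall y, normsq (y - x) < r -> (X y <-> forall j, evr (h j) y = 0)) /\
      row_free (\matrix_(j < N - d, i < N) evr ((h j)^`M(i)) x).

(* A family of subsets (X j), j ranging over a finite index type, is a *)
(* Whitney (b)-regular stratification of A: the nonempty X j are the   *)
(* strata; they are pairwise disjoint, cover A, are complex            *)
(* submanifolds, and every pair of distinct strata satisfies (b).      *)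
Definition whitney_stratification (N : nat) (J : finType)
    (X : J -> 'rV[C]_N -> Prop) (A : 'rV[C]_N -> Prop) : Prop :=
  (forall j x, X j x -> A x) /\
  (forall x, A x -> exists j, X j x) /\
  (forall j j' x, X j x -> X j' x -> j = j') /\
  (forall j, complex_submanifold (X j)) /\
  (forall j j' y, j != j' -> X j' y -> whitney_b_at (X j) (X j') y).

Definition expR (n : nat) (m : 'X_{1..n}) : 'I_n -> R := fun i => (m i)%:R.

Definition wdotR (n : nat) (w x : 'I_n -> R) : R := \sum_(i < n) w i * x i.

(* Gamma_+(g): convex hull of the union of alpha + R^n_+ over the     *)
(* support, i.e. points dominating a convex combination of exponents. *)
Definition Gamma_plus (n : nat) (g : {mpoly C[n]}) (x : 'I_n -> R) : Prop :=
  exists lam : 'X_{1..n} -> R,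
    (forall m, 0 <= lam m) /\ \sum_(m <- msupp g) lam m = 1 /\
    (forall i, \sum_(m <- msupp g) lam m * expR m i <= x i).

Definition Delta (n : nat) (w : 'I_n -> R) (g : {mpoly C[n]}) (x : 'I_n -> R) : Prop :=
  Gamma_plus g x /\ forall y, Gamma_plus g y -> wdotR w x <= wdotR w y.

(* Newton boundary Gamma(g): union of the compact faces of Gamma_+(g) *)
(* (all faces of Gamma_+ are of the form Delta(w;g), w >= 0).         *)
Definition Newton_boundary (n : nat) (g : {mpoly C[n]}) (x : 'I_n -> R) : Prop :=
  exists w : 'I_n -> R,
    (forall i, 0 <= w i) /\
    (exists M : R, forall y, Delta w g y -> forall i, y i <= M) /\
    Delta w g x.

Definition wdot (n : nat) (w : 'I_n -> nat) (m : 'X_{1..n}) : nat :=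
  (\sum_(i < n) w i * m i)%N.

(* face function g_w: sum of the terms c_alpha z^alpha of g whose     *)
(* exponent alpha lies on Delta(w;g), i.e. alpha minimizes <w,.> over *)
(* the support (for w >= 0, min over Gamma_+ = min over the support). *)
Definition face_fun (n : nat) (w : 'I_n -> nat) (g : {mpoly C[n]}) : {mpoly C[n]} :=
  \sum_(m <- msupp g | all (fun m' => (wdot w m <= wdot w m')%N) (msupp g))
     g@_m *: 'X_[m].

Definition positive_weight (n : nat) (w : 'I_n -> nat) : Prop :=
  forall i, (0 < w i)%N.

Definition in_torus (n : nat) (z : 'I_n -> C) : Prop := forall i, z i != 0.

(* Jacobian of the family (g k)_{k in S} at z, with the columns of the *)
(* variables in I set to 0 (i.e. differentials w.r.t. z_i, i notin I) *)
Definition jac_out (n k0 : nat) (S : {set 'I_k0}) (g : 'I_k0 -> {mpoly C[n]})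
    (I : {set 'I_n}) (z : 'I_n -> C) : 'M[C]_(#|S|, n) :=
  \matrix_(j < #|S|, i < n)
     (if i \in I then 0 else ((g (@enum_val _ (mem S) j))^`M(i)).@[z]).

Definition nondegenerate_ci (n k0 : nat) (S : {set 'I_k0})
    (g : 'I_k0 -> {mpoly C[n]}) : Prop :=
  forall w : 'I_n -> nat, positive_weight w ->
    forall z : 'I_n -> C, in_torus z ->
      (forall k, k \in S -> (face_fun w (g k)).@[z] = 0) ->
      row_free (jac_out S (fun k => face_fun w (g k)) set0 z).

Definition vanishes_on_coord (n : nat) (g : {mpoly C[n]}) (I : {set 'I_n}) : Prop :=
  forall z : 'I_n -> C, (forall i, i \notin I -> z i = 0) -> g.@[z] = 0.

Definition tameness_radius (n k0 : nat) (S : {set 'I_k0})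
    (g : 'I_k0 -> {mpoly C[n]}) (Rt : R) : Prop :=
  0 < Rt /\
  forall I : {set 'I_n}, I != set0 ->
    (forall k, k \in S -> vanishes_on_coord (g k) I) ->
    forall w : 'I_n -> nat, (exists i, (0 < w i)%N) ->
      (forall i, (w i == 0)%N = (i \in I)) ->
      forall u : 'I_n -> C,
        (forall i, i \in I -> u i != 0) ->
        \sum_(i in I) `|u i| ^+ 2 < toC Rt ->
        forall z : 'I_n -> C, in_torus z -> (forall i, i \in I -> z i = u i) ->
          (forall k, k \in S -> (face_fun w (g k)).@[z] = 0) ->
          row_free (jac_out S (fun k => face_fun w (g k)) I z).

(* The family: coordinates (t, z_1..z_n) on C x C^n are indexed by     *)
(* 'I_n.+1, index ord0 being t and lift ord0 i being z_(i+1).          *)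

Definition slice (n : nat) (F : {mpoly C[n.+1]}) (t : C) : {mpoly C[n]} :=
  F \mPo [tuple (match unlift ord0 i with Some j => 'X_j | None => t%:MP end)
                | i < n.+1].

Definition pt (n : nat) (t : C) (z : 'I_n -> C) : 'rV[C]_n.+1 :=
  \row_(i < n.+1) (match unlift ord0 i with Some j => z j | None => t end).

Definition Newton_admissible (n k0 : nat) (f : 'I_k0 -> {mpoly C[n.+1]}) : Prop :=
  exists (R0 : R) (delta : R), 0 < R0 /\ 0 < delta /\
    (forall k (t t' : C), `|t| < toC delta -> `|t'| < toC delta ->
        forall x, Newton_boundary (slice (f k) t) x <-> Newton_boundary (slice (f k) t') x) /\
    (forall (t : C), `|t| < toC delta ->
       forall S : {set 'I_k0}, S != set0 ->
         nondegenerate_ci S (fun k => slice (f k) t) /\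
         exists Rt : R, R0 < Rt /\ tameness_radius S (fun k => slice (f k) t) Rt).

Definition toric_stratum (n k0 : nat) (f : 'I_k0 -> {mpoly C[n.+1]})
    (I : {set 'I_n}) (K : {set 'I_k0}) (x : 'rV[C]_n.+1) : Prop :=
  (forall i : 'I_n, (x ord0 (lift ord0 i) != 0) = (i \in I)) /\
  (forall k, (evr (f k) x == 0) = (k \in K)).

(* Main.v *)
(* Curve selection is replaced by sequences and a nonprincipal ultrafilter on
   the natural numbers, along which every bounded sequence converges.  Let x_k
   be points of a stratum in C x C^*I tending to a point y of C x C^*I', with
   I' included in I.  The vectors (-ln |x_k,i|), for i in I but not in I', are
   corrected by a bounded amount so that all bounded differences of the finitely
   many monomials of the f^k become 0; a simultaneous Diophantine approximation
   then gives an integer weight w ordering these monomials as their asymptotic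
   sizes do.  After rescaling, x_k tends to a point a with nonzero coordinates
   indexed by I, and the f^k and their gradients at x_k are governed by the face
   functions f^k_w and their gradients at a.  Constancy of the Newton boundary
   identifies these with the face functions of the slice at the limit time t.

   For y = 0, non-degeneracy shows that the gradients of the f^k which do not
   vanish on C x C^I are independent near the origin, so the strata are smooth.
   For Whitney (b), split the equations of X into those vanishing on C^I' (whose
   rescaled gradients are independent in the variables of I \ I' by tameness) and
   the others (whose gradients are independent along Y, by smoothness).  The
   limiting linear system has full rank, so a secant direction can be moved into
   the tangent space by a correction tending to 0 as soon as its residual does;
   Euler's relation for f^k_w gives this for the first group of equations, and
   differentiability together with f^k(x) = f^k(y') = 0 for the second. *)

Require Import Defs.
From HB Require Import structures.
From mathcomp Require Import all_boot all_order all_algebra.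
From mathcomp Require Import complex.
From mathcomp Require Import mpoly.
From mathcomp Require Import Rstruct.
From mathcomp Require Import boolp.
From mathcomp Require Import ring lra zify.
From mathcomp Require classical_sets filter.
From Stdlib Require Rdefinitions Rtrigo_def Exp_prop Rpower Raxioms.
Import Order.TTheory GRing.Theory Num.Theory.
Local Open Scope ring_scope.

Set Implicit Arguments.
Unset Strict Implicit.
Unset Printing Implicit Defensive.

(** * Real numbers inside the complex numbers and the real-valued modulus *)

HB.instance Definition _ := GRing.RMorphism.copy toC (real_complex R).

Definition nrm (z : C) : R := ComplexField.Normc.normc z.

Lemma normC_nrm (z : C) : `|z| = toC (nrm z).
Proof. by []. Qed.

Lemma ltr_toC (a b : R) : (toC a < toC b) = (a < b).
Proof. by rewrite ltcR. Qed.

Lemma ler_toC (a b : R) : (toC a <= toC b) = (a <= b).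
Proof. by rewrite lecR. Qed.

Lemma toCM a b : toC (a * b) = toC a * toC b.
Proof. exact: rmorphM. Qed.

Lemma toC_eq0 (a : R) : (toC a == 0) = (a == 0).
Proof. exact: fmorph_eq0. Qed.

(** Positivity in the order of [C] forces the imaginary part to vanish, so the complex tolerances of
    the definitions can be traded for real ones. *)
Lemma toC_surj (e : C) : 0 < e -> exists2 r : R, 0 < r & e = toC r.
Proof.
case: e => a b; rewrite ltcE /= => /andP[/eqP -> h].
by exists a.
Qed.

Lemma nrm_ge0 z : 0 <= nrm z.
Proof. by rewrite -ler_toC -normC_nrm rmorph0. Qed.

Lemma nrm0 : nrm 0 = 0.
Proof. exact: ComplexField.Normc.normc0. Qed.

Lemma nrm_eq0 z : (nrm z == 0) = (z == 0).
Proof.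
by apply/eqP/eqP => [/ComplexField.Normc.eq0_normc //|->]; exact: nrm0.
Qed.

Lemma nrm_gt0 z : (0 < nrm z) = (z != 0).
Proof. by rewrite lt0r nrm_ge0 andbT nrm_eq0. Qed.

Lemma nrmM x y : nrm (x * y) = nrm x * nrm y.
Proof. exact: ComplexField.Normc.normcM. Qed.

Lemma nrmN x : nrm (- x) = nrm x.
Proof. exact: normcN. Qed.

Lemma nrmV x : nrm x^-1 = (nrm x)^-1.
Proof. exact: ComplexField.Normc.normcV. Qed.

Lemma nrmD x y : nrm (x + y) <= nrm x + nrm y.
Proof. exact: le_normcD. Qed.

Lemma nrmBC x y : nrm (x - y) = nrm (y - x).
Proof. by rewrite -nrmN opprB. Qed.

Lemma nrm_toC r : nrm (toC r) = `|r|.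
Proof. by apply: complexI; rewrite -[LHS]/`|toC r| -[RHS]/(toC `|r|) /toC normc_def /= expr0n /= addr0 sqrtr_sqr. Qed.

Lemma nrm_sum (I : Type) (r : seq I) (P : pred I) (F : I -> C) :
  nrm (\sum_(i <- r | P i) F i) <= \sum_(i <- r | P i) nrm (F i).
Proof.
elim/big_rec2: _ => [|i y1 y2 _ h]; first by rewrite nrm0.
by apply: le_trans (nrmD _ _) _; rewrite lerD2l.
Qed.

(** * Limits along filters *)

Notation filt F := (filter.Filter F).

(** Limits along an arbitrary filter. The same calculus then serves the ultrafilter [om], ordinary
    convergence of sequences and neighbourhoods of a point. *)
Definition flim (T : Type) (F : (T -> Prop) -> Prop) (u : T -> C) (l : C) :=
  forall e : R, 0 < e -> F (fun x => nrm (u x - l) < e).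

Section Limits.
Context {T : Type} {F : (T -> Prop) -> Prop} {FF : filt F}.
Implicit Types u v : T -> C.

Lemma filtS (P Q : T -> Prop) : (forall x, P x -> Q x) -> F P -> F Q.
Proof. by move=> h; apply: filter.filterS. Qed.

Lemma filtI (P Q : T -> Prop) : F P -> F Q -> F (fun x => P x /\ Q x).
Proof. by move=> h1 h2; apply: (filter.filterI h1 h2). Qed.

Lemma filtT (P : T -> Prop) : (forall x, P x) -> F P.
Proof. by move=> h; apply: filtS (filter.filterT). Qed.

Lemma filtS2 (P Q S : T -> Prop) :
  (forall x, P x -> Q x -> S x) -> F P -> F Q -> F S.
Proof. by move=> h p q; apply: filtS (filtI p q) => x []; apply: h. Qed.

Lemma filt_all (I : eqType) (s : seq I) (P : I -> T -> Prop) :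
  (forall i, i \in s -> F (P i)) -> F (fun x => forall i, i \in s -> P i x).
Proof.
elim: s => [|i s IH] h; first by apply: filtT.
have h1 : F (P i) by apply: h; rewrite mem_head.
have h2 := IH (fun j js => h j (mem_behead (s := i :: s) js)).
apply: filtS2 h1 h2 => x p q j; rewrite inE => /orP[/eqP -> //|]; exact: q.
Qed.

Lemma filt_forall (I : finType) (P : I -> T -> Prop) :
  (forall i, F (P i)) -> F (fun x => forall i, P i x).
Proof.
move=> h; apply: filtS (filt_all (s := enum I) (fun i _ => h i)) => x q i.
by apply: q; rewrite mem_enum.
Qed.

Lemma flim_ext_ev u v l : F (fun x => u x = v x) -> flim F u l -> flim F v l.
Proof. by move=> h hu e e0; apply: filtS2 h (hu e e0) => x ->. Qed.

Lemma flim_ext u v l : u =1 v -> flim F u l -> flim F v l.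
Proof. by move=> h; apply: flim_ext_ev; apply: filtT. Qed.

Lemma flim_cst l : flim F (fun _ => l) l.
Proof. by move=> e e0; apply: filtT => x; rewrite subrr nrm0. Qed.

Lemma flimD u v a b :
  flim F u a -> flim F v b -> flim F (fun x => u x + v x) (a + b).
Proof.
move=> hu hv e e0; have e2 : 0 < e / 2 by lra.
apply: filtS2 (hu _ e2) (hv _ e2) => x h1 h2.
rewrite opprD addrACA; have := nrmD (u x - a) (v x - b); lra.
Qed.

Lemma flim_squeeze (g : T -> R) u a :
  flim F (fun x => toC (g x)) 0 -> F (fun x => nrm (u x - a) <= g x) -> flim F u a.
Proof.
move=> hg hu e e0; apply: filtS2 (hg e e0) hu => x; rewrite subr0 nrm_toC.
have := ler_norm (g x); lra.
Qed.

Lemma flim_bounded u a : flim F u a -> F (fun x => nrm (u x) < nrm a + 1).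
Proof.
move=> h; apply: filtS (h 1 ltr01) => x h1.
have := nrmD (u x - a) a; rewrite subrK; lra.
Qed.

Lemma flimM u v a b :
  flim F u a -> flim F v b -> flim F (fun x => u x * v x) (a * b).
Proof.
move=> hu hv e e0.
pose A := nrm a + 1; pose B := nrm b + 1.
have A0 : 0 < A by rewrite /A; have := nrm_ge0 a; lra.
have B0 : 0 < B by rewrite /B; have := nrm_ge0 b; lra.
have h1 : F (fun x => nrm (u x - a) < e / (2 * B)) by apply: hu; apply: divr_gt0 => //; lra.
have h2 : F (fun x => nrm (v x - b) < e / (2 * A)) by apply: hv; apply: divr_gt0 => //; lra.
apply: filtS2 (filtI h1 h2) (flim_bounded hv) => x [k1 k2] k3.
have -> : u x * v x - a * b = (u x - a) * v x + a * (v x - b) by ring.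
apply: le_lt_trans (nrmD _ _) _; rewrite !nrmM.
have -> : e = e / (2 * B) * B + e / (2 * A) * A by field; lra.
apply: ltr_leD.
  apply: le_lt_trans (_ : _ <= nrm (u x - a) * B) _.
    by apply: ler_wpM2l; [exact: nrm_ge0|exact: ltW].
  by rewrite ltr_pM2r.
rewrite mulrC; apply: ler_pM; rewrite ?nrm_ge0 //; first exact: ltW.
rewrite /A; lra.
Qed.

Lemma flimZ c u a : flim F u a -> flim F (fun x => c * u x) (c * a).
Proof. by apply: flimM; apply: flim_cst. Qed.

Lemma flimN u a : flim F u a -> flim F (fun x => - u x) (- a).
Proof.
by move=> h e e0; apply: filtS (h e e0) => x; rewrite -opprD nrmN.
Qed.

Lemma flimB u v a b :
  flim F u a -> flim F v b -> flim F (fun x => u x - v x) (a - b).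
Proof. by move=> hu hv; apply: flimD => //; apply: flimN. Qed.

Lemma flim_sum (I : eqType) (r : seq I) (P : pred I) (f : I -> T -> C) (g : I -> C) :
  (forall i, i \in r -> P i -> flim F (f i) (g i)) ->
  flim F (fun x => \sum_(i <- r | P i) f i x) (\sum_(i <- r | P i) g i).
Proof.
elim: r => [|i r IH] h.
  by rewrite big_nil; apply: flim_ext (flim_cst 0) => x; rewrite big_nil.
have hr : flim F (fun x => \sum_(i <- r | P i) f i x) (\sum_(i <- r | P i) g i).
  by apply: IH => j jr; apply: h; rewrite inE jr orbT.
rewrite big_cons; case: ifP => Pi.
  have hi := h i (mem_head _ _) Pi.
  by apply: flim_ext (flimD hi hr) => x; rewrite big_cons Pi.
by apply: flim_ext hr => x; rewrite big_cons Pi.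
Qed.

Lemma flim_prod (I : Type) (r : seq I) (f : I -> T -> C) (g : I -> C) :
  (forall i, flim F (f i) (g i)) ->
  flim F (fun x => \prod_(i <- r) f i x) (\prod_(i <- r) g i).
Proof.
move=> h; elim: r => [|i r IH].
  by rewrite big_nil; apply: flim_ext (flim_cst 1) => x; rewrite big_nil.
by rewrite big_cons; apply: flim_ext (flimM (h i) IH) => x; rewrite big_cons.
Qed.

Lemma flimX n u a : flim F u a -> flim F (fun x => u x ^+ n) (a ^+ n).
Proof.
move=> h; elim: n => [|n IH]; first exact: flim_cst.
by rewrite exprS; apply: flim_ext (flimM h IH) => x; rewrite exprS.
Qed.

Lemma flim_nrm_gt u a e : flim F u a -> e < nrm a -> F (fun x => e < nrm (u x)).
Proof.
move=> h ea; have d0 : 0 < nrm a - e by lra.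
apply: filtS (h _ d0) => x; rewrite nrmBC.
have := nrmD (a - u x) (u x); rewrite subrK; lra.
Qed.

Lemma flim_neq0 u a : flim F u a -> a != 0 -> F (fun x => u x != 0).
Proof.
by rewrite -nrm_gt0 => h a0; apply: filtS (flim_nrm_gt h a0) => x; rewrite nrm_gt0.
Qed.

Lemma flimV u a : a != 0 -> flim F u a -> flim F (fun x => (u x)^-1) a^-1.
Proof.
move=> a0 h e e0; pose A := nrm a.
have A0 : 0 < A by rewrite nrm_gt0.
have d0 : 0 < e * (A / 2 * A) by rewrite !mulr_gt0 ?invr_gt0.
have hA : A / 2 < A by lra.
apply: filtS2 (h _ d0) (flim_nrm_gt h hA) => x h1 h2.
have ux : u x != 0 by rewrite -nrm_gt0; lra.
have -> : (u x)^-1 - a^-1 = (a - u x) / (u x * a) by field; rewrite ux a0.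
rewrite nrmM nrmV nrmM nrmBC ltr_pdivrMr ?mulr_gt0 //; last by lra.
apply: lt_le_trans h1 _; rewrite ler_pM2l //; apply: ler_wpM2r; lra.
Qed.

Lemma flim_le_nrm u a M : filter.ProperFilter F ->
  flim F u a -> F (fun x => nrm (u x) <= M) -> nrm a <= M.
Proof.
move=> PF h hM; rewrite leNgt; apply/negP => aM.
have : F (fun=> False) by apply: filtS2 (flim_nrm_gt h aM) hM => x; lra.
exact: filter.filter_not_empty.
Qed.

Lemma flim_unique u a b : filter.ProperFilter F -> flim F u a -> flim F u b -> a = b.
Proof.
move=> PF ha hb; apply/eqP; rewrite -subr_eq0 -nrm_eq0 eq_le nrm_ge0 andbT.
apply: (flim_le_nrm PF (flimB ha hb)); apply: filtT => x.
by rewrite subrr nrm0.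
Qed.

Lemma flim_nrm u a : flim F u a -> flim F (fun x => toC (nrm (u x))) (toC (nrm a)).
Proof.
move=> h e e0; apply: filtS (h e e0) => x; rewrite -rmorphB nrm_toC.
apply: le_lt_trans; rewrite ler_norml; apply/andP; split.
  have := nrmD (a - u x) (u x); rewrite subrK nrmBC; lra.
have := nrmD (u x - a) a; rewrite subrK; lra.
Qed.

Lemma flim_meval n (P : {mpoly C[n]}) (u : T -> 'I_n -> C) (y : 'I_n -> C) :
  (forall i, flim F (fun x => u x i) (y i)) ->
  flim F (fun x => P.@[u x]) P.@[y].
Proof.
move=> h; rewrite mevalE.
apply: (flim_ext (u := fun x => \sum_(m <- msupp P) P@_m * \prod_i u x i ^+ m i)).
  by move=> x; rewrite mevalE.
apply: flim_sum => m _ _; apply: flimZ; apply: flim_prod => i; exact: flimX.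
Qed.
End Limits.

(** * A nonprincipal ultrafilter on the natural numbers *)

Lemma ultra_exists :
  exists G : (nat -> Prop) -> Prop, filter.UltraFilter G /\
    forall P : nat -> Prop, (exists k0, forall k, (k0 <= k)%N -> P k) -> G P.
Proof.
have [G [UG sub]] := filter.ultraFilterLemma filter.eventually_filter.
exists G; split=> // P [k0 h]; apply: sub.
by exists k0 => // k /= hk; apply: h.
Qed.

(** Fixed once and for all by choice. Since one of [P] and its negation always holds along [om], no
    successive extraction of subsequences is needed. *)
Definition om : (nat -> Prop) -> Prop := projT1 (cid ultra_exists).

Lemma om_ultra : filter.UltraFilter om.
Proof. by rewrite /om; case: (projT2 (cid ultra_exists)). Qed.

#[local] Instance om_proper : filter.ProperFilter om := @filter.ultra_proper _ _ om_ultra.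
#[local] Instance om_filter : filt om := @filter.filter_filter _ _ om_proper.

Lemma om_ev (P : nat -> Prop) k0 : (forall k, (k0 <= k)%N -> P k) -> om P.
Proof.
by move=> h; rewrite /om; case: (projT2 (cid ultra_exists)) => _; apply; exists k0.
Qed.

Lemma om_em (P : nat -> Prop) : om P \/ om (fun k => ~ P k).
Proof. exact: (filter.in_ultra_setVsetC P om_ultra). Qed.

(** Final segments belong to [om], so a set in [om] is unbounded. This brings statements along [om]
    back to actual indices. *)
Lemma om_ex (P : nat -> Prop) : om P -> forall n, exists2 k, (n <= k)%N & P k.
Proof.
move=> h n; apply: contrapT => hn.
have hk : om (fun k => (n <= k)%N) := om_ev (fun k h => h).
by apply: (filter.filter_not_empty om); apply: filtS2 h hk => k p q; apply: hn; exists k.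
Qed.

(** The limit is the supremum of the [x] with [x <= r k] along [om]; the ultrafilter dichotomy turns
    both defining properties of the supremum into estimates along [om]. *)
Lemma om_bounded_lim (r : nat -> R) M : om (fun k => `|r k| <= M) ->
  exists l : R, forall e, 0 < e -> om (fun k => `|r k - l| < e).
Proof.
move=> hM; pose E (x : R) := om (fun k => x <= r k).
have Eb : Raxioms.bound E.
  exists M => x Ex; apply/RleP; have [k _ [h1 h2]] := om_ex (filtI hM Ex) 0%N.
  by have := ler_norm (r k); lra.
have En : exists x, E x.
  by exists (- M); apply: filtS hM => k; rewrite ler_norml => /andP[].
have [l [lu ll]] := Raxioms.completeness E Eb En.
exists l => e e0.
have h1 : om (fun k => r k < l + e / 2).
  case: (om_em (fun k => r k < l + e / 2)) => // h.
  have /lu /RleP : E (l + e / 2) by apply: filtS h => k /negP; rewrite -leNgt.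
  by lra.
have h2 : om (fun k => l - e / 2 < r k).
  case: (om_em (fun k => l - e / 2 < r k)) => // h.
  have /RleP : Rdefinitions.Rle l (l - e / 2).
    apply: ll => x Ex; apply/RleP; have [k _ [k1 /negP k2]] := om_ex (filtI Ex h) 0%N.
    by move: k2; rewrite -leNgt; lra.
  by lra.
apply: filtS2 h1 h2 => k; rewrite ltr_norml; lra.
Qed.

Lemma om_flim (u : nat -> C) M : om (fun k => nrm (u k) <= M) ->
  exists l, flim om u l.
Proof.
move=> h.
have hc (z : C) : `|complex.Re z| <= nrm z /\ `|complex.Im z| <= nrm z.
  case: z => a b /=; rewrite -!sqrtr_sqr.
  by split; rewrite ler_wsqrtr // ?lerDl ?lerDr sqr_ge0.
have hnc (z : C) : nrm z <= `|complex.Re z| + `|complex.Im z|.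
  case: z => a b /=; rewrite -[leRHS]ger0_norm ?addr_ge0 // -sqrtr_sqr.
  rewrite ler_wsqrtr // sqrrD !real_normK ?num_real // addrAC lerDl.
  by rewrite mulrn_wge0 ?mulr_ge0.
have [a ha] : exists l : R, forall e, 0 < e -> om (fun k => `|complex.Re (u k) - l| < e).
  by apply: (@om_bounded_lim _ M); apply: filtS h => k; apply: le_trans; have [] := hc (u k).
have [b hb] : exists l : R, forall e, 0 < e -> om (fun k => `|complex.Im (u k) - l| < e).
  by apply: (@om_bounded_lim _ M); apply: filtS h => k; apply: le_trans; have [] := hc (u k).
exists (a +i* b)%C => e e0; have e2 : 0 < e / 2 by lra.
apply: filtS2 (ha _ e2) (hb _ e2) => k.
have := hnc (u k - (a +i* b)%C); case: (u k) => c d /=; lra.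
Qed.

(** * Tropical limits *)

Definition ex (r : R) : R := Rtrigo_def.exp r.

Lemma ex0 : ex 0 = 1.
Proof. exact: Rtrigo_def.exp_0. Qed.

Lemma exD a b : ex (a + b) = ex a * ex b.
Proof. exact: Exp_prop.exp_plus. Qed.

Lemma ex_gt0 a : 0 < ex a.
Proof. by apply/RltP; apply: Exp_prop.exp_pos. Qed.

Lemma ex_neq0 a : ex a != 0.
Proof. by rewrite gt_eqF // ex_gt0. Qed.

Lemma exN a : ex (- a) = (ex a)^-1.
Proof.
by apply: (mulfI (ex_neq0 a)); rewrite -exD subrr ex0 mulfV // ex_neq0.
Qed.

Lemma ltr_ex a b : a < b -> ex a < ex b.
Proof. by move=> /RltP h; apply/RltP; apply: Rpower.exp_increasing. Qed.

Lemma ler_ex a b : a <= b -> ex a <= ex b.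
Proof. by rewrite le_eqVlt => /orP[/eqP -> //|/ltr_ex /ltW]. Qed.

Lemma ex_ge1D a : 1 + a <= ex a.
Proof. by apply/RleP; apply: Rpower.exp_ineq1_le. Qed.

Lemma ex_surj a : 0 < a -> exists b, ex b = a.
Proof. by move=> /RltP h; exists (Rpower.ln a); apply: Rpower.exp_ln. Qed.

Definition toinfty (r : nat -> R) := forall B, om (fun k => B <= r k).

Definition rbounded (r : nat -> R) := exists B, om (fun k => `|r k| <= B).

(** If [r] does not tend to plus infinity, it lies below some [B] along [om]; if moreover [- r]
    failed to exceed some [D], then [r] would be bounded. *)
Lemma rbounded_trichotomy r :
  rbounded r \/ toinfty r \/ toinfty (fun k => - r k).
Proof.
have [|nb] := pselect (rbounded r); [by left|right].
have [|np] := pselect (toinfty r); [by left|right].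
have [B hB] : exists B, ~ om (fun k => B <= r k).
  by apply: contrapT => h; apply: np => B; apply: contrapT => h'; apply: h; exists B.
have hB' : om (fun k => r k < B).
  by case: (om_em (fun k => B <= r k)) => // h; apply: filtS h => k /negP; rewrite -ltNge.
move=> D; case: (om_em (fun k => D <= - r k)) => // h; exfalso; apply: nb.
exists (`|B| + `|D|); apply: filtS2 hB' h => k h1 /negP; rewrite -ltNge => h2.
have := ler_norm B; have := ler_norm D; have := normr_ge0 B; have := normr_ge0 D.
by rewrite ler_norml; lra.
Qed.

Lemma rboundedD r s : rbounded r -> rbounded s -> rbounded (fun k => r k + s k).
Proof.
move=> [B hB] [D hD]; exists (B + D); apply: filtS2 hB hD => k h1 h2.
by have := ler_normD (r k) (s k); lra.
Qed.

Lemma rboundedM r c : rbounded r -> rbounded (fun k => r k * c).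
Proof.
move=> [B hB]; exists (B * `|c|); apply: filtS hB => k h.
by rewrite normrM ler_wpM2r.
Qed.

Lemma rbounded_sum (I : Type) (s : seq I) (r : I -> nat -> R) :
  (forall i, rbounded (r i)) -> rbounded (fun k => \sum_(i <- s) r i k).
Proof.
move=> h; elim: s => [|i s [B hB]].
  by exists 0; apply: filtT => k; rewrite big_nil normr0.
have [D hD] := rboundedD (h i) (ex_intro _ B hB).
by exists D; apply: filtS hD => k; rewrite big_cons.
Qed.

Lemma toinftyD r s : toinfty r -> rbounded s -> toinfty (fun k => r k + s k).
Proof.
move=> h [D hD] B; apply: filtS2 (h (B + D)) hD => k h1.
by rewrite ler_norml; lra.
Qed.

Lemma toinfty_unbounded r : toinfty r -> ~ rbounded r.
Proof.
move=> h [B hB]; have [k _ [h1 h2]] := om_ex (filtI hB (h (B + 1))) 0%N.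
by have := ler_norm (r k); lra.
Qed.

Lemma toinftyN r : toinfty r -> toinfty (fun k => - r k) -> False.
Proof.
by move=> h1 h2; have [k _ [k1 k2]] := om_ex (filtI (h1 1) (h2 1)) 0%N; lra.
Qed.

Lemma flim_exN r : toinfty r -> flim om (fun k => toC (ex (- r k))) 0.
Proof.
move=> h e e0; apply: filtS (h e^-1) => k hk.
rewrite subr0 nrm_toC gtr0_norm ?ex_gt0 // exN -[ltRHS]invrK ltf_pV2 ?posrE ?invr_gt0 ?ex_gt0 //.
by have := ex_ge1D (r k); lra.
Qed.

Lemma floor_ex (x : R) : exists p : int, 0 <= x - p%:~R < 1.
Proof.
exists (Num.floor (x : Rdefinitions.R)).
have := floor_itv (x : Rdefinitions.R) => /andP[h1 h2].
by apply/andP; split; [rewrite subr_ge0|rewrite ltrBlDl -[X in _ + X]/(1%:~R) -intrD].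
Qed.

Lemma om_natr (x : R) : om (fun k => x < k%:R).
Proof.
have [p /andP[_ hp]] := floor_ex x.
apply: (om_ev (k0 := (`|p|).+1)) => k hk.
have h1 : x < (p + 1)%:~R by rewrite intrD; lra.
apply: lt_le_trans h1 _; rewrite -[k%:R]/((k%:Z)%:~R) ler_int; lia.
Qed.

(* The fractional parts of [q * l i] converge along the ultrafilter, so two
   multiples of [l] nearly agree modulo 1. *)
Lemma integer_approx N (l : 'I_N -> R) (e : R) : 0 < e ->
  exists (q : nat) (p : 'I_N -> int), (0 < q)%N /\
    forall i, `|q%:R * l i - (p i)%:~R| < e.
Proof.
move=> e0.
have [p hp] := choice (fun qi : nat * 'I_N => floor_ex (qi.1%:R * l qi.2)).
have hc i : exists c : R, forall e : R, 0 < e -> om (fun q => `|q%:R * l i - (p (q, i))%:~R - c| < e).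
  apply: (@om_bounded_lim _ 1); apply: filtT => q.
  by have /andP[/= h1 h2] := hp (q, i); rewrite ger0_norm //; apply: ltW.
have [c hc'] := choice hc.
have e2 : 0 < e / 2 by lra.
have hq : om (fun q => forall i, `|q%:R * l i - (p (q, i))%:~R - c i| < e / 2).
  by apply: filt_forall => i; apply: hc'.
have [q1 _ h1] := om_ex hq 0%N.
have [q2 q12 h2] := om_ex hq q1.+1.
exists (q2 - q1)%N, (fun i => p (q2, i) - p (q1, i)); split; first by rewrite subn_gt0.
move=> i; rewrite natrB 1?ltnW // intrD rmorphN /=.
by have := h1 i; have := h2 i; rewrite !ltr_norml; lra.
Qed.

(** Real counterpart of [wdot]: multiplying each coordinate by [ex (l i)] multiplies the monomial of
    exponent [m] by [ex (pairR l m)]. *)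
Definition pairR N (l : 'I_N -> R) (m : 'X_{1..N}) : R := \sum_(i < N) l i * (m i)%:R.

Lemma positive_gap (T : eqType) (s : seq T) (f : T -> R) :
  exists g, 0 < g /\ forall x, x \in s -> 0 < f x -> g <= f x.
Proof.
elim: s => [|x s [g [g0 h]]]; first by exists 1.
exists (if 0 < f x then Num.min g (f x) else g); split.
  by case: ifP => // h1; rewrite lt_min g0 h1.
move=> z; rewrite inE => /orP[/eqP -> h1|zs h1].
  by rewrite h1 ge_min lexx orbT.
by case: ifP => _; rewrite ?ge_min h.
Qed.

(** A multiple [q * l] is so close to an integer vector [w] that pairings with exponents of [M] move
    by less than one half and by less than half the smallest gap. Equal pairings then give integers
    at distance below 1, and strict inequalities survive. *)
Lemma integer_weight N (l : 'I_N -> R) (M : seq 'X_{1..N}) :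
  exists w : 'I_N -> int, forall m m', m \in M -> m' \in M ->
    (pairR l m = pairR l m' -> \sum_i w i * (m i)%:Z = \sum_i w i * (m' i)%:Z) /\
    (pairR l m < pairR l m' -> \sum_i w i * (m i)%:Z < \sum_i w i * (m' i)%:Z).
Proof.
have [g [g0 hg]] := positive_gap [seq (m, m') | m <- M, m' <- M]
  (fun p => pairR l p.2 - pairR l p.1).
(* [B] bounds the degree of every exponent in [M], hence the factor by which a coordinatewise error
   is amplified in a pairing. *)
pose B : R := (\sum_(m <- M) mdeg m)%:R.
have B0 : 0 <= B by [].
pose h := Num.min g 1.
have h0 : 0 < h by rewrite lt_min g0 ltr01.
have e0 : 0 < h / (2 * B + 1) by apply: divr_gt0 => //; lra.
have eB : h / (2 * B + 1) * B * 2 < h.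
  rewrite -2!mulrA gtr_pMr // mulrC ltr_pdivrMr; lra.
have [q [w [q0 hw]]] := integer_approx l e0; exists w => m m' mM m'M.
have est m0 : m0 \in M ->
  `|q%:R * pairR l m0 - (\sum_i w i * (m0 i)%:Z)%:~R| <= h / (2 * B + 1) * B.
  move=> m0M.
  have -> : q%:R * pairR l m0 - (\sum_i w i * (m0 i)%:Z)%:~R =
      \sum_i (q%:R * l i - (w i)%:~R) * (m0 i)%:R.
    rewrite rmorph_sum mulr_sumr -sumrB; apply: eq_bigr => i _.
    by rewrite mulrBl rmorphM mulrA.
  apply: le_trans (ler_norm_sum _ _ _) _.
  apply: le_trans (_ : _ <= \sum_i h / (2 * B + 1) * (m0 i)%:R) _.
    by apply: ler_sum => i _; rewrite normrM normr_nat ler_wpM2r // ltW.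
  rewrite -mulr_sumr ler_wpM2l //; first exact: ltW.
  rewrite -natr_sum ler_nat -mdegE.
  by rewrite (big_rem m0) //= leq_addr.
have e1 := est _ mM; have e2 := est _ m'M.
have hg1 : h <= g by rewrite ge_min lexx.
have h1 : h <= 1 by rewrite ge_min lexx orbT.
split=> hm.
  suff : `|(\sum_i w i * (m i)%:Z) - (\sum_i w i * (m' i)%:Z)| < 1.
    by move: (\sum_i _) (\sum_i _) => a b; clear; lia.
  rewrite -(ltr_int R) intr_norm rmorphB /=.
  by move: e1 e2; rewrite hm !ler_norml ltr_norml; lra.
rewrite -(ltr_int R).
have gm : g <= pairR l m' - pairR l m.
  by apply: (hg (m, m')); [apply: allpairs_f|rewrite subr_gt0].
have : pairR l m' - pairR l m <= q%:R * (pairR l m' - pairR l m).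
  by rewrite ler_peMl ?ler1n // subr_ge0 ltW.
by move: e1 e2; rewrite mulrBr !ler_norml; lra.
Qed.

Lemma rbounded_ext r s : r =1 s -> rbounded r -> rbounded s.
Proof. by move=> /funext ->. Qed.

Lemma toinfty_ext r s : r =1 s -> toinfty r -> toinfty s.
Proof. by move=> /funext ->. Qed.

Lemma rboundedN r : rbounded r -> rbounded (fun k => - r k).
Proof. by move=> [B hB]; exists B; apply: filtS hB => k; rewrite normrN. Qed.

Lemma pairR0 N (l : 'I_N -> R) : pairR l 0%MM = 0.
Proof. by rewrite /pairR big1 // => i _; rewrite mnm0E mulr0. Qed.

Lemma pairRU N (l : 'I_N -> R) i : pairR l U_(i)%MM = l i.
Proof.
rewrite /pairR (bigD1 i) //= mnm1E eqxx mulr1 big1 ?addr0 // => j ji.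
by rewrite mnm1E eq_sym (negbTE ji) mulr0.
Qed.

Lemma tropical_diff N (l1 l2 : 'I_N -> R) m :
  pairR (fun i => l1 i - l2 i) m = pairR l1 m - pairR l2 m.
Proof. by rewrite /pairR -sumrB; apply: eq_bigr => i _; rewrite mulrBl. Qed.

(* Bounded differences [<m' - m, L k>] are killed by a bounded correction of
   [L], namely a pseudo-inverse applied to the vector of bounded differences. *)
Lemma tropical_projection N (L : nat -> 'I_N -> R) (M : seq 'X_{1..N}) :
  exists e : nat -> 'I_N -> R, (forall i, rbounded (fun k => e k i)) /\
  forall m m', m \in M -> m' \in M ->
    let d k := pairR (L k) m' - pairR (L k) m in
    let d' k := pairR (fun i => L k i - e k i) m' - pairR (fun i => L k i - e k i) m in
    [\/ rbounded d /\ (forall k, d' k = 0), toinfty d /\ toinfty d' |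
        toinfty (fun k => - d k) /\ toinfty (fun k => - d' k)].
Proof.
pose D := [seq (m, m') | m <- M, m' <- M].
pose bnd (p : 'X_{1..N} * 'X_{1..N}) := rbounded (fun k => pairR (L k) p.2 - pairR (L k) p.1).
pose nD := size D; pose v (j : 'I_nD) := tnth (in_tuple D) j.
pose A : 'M[R]_(N, nD) := \matrix_(i, j)
  if `[< bnd (v j) >] then ((v j).2 i)%:R - ((v j).1 i)%:R else 0.
pose Lr k : 'rV[R]_N := \row_i L k i.
pose e k i : R := (Lr k *m A *m pinvmx A) ord0 i.
have eb i : rbounded (fun k => e k i).
  apply: (@rbounded_ext (fun k => \sum_j (Lr k *m A) ord0 j * pinvmx A j i)).
    by move=> k; rewrite /e mxE.
  apply: rbounded_sum => j; apply: rboundedM.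
  have [bj|nbj] := pselect (bnd (v j)).
    have [B hB] := bj; exists B; apply: filtS hB => k; rewrite mxE.
    congr (`| _ | <= _); rewrite /pairR -sumrB; apply: eq_bigr => i' _.
    by rewrite !mxE asboolT // mulrBr.
  exists 0; apply: filtT => k; rewrite mxE big1 ?normr0 // => i' _.
  by rewrite !mxE asboolF // mulr0.
exists e; split=> // m m' mM m'M d d'.
have dd' k : d' k = d k - (pairR (e k) m' - pairR (e k) m).
  by rewrite /d /d' !tropical_diff; ring.
have db : rbounded (fun k => - (pairR (e k) m' - pairR (e k) m)).
  apply: rboundedN.
  apply: (@rbounded_ext (fun k => \sum_i e k i * ((m' i)%:R - (m i)%:R))).
    by move=> k; rewrite /pairR -sumrB; apply: eq_bigr => i _; rewrite mulrBr.
  by apply: rbounded_sum => i; apply: rboundedM.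
have [bd|[i1|i2]] := rbounded_trichotomy d.
- constructor 1; split=> // k.
  have pD : (m, m') \in D by apply: allpairs_f.
  have jlt : (index (m, m') D < nD)%N by rewrite index_mem.
  pose j := Ordinal jlt.
  have vj : v j = (m, m') by rewrite /v (tnth_nth (m, m')) /= nth_index.
  have bj : bnd (v j) by rewrite /bnd vj.
  have : (Lr k *m A *m pinvmx A *m A) ord0 j = (Lr k *m A) ord0 j.
    by rewrite mulmxKpV ?submxMl.
  rewrite dd' /d mxE [RHS]mxE => h; apply/eqP; rewrite subr_eq0 eq_sym; apply/eqP.
  move: h; under eq_bigr do rewrite [A _ _]mxE asboolT // vj mulrBr.
  under [X in _ = X -> _]eq_bigr do rewrite [A _ _]mxE asboolT // vj mulrBr [Lr _ _ _]mxE.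
  by rewrite !sumrB.
- constructor 2; split=> //; apply: toinfty_ext (toinftyD i1 db) => k.
  by rewrite dd'.
- constructor 3; split=> //.
  apply: toinfty_ext (toinftyD i2 (rboundedN db)) => k.
  by rewrite /= dd'; ring.
Qed.

(** Take [L = - ln |x|] on [act], subtract the bounded correction [e] to get [l], and let [a] be the
    limit of the rescaled points. Every difference of pairings on [M] is now identically 0 or
    infinite in the limit, so a single integer weight [w] records the asymptotic order of all these
    monomials. *)
Lemma tropical_limit N (x : nat -> 'I_N -> C) (y : 'I_N -> C) (act : {set 'I_N})
    (M : seq 'X_{1..N}) :
  (forall i, flim om (fun k => x k i) (y i)) ->
  (forall i, i \in act -> y i = 0) ->
  (forall k i, i \in act -> x k i != 0) ->
  exists (l : nat -> 'I_N -> R) (w : 'I_N -> nat) (a : 'I_N -> C),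
  (forall i, (w i == 0%N) = (i \notin act)) /\
  (forall k i, i \notin act -> l k i = 0) /\
  (forall i, flim om (fun k => x k i * toC (ex (l k i))) (a i)) /\
  (forall i, i \in act -> a i != 0) /\
  (forall m m', m \in M -> m' \in M -> wdot w m = wdot w m' ->
     forall k, pairR (l k) m = pairR (l k) m') /\
  (forall m m', m \in M -> m' \in M -> (wdot w m < wdot w m')%N ->
     toinfty (fun k => pairR (l k) m' - pairR (l k) m)).
Proof.
move=> xy y0 x0.
have hL0 (ki : nat * 'I_N) : exists r : R,
    if ki.2 \in act then nrm (x ki.1 ki.2) * ex r = 1 else r = 0.
  case: ki => k i /=; have [ia|ia] := boolP (i \in act); last by exists 0.
  have nx : 0 < nrm (x k i) by rewrite nrm_gt0 x0.
  have [r hr] : exists r, ex r = (nrm (x k i))^-1 by apply: ex_surj; rewrite invr_gt0.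
  by exists r; rewrite hr mulfV // gt_eqF.
have [L hL] := choice hL0.
(* With the exponents 0 and [U_(i)] included, comparing a coordinate with the constant monomial
   forces [l] and [w] to vanish off [act] and [w] to be positive on [act]. *)
pose M' := 0%MM :: [seq U_(i)%MM | i <- enum 'I_N] ++ M.
have M0 : 0%MM \in M' by rewrite mem_head.
have MU i : U_(i)%MM \in M' by rewrite inE mem_cat map_f ?orbT ?mem_enum.
have MM m : m \in M -> m \in M' by move=> mM; rewrite inE mem_cat mM !orbT.
have [e [eb he]] := tropical_projection (fun k i => L (k, i)) M'.
pose l k i := L (k, i) - e k i.
(* At one suitable index [ks] all the diverging differences are already positive, while the bounded
   ones vanish at every index. The vector [l ks] thus orders [M'] exactly as the whole sequence does
   asymptotically. *)
have [ks hk1] : exists ks, forall p, p \in [seq (m, m') | m <- M', m' <- M'] ->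
   toinfty (fun k => pairR (l k) p.2 - pairR (l k) p.1) ->
   pairR (l ks) p.1 < pairR (l ks) p.2.
  have h p : p \in [seq (m, m') | m <- M', m' <- M'] -> om (fun ks =>
     toinfty (fun k => pairR (l k) p.2 - pairR (l k) p.1) ->
     pairR (l ks) p.1 < pairR (l ks) p.2).
    move=> _; have [h|h] := pselect (toinfty (fun k => pairR (l k) p.2 - pairR (l k) p.1)).
      by apply: filtS (h 1) => k hk _; lra.
    by apply: filtT => k /h.
  by have [ks _ hks] := om_ex (filt_all h) 0%N; exists ks.
have hk m m' : m \in M' -> m' \in M' -> toinfty (fun k => pairR (l k) m' - pairR (l k) m) ->
    pairR (l ks) m < pairR (l ks) m'.
  by move=> mM m'M; apply: (hk1 (m, m')); apply: allpairs_f.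
have [w hw] := integer_weight (l ks) M'.
have negt m m' : toinfty (fun k => - (pairR (l k) m' - pairR (l k) m)) ->
    toinfty (fun k => pairR (l k) m - pairR (l k) m').
  by move=> h B; apply: filtS (h B) => k; rewrite opprB.
have weq m m' : m \in M' -> m' \in M' ->
    \sum_i w i * (m i)%:Z = \sum_i w i * (m' i)%:Z -> forall k, pairR (l k) m = pairR (l k) m'.
  move=> mM m'M E k; have [hw1 hw2] := hw _ _ mM m'M; have [hw3 hw4] := hw _ _ m'M mM.
  case: (he _ _ mM m'M) => [[_ h]|[_ h]|[_ /negt h]].
  - by apply/eqP; rewrite eq_sym -subr_eq0; apply/eqP; exact: h.
  - by have /hw2 := hk _ _ mM m'M h; rewrite E ltxx.
  - by have /hw4 := hk _ _ m'M mM h; rewrite E ltxx.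
have wlt m m' : m \in M' -> m' \in M' ->
    \sum_i w i * (m i)%:Z < \sum_i w i * (m' i)%:Z ->
    toinfty (fun k => pairR (l k) m' - pairR (l k) m).
  move=> mM m'M E; have [hw1 hw2] := hw _ _ mM m'M; have [hw3 hw4] := hw _ _ m'M mM.
  case: (he _ _ mM m'M) => [[_ h]|[_ h]|[_ /negt h]] //.
  - have /hw1 E' : pairR (l ks) m = pairR (l ks) m'.
      by apply/eqP; rewrite eq_sym -subr_eq0; apply/eqP; exact: h.
    by move: E; rewrite E' ltxx.
  - by have /hw4 := hk _ _ m'M mM h; move=> /(lt_trans E); rewrite ltxx.
have wU i : \sum_j w j * ((U_(i)%MM : 'X_{1..N}) j)%:Z = w i.
  rewrite (bigD1 i) //= mnm1E eqxx mulr1 big1 ?addr0 // => j ji.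
  by rewrite mnm1E eq_sym (negbTE ji) mulr0.
have w0 : \sum_j w j * ((0%MM : 'X_{1..N}) j)%:Z = 0.
  by rewrite big1 // => j _; rewrite mnm0E mulr0.
have lna k i : i \notin act -> l k i = 0.
  move=> ia; have Li k' : L (k', i) = 0 by have := hL (k', i); rewrite /= (negbTE ia).
  case: (he _ _ M0 (MU i)) => [[_ h]|[h _]|[h _]].
  - by have := h k; rewrite pairRU pairR0 subr0.
  - have [k' _] := om_ex (h 1) 0%N; rewrite pairRU pairR0 Li; lra.
  - have [k' _] := om_ex (h 1) 0%N; rewrite pairRU pairR0 Li; lra.
have Linf i : i \in act -> toinfty (fun k => L (k, i)).
  move=> ia B; have := xy i; rewrite (y0 _ ia) => /(_ _ (ex_gt0 (- B))).
  apply: filtS => k; rewrite subr0 => hx.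
  have := hL (k, i); rewrite /= ia => h1; rewrite leNgt; apply/negP => /ltr_ex hB.
  have : nrm (x k i) * ex (L (k, i)) < ex (- B) * ex B.
    by apply: ltr_pM => //; [exact: nrm_ge0|exact: ltW (ex_gt0 _)].
  by rewrite h1 -exD addNr ex0 ltxx.
have wact i : i \in act -> 0 < w i.
  move=> ia.
  have [_] := hw _ _ M0 (MU i); rewrite w0 wU; apply; apply: hk => //.
  case: (he _ _ M0 (MU i)) => [[h _]|[_ h]|[h _]] //; exfalso.
  - have [B hB] := h; apply: (toinfty_unbounded (Linf i ia)); exists B.
    by apply: filtS hB => k; rewrite pairRU pairR0 subr0.
  - apply: (toinftyN (Linf i ia)).
    by apply: toinfty_ext h => k; rewrite pairRU pairR0 subr0.
have wnact i : i \notin act -> w i = 0.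
  move=> ia; have [+ _] := hw _ _ M0 (MU i); rewrite w0 wU => /(_ _)/esym; apply; rewrite pairRU pairR0 lna //.
have wabs i : (`|w i|%N)%:Z = w i.
  have [/wact wi|/wnact ->//] := boolP (i \in act).
  by rewrite gez0_abs // ltW.
have wdotE m : (wdot (fun i => `|w i|%N) m)%:Z = \sum_i w i * (m i)%:Z.
  rewrite /wdot -natz natr_sum; apply: eq_bigr => i _.
  by rewrite natrM !natz wabs.
have exa i : exists b : C, flim om (fun k => x k i * toC (ex (l k i))) b /\
    (i \in act -> b != 0).
  have [ia|ia] := boolP (i \in act); last first.
    exists (y i); split=> //; apply: flim_ext (xy i) => k.
    by rewrite lna // ex0 rmorph1 mulr1.
  (* The rescaled coordinate has modulus exactly [ex (- e k i)], which is bounded and bounded away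
     from 0; hence it has a limit and that limit is nonzero. *)
  have nx k : nrm (x k i * toC (ex (l k i))) = ex (- e k i).
    rewrite nrmM nrm_toC gtr0_norm ?ex_gt0 // /l exD mulrA.
    by have := hL (k, i); rewrite /= ia => ->; rewrite mul1r.
  have [B hB] := eb i.
  have [b hb] : exists b : C, flim om (fun k => x k i * toC (ex (l k i))) b.
    apply: (@om_flim _ (ex B)); apply: filtS hB => k; rewrite nx ler_norml => /andP[h1 h2].
    by apply: ler_ex; lra.
  exists b; split=> // _; apply/eqP => b0.
  have [k _ [h1 h2]] := om_ex (filtI hB (hb _ (ex_gt0 (- B)))) 0%N.
  move: h2; rewrite b0 subr0 nx ltNge => /negP; apply; apply: ler_ex.
  by move: h1; rewrite ler_norml => /andP[]; lra.
have [a ha] := choice exa.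
exists l, (fun i => `|w i|%N), a; do !split.
- move=> i; rewrite absz_eq0.
  have [/wact wi|/wnact ->//] := boolP (i \in act).
  by rewrite gt_eqF.
- exact: lna.
- by move=> i; have [] := ha i.
- by move=> i; have [] := ha i.
- move=> m m' /MM mM /MM m'M E; apply: weq => //.
  by rewrite -!wdotE E.
- move=> m m' /MM mM /MM m'M E; apply: wlt => //.
  by rewrite -!wdotE ltz_nat.
Qed.

(** * Initial forms of polynomials *)

Definition mfilter N (p : pred 'X_{1..N}) (F : {mpoly C[N]}) : {mpoly C[N]} :=
  \sum_(m <- msupp F | p m) F@_m *: 'X_[m].

(** The quasi-homogeneous component of weight [d]; when [d] is the least weight on the support, it
    is the initial form. *)
Definition wpart N (w : 'I_N -> nat) (d : nat) (F : {mpoly C[N]}) :=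
  mfilter (fun m => wdot w m == d) F.

Lemma mfilter_coeff N (p : pred 'X_{1..N}) F m :
  (mfilter p F)@_m = if p m then F@_m else 0.
Proof.
rewrite /mfilter raddf_sum /=.
under eq_bigr do rewrite mcoeffZ mcoeffX.
have [mF|mF] := boolP (m \in msupp F); last first.
  rewrite (memN_msupp_eq0 mF) if_same big_seq_cond big1 // => m' /andP[m'F _].
  case: eqP => [E|_]; last by rewrite mulr0.
  by move: mF; rewrite -E m'F.
rewrite big_mkcond (bigD1_seq m) //= eqxx mulr1 big1 ?addr0 // => m' m'm.
by rewrite (negbTE m'm) mulr0 if_same.
Qed.

Lemma mfilter_supp N (p : pred 'X_{1..N}) F m :
  (m \in msupp (mfilter p F)) = p m && (m \in msupp F).
Proof. by rewrite !mcoeff_msupp mfilter_coeff; case: (p m); rewrite ?eqxx. Qed.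

Lemma mfilter_filter N (p q : pred 'X_{1..N}) F :
  mfilter p (mfilter q F) = mfilter (fun m => p m && q m) F.
Proof.
by apply/mpolyP => m; rewrite !mfilter_coeff; case: (p m); case: (q m).
Qed.

Lemma eq_mfilter N (p q : pred 'X_{1..N}) F :
  (forall m, m \in msupp F -> p m = q m) -> mfilter p F = mfilter q F.
Proof.
move=> h; apply/mpolyP => m; rewrite !mfilter_coeff.
have [/h -> //|/memN_msupp_eq0 ->] := boolP (m \in msupp F).
by rewrite !if_same.
Qed.

Lemma mfilterX N (p : pred 'X_{1..N}) m :
  mfilter p 'X_[m] = if p m then 'X_[m] else 0.
Proof.
apply/mpolyP => m'; rewrite mfilter_coeff; case: ifP => [pm'|pm'].
  have [->|mm'] := eqVneq m m'; first by rewrite pm'.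
  by case: ifP; rewrite ?mcoeff0 // mcoeffX (negbTE mm').
case: ifP => [pm|pm]; last by rewrite mcoeff0.
rewrite mcoeffX; case: eqP => // E; by rewrite -E pm in pm'.
Qed.

Lemma mfilter_sum N (p : pred 'X_{1..N}) (I : Type) (s : seq I) (F : I -> {mpoly C[N]}) c :
  mfilter p (\sum_(i <- s) c i *: F i) = \sum_(i <- s) c i *: mfilter p (F i).
Proof.
apply/mpolyP => m; rewrite mfilter_coeff !raddf_sum /=.
case: ifP => pm; last first.
  by rewrite big1 // => i _; rewrite mcoeffZ mfilter_coeff pm mulr0.
by apply: eq_bigr => i _; rewrite !mcoeffZ mfilter_coeff pm.
Qed.

(** The identity and the partial derivatives are both linear, so facts checked on monomials for a
    linear [Th] yield values and gradients at once. *)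
Lemma meval_linear N (Th : {linear {mpoly C[N]} -> {mpoly C[N]}}) (F : {mpoly C[N]}) z :
  (Th F).@[z] = \sum_(m <- msupp F) F@_m * (Th 'X_[m]).@[z].
Proof.
rewrite {1}[F]mpolyE linear_sum raddf_sum /=; apply: eq_bigr => m _.
by rewrite linearZ /= mevalZ.
Qed.

Lemma mevalX_scale N (x : 'I_N -> C) (l : 'I_N -> R) m :
  ('X_[m] : {mpoly C[N]}).@[fun i => x i * toC (ex (l i))] =
  ('X_[m]).@[x] * toC (ex (pairR l m)).
Proof.
rewrite !mevalX /pairR.
under eq_bigr do rewrite exprMn.
rewrite big_split /=; congr (_ * _).
rewrite (big_morph (fun r => toC (ex r)) (id1 := 1) (op1 := *%R)); first last.
- by rewrite ex0 rmorph1.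
- by move=> u v; rewrite exD rmorphM.
apply: eq_bigr => i _; elim: (m i) => [|k IH]; first by rewrite expr0 mulr0 ex0 rmorph1.
by rewrite exprS IH -rmorphM -exD; congr (toC (ex _)); rewrite -[k.+1]addn1 natrD; ring.
Qed.

Lemma pairRD N (l : 'I_N -> R) m m' : pairR l (m + m')%MM = pairR l m + pairR l m'.
Proof.
by rewrite /pairR -big_split /=; apply: eq_bigr => i _; rewrite mnmDE natrD mulrDr.
Qed.

Lemma mderivX_scale N (x : 'I_N -> C) (l : 'I_N -> R) m i :
  (('X_[m] : {mpoly C[N]})^`M(i)).@[fun i => x i * toC (ex (l i))] =
  (('X_[m])^`M(i)).@[x] * toC (ex (pairR l m - l i)).
Proof.
rewrite !mderivX !mevalZ.
have [->|mi] := eqVneq (m i) 0%N; first by rewrite !mul0r.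
rewrite mevalX_scale -mulrA; congr (_ * (_ * toC (ex _))).
have {2}-> : m = (m - U_(i) + U_(i))%MM by rewrite submK // lep1mP.
by rewrite pairRD pairRU addrK.
Qed.

Definition tropical N (M : pred 'X_{1..N}) (x : nat -> 'I_N -> C) (l : nat -> 'I_N -> R)
    (w : 'I_N -> nat) (a : 'I_N -> C) :=
  [/\ forall i, flim om (fun k => x k i * toC (ex (l k i))) (a i),
      forall m m', m \in M -> m' \in M -> wdot w m = wdot w m' ->
        forall k, pairR (l k) m = pairR (l k) m' &
      forall m m', m \in M -> m' \in M -> (wdot w m < wdot w m')%N ->
        toinfty (fun k => pairR (l k) m' - pairR (l k) m)].

(** After multiplication by the factor of [m0], monomials of the same weight keep a constant
    coefficient and those of larger weight are damped by an exponential tending to 0. It is applied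
    with [Th] the identity and [s = 0], and with [Th] the derivative in [i] and [s k = l k i]. *)
Lemma tropical_linear N (M : pred 'X_{1..N}) x l w a
    (Th : {linear {mpoly C[N]} -> {mpoly C[N]}}) (s : nat -> R) (F : {mpoly C[N]}) m0 :
  tropical M x l w a -> {subset msupp F <= M} -> m0 \in msupp F ->
  (forall m, m \in msupp F -> (wdot w m0 <= wdot w m)%N) ->
  (forall k m, (Th 'X_[m]).@[fun i => x k i * toC (ex (l k i))] =
     (Th 'X_[m]).@[x k] * toC (ex (pairR (l k) m - s k))) ->
  flim om (fun k => toC (ex (pairR (l k) m0 - s k)) * (Th F).@[x k])
    (Th (wpart w (wdot w m0) F)).@[a].
Proof.
move=> [ha heq hlt] FM m0F hmin hTh.
pose z k i := x k i * toC (ex (l k i)).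
have -> : (Th (wpart w (wdot w m0) F)).@[a] =
    \sum_(m <- msupp F) (if wdot w m == wdot w m0 then F@_m else 0) * (Th 'X_[m]).@[a].
  rewrite /wpart /mfilter linear_sum raddf_sum /= big_mkcond; apply: eq_bigr => m _.
  by case: ifP => _; rewrite ?mul0r // linearZ /= mevalZ.
apply: (flim_ext (u := fun k => \sum_(m <- msupp F)
    F@_m * toC (ex (- (pairR (l k) m - pairR (l k) m0))) * (Th 'X_[m]).@[z k])).
  move=> k; rewrite meval_linear mulr_sumr; apply: eq_bigr => m _.
  rewrite hTh mulrA mulrCA -mulrA; rewrite -!mulrA; congr (_ * _).
  rewrite mulrCA -rmorphM -exD mulrC; congr (toC (ex _) * _); ring.
apply: flim_sum => m mF _; apply: flimM; last by apply: flim_meval => i; exact: ha.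
have mM := FM _ mF; have m0M := FM _ m0F.
have := hmin _ mF; rewrite leq_eqVlt => /orP[/eqP E|E].
  rewrite E eqxx; apply: flim_ext (flim_cst (F@_m)) => k.
  by rewrite (heq _ _ m0M mM E) subrr oppr0 ex0 rmorph1 mulr1.
rewrite gtn_eqF // -(mulr0 F@_m); apply: flimZ; apply: flim_exN.
exact: hlt.
Qed.

Lemma tropical_eval N (M : pred 'X_{1..N}) x l w a (F : {mpoly C[N]}) m0 :
  tropical M x l w a -> {subset msupp F <= M} -> m0 \in msupp F ->
  (forall m, m \in msupp F -> (wdot w m0 <= wdot w m)%N) ->
  flim om (fun k => toC (ex (pairR (l k) m0)) * F.@[x k]) (wpart w (wdot w m0) F).@[a].
Proof.
move=> h FM m0F hmin.
have := @tropical_linear N M x l w a idfun (fun _ => 0) F m0 h FM m0F hmin.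
move=> /(_ (fun k m => _)) H.
apply: flim_ext (H _) => k; first by rewrite subr0.
by move=> m; rewrite subr0 /= mevalX_scale.
Qed.

Lemma tropical_deriv N (M : pred 'X_{1..N}) x l w a (F : {mpoly C[N]}) m0 i :
  tropical M x l w a -> {subset msupp F <= M} -> m0 \in msupp F ->
  (forall m, m \in msupp F -> (wdot w m0 <= wdot w m)%N) ->
  flim om (fun k => toC (ex (pairR (l k) m0 - l k i)) * (F^`M(i)).@[x k])
    ((wpart w (wdot w m0) F)^`M(i)).@[a].
Proof.
move=> h FM m0F hmin.
apply: (@tropical_linear N M x l w a (mderiv i) (fun k => l k i) F m0 h FM m0F hmin).
by move=> k m; apply: mderivX_scale.
Qed.

Lemma mulX_mderiv N (a : 'I_N -> C) m i :
  a i * (('X_[m] : {mpoly C[N]})^`M(i)).@[a] = (m i)%:R * ('X_[m]).@[a].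
Proof.
rewrite mderivX mevalZ mulrCA.
have [->|mi] := eqVneq (m i) 0%N; first by rewrite !mul0r.
congr (_ * _); have {2}-> : m = (m - U_(i) + U_(i))%MM by rewrite submK // lep1mP.
by rewrite mpolyXD mevalM mevalXU (mulrC (a i)).
Qed.

(** Each monomial of weight [d] is an eigenvector, with eigenvalue [d], of the weighted Euler vector
    field. *)
Lemma wpart_euler N (w : 'I_N -> nat) d (F : {mpoly C[N]}) a :
  \sum_i (w i)%:R * (a i * ((wpart w d F)^`M(i)).@[a]) = d%:R * (wpart w d F).@[a].
Proof.
under eq_bigr => i _ do rewrite (meval_linear (mderiv i)) /= 2!mulr_sumr.
rewrite exchange_big /= [in RHS](meval_linear idfun) mulr_sumr big_seq [RHS]big_seq.
apply: eq_bigr => m; rewrite mfilter_supp => /andP[/eqP wm _].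
rewrite -wm /wdot natr_sum mulr_suml; apply: eq_bigr => i _ /=.
by rewrite (mulrCA (a i)) mulX_mderiv natrM; ring.
Qed.

(** * Linear independence of gradients and its stability *)

(** Linear independence of the rows in [S] restricted to the columns in [cols], stated without
    matrices of size [#|S|] so that index sets can be split and compared freely. *)
Definition indep (p N : nat) (S : {set 'I_p}) (cols : {set 'I_N}) (G : 'I_p -> 'I_N -> C) :=
  forall c : 'I_p -> C, (forall i, i \in cols -> \sum_(j in S) c j * G j i = 0) ->
  forall j, j \in S -> c j = 0.

(** The other columns are set to 0 rather than removed, to agree with [jac_out]. *)
Definition rowsmx (p N : nat) (S : {set 'I_p}) (cols : {set 'I_N}) (G : 'I_p -> 'I_N -> C) :
    'M[C]_(#|S|, N) :=
  \matrix_(j < #|S|, i < N) if i \in cols then G (@enum_val _ (mem S) j) i else 0.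

Lemma indepP p N (S : {set 'I_p}) (cols : {set 'I_N}) G :
  row_free (rowsmx S cols G) <-> indep S cols G.
Proof.
split=> [rf c hc j jS|h].
  pose v : 'rV[C]_#|S| := \row_l c (@enum_val _ (mem S) l).
  have : v *m rowsmx S cols G = 0.
    apply/rowP => i; rewrite !mxE.
    under eq_bigr do rewrite !mxE.
    have [ic|ic] := boolP (i \in cols); last by rewrite big1 // => l _; rewrite mulr0.
    by rewrite -[RHS](hc i ic) [RHS]big_enum_val; apply: eq_bigr.
  move/eqP; rewrite mulmx_free_eq0 // => /eqP /rowP /(_ (enum_rank_in jS j)).
  by rewrite !mxE enum_rankK_in.
apply: inj_row_free => v hv.
(* Extension of the row vector [v] to all indices, by 0 outside [S]. *)
pose c j := \sum_l (@enum_val _ (mem S) l == j)%:R * v ord0 l.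
have cE l : c (@enum_val _ (mem S) l) = v ord0 l.
  rewrite /c (bigD1 l) //= eqxx mul1r big1 ?addr0 // => l' ll'.
  by rewrite (inj_eq enum_val_inj) (negbTE ll') mul0r.
have hc i : i \in cols -> \sum_(j in S) c j * G j i = 0.
  move=> ic; move/rowP: hv => /(_ i); rewrite !mxE => hv.
  rewrite big_enum_val -[RHS]hv; apply: eq_bigr => l _.
  by rewrite cE !mxE ic.
by apply/rowP => l; rewrite mxE -cE; apply: h hc _ (enum_valP _).
Qed.

Section MatrixLimits.
Context {T : Type} {F : (T -> Prop) -> Prop} {FF : filt F}.

Lemma flim_det n (A : T -> 'M[C]_n) (B : 'M[C]_n) :
  (forall i j, flim F (fun x => A x i j) (B i j)) -> flim F (fun x => \det (A x)) (\det B).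
Proof.
move=> h; apply: flim_sum => s _ _; apply: flimZ; apply: flim_prod => i; exact: h.
Qed.

Lemma flim_adj n (A : T -> 'M[C]_n) (B : 'M[C]_n) :
  (forall i j, flim F (fun x => A x i j) (B i j)) ->
  forall i j, flim F (fun x => (\adj (A x)) i j) ((\adj B) i j).
Proof.
move=> h i j; rewrite mxE; apply: (flim_ext (u := fun x => cofactor (A x) j i)).
  by move=> x; rewrite mxE.
apply: flimZ; apply: flim_det => k l; rewrite !mxE.
by apply: flim_ext (h (lift j k) (lift i l)) => x; rewrite !mxE.
Qed.

Lemma flim_mulmx m n q (A : T -> 'M[C]_(m, n)) (D : T -> 'M[C]_(n, q))
    (B : 'M[C]_(m, n)) (E : 'M[C]_(n, q)) :
  (forall i j, flim F (fun x => A x i j) (B i j)) ->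
  (forall i j, flim F (fun x => D x i j) (E i j)) ->
  forall i j, flim F (fun x => (A x *m D x) i j) ((B *m E) i j).
Proof.
move=> h1 h2 i j; rewrite mxE.
apply: (flim_ext (u := fun x => \sum_l A x i l * D x l j)) => [x|]; first by rewrite mxE.
by apply: flim_sum => l _ _; apply: flimM.
Qed.

(** For a right inverse [Q] of [B], the square matrices [A x *m Q] tend to the identity and are
    eventually invertible. Solving in the image of [Q] gives a solution that tends to 0 with the
    right-hand side. *)
Lemma solve_row_free p N (A : T -> 'M[C]_(p, N)) (B : 'M[C]_(p, N)) (r : T -> 'cV[C]_p) :
  row_free B -> (forall i j, flim F (fun x => A x i j) (B i j)) ->
  (forall i j, flim F (fun x => r x i j) 0) ->
  exists u : T -> 'cV[C]_N, (forall i j, flim F (fun x => u x i j) 0) /\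
    F (fun x => row_free (A x) /\ A x *m u x = r x).
Proof.
move=> rf hA hr.
pose Q := pinvmx B; pose G x := A x *m Q.
have BQ : B *m Q = 1%:M by rewrite mulmxVp.
have hG i j : flim F (fun x => G x i j) ((1%:M : 'M[C]_p) i j).
  by rewrite -BQ; apply: flim_mulmx => // *; apply: flim_cst.
have hdet : flim F (fun x => \det (G x)) 1 by rewrite -(det1 C p); apply: flim_det.
(* The inverse is written through the adjugate: its entries have limits by continuity of
   determinants, and the formula defines [u] also where the determinant vanishes. *)
pose u x := Q *m ((\det (G x))^-1 *: (\adj (G x) *m r x)).
have hr' i j : flim F (fun x => r x i j) ((0 : 'cV[C]_p) i j) by rewrite mxE.
exists u; split=> [i j|].
  have -> : (0 : C) = (Q *m (1^-1 *: (\adj (1%:M : 'M[C]_p) *m (0 : 'cV[C]_p)))) i j.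
    by rewrite mulmx0 scaler0 mulmx0 mxE.
  apply: flim_mulmx => [i' j'|i' j']; first exact: flim_cst.
  rewrite mxE; apply: (flim_ext (u := fun x => (\det (G x))^-1 * (\adj (G x) *m r x) i' j')).
    by move=> x; rewrite [RHS]mxE.
  by apply: flimM; [apply: flimV => //; apply: oner_neq0|apply: flim_mulmx => //; apply: flim_adj].
apply: filtS (flim_neq0 hdet (oner_neq0 _)) => x d0; split.
  apply: inj_row_free => v hv.
  have : v *m G x = 0 by rewrite mulmxA hv mul0mx.
  move/(congr1 (fun M => M *m \adj (G x))); rewrite -mulmxA mul_mx_adj mul0mx mul_mx_scalar.
  by move/eqP; rewrite scaler_eq0 (negbTE d0) => /eqP.
rewrite /u mulmxA -/(G x) -scalemxAr mulmxA mul_mx_adj mul_scalar_mx scalerA mulVf //.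
by rewrite scale1r.
Qed.

Lemma solve_indep p N (S : {set 'I_p}) (cols : {set 'I_N}) (G : T -> 'I_p -> 'I_N -> C)
    (G0 : 'I_p -> 'I_N -> C) (r : T -> 'I_p -> C) :
  indep S cols G0 ->
  (forall j i, j \in S -> i \in cols -> flim F (fun x => G x j i) (G0 j i)) ->
  (forall j, j \in S -> flim F (fun x => r x j) 0) ->
  exists u : T -> 'I_N -> C, (forall i, flim F (fun x => u x i) 0) /\
    (forall x i, i \notin cols -> u x i = 0) /\
    F (fun x => indep S cols (G x) /\
      forall j, j \in S -> \sum_i G x j i * u x i = r x j).
Proof.
move=> /indepP rf hG hr.
have hA l i : flim F (fun x => rowsmx S cols (G x) l i) (rowsmx S cols G0 l i).
  rewrite mxE; apply: (flim_ext (u := fun x => if i \in cols then G x (@enum_val _ (mem S) l) i else 0)).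
    by move=> x; rewrite mxE.
  by have [ic|ic] := boolP (i \in cols); [apply: hG => //; apply: enum_valP|apply: flim_cst].
have hr' l (j : 'I_1) : flim F (fun x => (\col_l r x (@enum_val _ (mem S) l)) l j) 0.
  apply: (flim_ext (u := fun x => r x (@enum_val _ (mem S) l))) => [x|]; first by rewrite mxE.
  by apply: hr; apply: enum_valP.
have [u [u0 hu]] := solve_row_free rf hA hr'.
exists (fun x i => if i \in cols then u x i ord0 else 0); split=> [i|].
  by have [ic|ic] := boolP (i \in cols); [exact: u0|exact: flim_cst].
split=> [x i ic|]; first by rewrite (negbTE ic).
apply: filtS hu => x [/indepP rfx ux]; split=> // j jS.
have := congr1 (fun M : 'cV[C]_#|S| => M (enum_rank_in jS j) ord0) ux.
rewrite !mxE enum_rankK_in // => <-; apply: eq_bigr => i _.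
by rewrite mxE enum_rankK_in //; case: ifP; rewrite ?mulr0 ?mul0r.
Qed.

Lemma indep_open p N (S : {set 'I_p}) (cols : {set 'I_N}) (G : T -> 'I_p -> 'I_N -> C)
    (G0 : 'I_p -> 'I_N -> C) :
  indep S cols G0 ->
  (forall j i, j \in S -> i \in cols -> flim F (fun x => G x j i) (G0 j i)) ->
  F (fun x => indep S cols (G x)).
Proof.
move=> h hG.
have [u [_ [_ hu]]] := solve_indep (r := fun _ _ => 0) h hG (fun _ _ => flim_cst 0).
by apply: filtS hu => x [].
Qed.
End MatrixLimits.

Lemma indep_rinv p N (S : {set 'I_p}) (cols : {set 'I_N}) (G : 'I_p -> 'I_N -> C) :
  indep S cols G ->
  exists Q : 'I_N -> 'I_p -> C, (forall i j, i \notin cols -> Q i j = 0) /\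
    forall j j', j \in S -> j' \in S -> \sum_i G j i * Q i j' = (j == j')%:R.
Proof.
move=> /indepP rf; pose Q := pinvmx (rowsmx S cols G).
have BQ : rowsmx S cols G *m Q = 1%:M by rewrite mulmxVp.
exists (fun i j => if i \in cols then \sum_l (@enum_val _ (mem S) l == j)%:R * Q i l else 0).
split=> [i j ic|j j' jS j'S]; first by rewrite (negbTE ic).
have := congr1 (fun M : 'M[C]_#|S| => M (enum_rank_in jS j) (enum_rank_in jS j')) BQ.
rewrite !mxE (inj_in_eq (can_in_inj (enum_rankK_in jS))) // => <-; apply: eq_bigr => i _.
rewrite mxE enum_rankK_in //; case: ifP => _; last by rewrite mulr0 mul0r.
congr (_ * _); rewrite (bigD1 (enum_rank_in jS j')) //= enum_rankK_in // eqxx mul1r.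
rewrite big1 ?addr0 // => l ll'; case: eqP => [E|]; last by rewrite mul0r.
by move: ll'; rewrite -E enum_valK_in eqxx.
Qed.

(** * Curves tangent to the kernel of independent gradients *)

(** Hadamard's lemma as a structure: difference quotients [H i] that restrict to the partial
    derivatives on the diagonal and are continuous there. It takes the place of the mean value
    theorem. *)
Definition hadamard_factors N (F : {mpoly C[N]})
    (H : 'I_N -> ('I_N -> C) -> ('I_N -> C) -> C) :=
  [/\ forall a b, F.@[a] - F.@[b] = \sum_i H i a b * (a i - b i),
      forall i a, H i a a = (F^`M(i)).@[a] &
      forall (T : Type) (G : (T -> Prop) -> Prop), filt G ->
        forall (a b : T -> 'I_N -> C) x,
        (forall i, flim G (fun t => a t i) (x i)) ->
        (forall i, flim G (fun t => b t i) (x i)) ->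
        forall i, flim G (fun t => H i (a t) (b t)) (H i x x)].

(** The polynomials admitting such factors contain the constants and the variables and are closed
    under sums and products, the product rule giving [H1 * Q(a) + P(b) * H2]. *)
Lemma hadamard N (F : {mpoly C[N]}) : exists H, hadamard_factors F H.
Proof.
have hC c : exists H, hadamard_factors (c%:MP : {mpoly C[N]}) H.
  exists (fun _ _ _ => 0); split=> [a b|i a|T G FG a b x _ _ i].
  - by rewrite !mevalC subrr big1 // => i _; rewrite mul0r.
  - by rewrite mderivC meval0.
  - exact: flim_cst.
have hM (P Q : {mpoly C[N]}) : (exists H, hadamard_factors P H) ->
    (exists H, hadamard_factors Q H) -> exists H, hadamard_factors (P * Q) H.
  move=> [H1 [h1 d1 c1]] [H2 [h2 d2 c2]].
  exists (fun i a b => H1 i a b * Q.@[a] + P.@[b] * H2 i a b).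
  split=> [a b|i a|T G FG a b x ha hb i].
  - rewrite !mevalM.
    have -> : P.@[a] * Q.@[a] - P.@[b] * Q.@[b] =
      (P.@[a] - P.@[b]) * Q.@[a] + P.@[b] * (Q.@[a] - Q.@[b]) by ring.
    rewrite h1 h2 mulr_suml mulr_sumr -big_split /=; apply: eq_bigr => i _; ring.
  - by rewrite d1 d2 mderivM mevalD !mevalM.
  - by apply: flimD; apply: flimM; [exact: c1|exact: flim_meval|exact: flim_meval|exact: c2].
have hD (P Q : {mpoly C[N]}) : (exists H, hadamard_factors P H) ->
    (exists H, hadamard_factors Q H) -> exists H, hadamard_factors (P + Q) H.
  move=> [H1 [h1 d1 c1]] [H2 [h2 d2 c2]].
  exists (fun i a b => H1 i a b + H2 i a b).
  split=> [a b|i a|T G FG a b x ha hb i].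
  - rewrite !mevalD opprD addrACA h1 h2 -big_split /=; apply: eq_bigr => i _; ring.
  - by rewrite d1 d2 mderivD mevalD.
  - by apply: flimD; [exact: c1|exact: c2].
have hX i : exists H, hadamard_factors ('X_i : {mpoly C[N]}) H.
  exists (fun j _ _ => (i == j)%:R); split=> [a b|j a|T G FG a b x _ _ j].
  - rewrite !mevalXU (bigD1 i) //= eqxx mul1r big1 ?addr0 // => j /negbTE ij.
    by rewrite eq_sym ij mul0r.
  - rewrite mderivX mnm1E; case: eqP => [->|_]; last by rewrite scale0r meval0.
    by rewrite scale1r -{1}[U_(j)%MM]add0m addmK mpolyX0 meval1.
  - exact: flim_cst.
elim/mpolyind: F => [|c m P _ _ hP]; first exact: (hC 0).
apply: (hD _ _ _ hP); rewrite -mul_mpolyC; apply: (hM); first exact: hC.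
rewrite mpolyXE_id; apply: (big_ind (fun P => exists H, hadamard_factors P H)).
- exact: (hC 1).
- exact: hM.
- move=> i _; elim: (m i) => [|k IH]; first exact: (hC 1).
  by rewrite exprS; apply: (hM _ _ (hX i) IH).
Qed.

(** The neighbourhood filter of the diagonal point [(x, x)]. *)
Definition near2 N (x : 'I_N -> C) (P : ('I_N -> C) * ('I_N -> C) -> Prop) :=
  exists r : R, 0 < r /\ forall a b, (forall i, nrm (a i - x i) < r) ->
    (forall i, nrm (b i - x i) < r) -> P (a, b).

#[local] Instance near2_filter N (x : 'I_N -> C) : filt (near2 x).
Proof.
split=> [|P Q [r [r0 hr]] [s [s0 hs]]|P Q PQ [r [r0 hr]]].
- by exists 1; split=> //; apply: ltr01.
- exists (Num.min r s); split=> [|a b ha hb]; first by rewrite lt_min r0.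
  split; [apply: hr|apply: hs] => i; have := ha i; have := hb i; rewrite !lt_min.
  + by move=> _ /andP[]. + by move=> /andP[]. + by move=> _ /andP[]. + by move=> /andP[].
- by exists r; split=> // a b ha hb; apply: PQ; apply: hr.
Qed.

Lemma near2_fst N (x : 'I_N -> C) i : flim (near2 x) (fun ab => ab.1 i) (x i).
Proof. by move=> e e0; exists e; split=> // a b ha _; apply: ha. Qed.

Lemma near2_snd N (x : 'I_N -> C) i : flim (near2 x) (fun ab => ab.2 i) (x i).
Proof. by move=> e e0; exists e; split=> // a b _ hb; apply: hb. Qed.

Lemma nrm_le_sum (I : finType) (c : I -> C) i : nrm (c i) <= \sum_j nrm (c j).
Proof. by rewrite (bigD1 i) //= lerDl; apply: sumr_ge0 => j _; apply: nrm_ge0. Qed.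

(* Picard iteration [c <- c - g c], with [g c = F (x + s v + Q c)] restricted
   to [S]; [Q] is a right inverse of the gradient, so [1 - Dg] is small. *)
Lemma picard_zero p N (S : {set 'I_p}) (F : 'I_p -> {mpoly C[N]})
    (Q : 'I_N -> 'I_p -> C) (x0 : 'I_N -> C) (B : R)
    (H : 'I_p -> 'I_N -> ('I_N -> C) -> ('I_N -> C) -> C) :
  let A (c : 'I_p -> C) i := x0 i + \sum_j Q i j * c j in
  (forall j, hadamard_factors (F j) (H j)) ->
  (forall c c', \sum_j nrm (c j) <= 2 * B -> \sum_j nrm (c' j) <= 2 * B ->
    forall j l, j \in S -> l \in S ->
    nrm (\sum_i H j i (A c) (A c') * Q i l - (j == l)%:R) <= (2 * p.+1%:R)^-1) ->
  \sum_(j in S) nrm ((F j).@[x0]) <= B ->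
  exists c, (forall j, nrm (c j) <= 2 * B) /\ forall j, j \in S -> (F j).@[A c] = 0.
Proof.
move=> A hH hsmall hB.
pose g c j := if j \in S then (F j).@[A c] else 0.
pose c := fix c (n : nat) : 'I_p -> C :=
  if n is m.+1 then fun j => c m j - g (c m) j else fun _ => 0.
have B0 : 0 <= B by apply: le_trans hB; apply: sumr_ge0 => j _; apply: nrm_ge0.
have A0 : A (c 0%N) = x0.
  by apply/funext => i; rewrite /A big1 ?addr0 // => j _; rewrite /= mulr0.
have cS n j : j \notin S -> c n j = 0.
  by move=> /negbTE jS; elim: n => //= n ->; rewrite /g jS subr0.
(* The residual halves at each step, so the total displacement is bounded by a geometric series of
   sum [2 * B]. *)
have inv n : \sum_j nrm (c n j) <= 2 * B * (1 - 2 ^- n) /\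
    \sum_j nrm (g (c n) j) <= B * 2 ^- n.
  elim: n => [|n [IH1 IH2]].
    rewrite expr0 invr1 subrr mulr0 mulr1; split.
      by rewrite big1 // => j _; rewrite nrm0.
    apply: le_trans hB; rewrite [leRHS]big_mkcond /=; apply: ler_sum => j _.
    by rewrite /g A0; case: ifP; rewrite ?nrm0.
  have p2 : (0 : R) < 2 ^- n by rewrite invr_gt0 exprn_gt0.
  have e2 : (2 : R) ^- n.+1 = 2 ^- n / 2 by rewrite exprS invfM mulrC.
  have c1 : \sum_j nrm (c n.+1 j) <= 2 * B * (1 - 2 ^- n.+1).
    apply: le_trans (_ : _ <= \sum_j (nrm (c n j) + nrm (g (c n) j))) _.
      by apply: ler_sum => j _; rewrite /= -[nrm (g _ _)]nrmN; apply: nrmD.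
    rewrite big_split /= e2; lra.
  split=> //.
  have bnd m : \sum_j nrm (c m j) <= 2 * B * (1 - 2 ^- m) -> \sum_j nrm (c m j) <= 2 * B.
    move/le_trans; apply; rewrite -[leRHS]mulr1 ler_wpM2l //; first lra.
    by rewrite lerBlDr lerDl invr_ge0 exprn_ge0.
  (* By the Hadamard factors, a step changes [F j] by minus the matrix [H Q] applied to the old
     residual; only the deviation of this matrix from the identity remains. *)
  have E j : j \in S -> g (c n.+1) j = - \sum_(l in S)
      (\sum_i H j i (A (c n.+1)) (A (c n)) * Q i l - (j == l)%:R) * g (c n) l.
    move=> jS; have [hd _ _] := hH j.
    rewrite {1}/g jS -[X in X = _](subrK (F j).@[A (c n)]) hd.
    have dA i : A (c n.+1) i - A (c n) i = - \sum_(l in S) Q i l * g (c n) l.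
      rewrite /A opprD addrACA subrr add0r -sumrB -sumrN [RHS]big_mkcond /=.
      apply: eq_bigr => l _; rewrite /g; case: ifP => _; ring.
    under eq_bigr do rewrite dA mulrN mulr_sumr.
    rewrite sumrN exchange_big /=.
    have -> : (F j).@[A (c n)] = \sum_(l in S) (j == l)%:R * g (c n) l.
      rewrite (bigD1 j) //= eqxx mul1r big1 ?addr0 => [|l /andP[_ /negbTE lj]].
        by rewrite /g jS.
      by rewrite eq_sym lj mul0r.
    rewrite addrC -opprB; congr (- _); rewrite -sumrB; apply: eq_bigr => l _.
    rewrite mulrBl mulr_suml; congr (_ - _); apply: eq_bigr => i _; ring.
  have Eb j : nrm (g (c n.+1) j) <= (2 * p.+1%:R)^-1 * \sum_l nrm (g (c n) l).
    have [jS|jS] := boolP (j \in S); last first.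
      rewrite /g (negbTE jS) nrm0 mulr_ge0 ?invr_ge0 ?mulr_ge0 //.
      by apply: sumr_ge0 => l _; apply: nrm_ge0.
    rewrite E // nrmN; apply: le_trans (nrm_sum _ _ _) _.
    rewrite mulr_sumr big_mkcond; apply: ler_sum => l _ /=.
    case: ifP => lS; last by rewrite mulr_ge0 ?nrm_ge0 // invr_ge0 mulr_ge0.
    rewrite nrmM ler_wpM2r ?nrm_ge0 //; apply: hsmall => //.
      exact: (bnd n.+1).
    exact: (bnd n).
  apply: le_trans (ler_sum _ (fun j _ => Eb j)) _.
  rewrite e2 sumr_const card_ord -[X in X <= _]mulr_natl.
  (* Summing the [p] bounds gives the factor [p / (p + 1)] times one half; the successor keeps the
     denominator nonzero when [p] is 0. *)
  have -> : p%:R * ((2 * p.+1%:R)^-1 * \sum_l nrm (g (c n) l)) =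
     (p%:R / p.+1%:R) * ((\sum_l nrm (g (c n) l)) / 2) :> R.
    have : p.+1%:R != 0 :> R by rewrite pnatr_eq0.
    by move: (p.+1%:R) (p%:R) (\sum_l _) => a b d a0; field.
  have q1 : p%:R / p.+1%:R <= 1 :> R by rewrite ler_pdivrMr ?ltr0Sn // mul1r ler_nat.
  have s0 : 0 <= \sum_l nrm (g (c n) l) by apply: sumr_ge0 => l _; apply: nrm_ge0.
  apply: le_trans (_ : _ <= 1 * ((\sum_l nrm (g (c n) l)) / 2)) _; last lra.
  by apply: ler_wpM2r => //; lra.
have cb n j : nrm (c n j) <= 2 * B.
  apply: le_trans (nrm_le_sum _ _) _; have [h _] := inv n; apply: le_trans h _.
  rewrite -[leRHS]mulr1 ler_wpM2l //; first lra.
  by rewrite lerBlDr lerDl invr_ge0 exprn_ge0.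
(* Boundedness alone provides a limit along [om]; it is a zero by continuity, because the residuals
   tend to 0. *)
have [cl hcl] := choice (fun j => om_flim (filtT (F := om) (fun n => cb n j))).
exists cl; split=> [j|j jS].
  by apply: (flim_le_nrm _ (hcl j)); apply: filtT => n.
have h1 : flim om (fun n => (F j).@[A (c n)]) (F j).@[A cl].
  apply: flim_meval => i; apply: flimD; first exact: flim_cst.
  by apply: flim_sum => l _ _; apply: flimZ.
apply: (flim_unique _ h1) => e e0.
have [n0 hn0] : exists n0 : nat, B / e < n0%:R.
  by have [k _ hk] := om_ex (om_natr (B / e)) 0%N; exists k.
apply: (om_ev (k0 := n0)) => n n0n; rewrite subr0.
have [_ h2] := inv n; have := nrm_le_sum (g (c n)) j; rewrite {1}/g jS => h3.
apply: le_lt_trans (le_trans h3 h2) _.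
rewrite ltr_pdivrMr ?exprn_gt0 // mulrC -ltr_pdivrMr //.
apply: lt_le_trans hn0 _; rewrite -natrX ler_nat.
by apply: leq_trans n0n _; apply: ltnW; apply: ltn_expl.
Qed.

(** As [v] is in the kernel of the gradients, [F] at [x + s v] is small compared with [s]; the
    Picard iteration then restores the equations by a correction of size at most [s * e]. *)
Lemma kernel_curve_step p N (S : {set 'I_p}) (F : 'I_p -> {mpoly C[N]})
    (Q : 'I_N -> 'I_p -> C) (x v : 'I_N -> C) :
  (forall j, j \in S -> (F j).@[x] = 0) ->
  (forall j l, j \in S -> l \in S -> \sum_i ((F j)^`M(i)).@[x] * Q i l = (j == l)%:R) ->
  (forall j, j \in S -> \sum_i ((F j)^`M(i)).@[x] * v i = 0) ->
  forall e : R, 0 < e -> exists (s : R) (c : 'I_p -> C),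
    [/\ 0 < s <= e, forall j, nrm (c j) <= s * e &
     forall j, j \in S -> (F j).@[fun i => x i + toC s * v i + \sum_l Q i l * c l] = 0].
Proof.
move=> Fx hQ hv e e0.
have [H hH] := choice (fun j => hadamard (F j)).
have Hlim j i : flim (near2 x) (fun ab => H j i ab.1 ab.2) ((F j)^`M(i)).@[x].
  by have [_ <- h] := hH j; apply: h; [exact: near2_fst|exact: near2_snd].
pose V : R := \sum_i nrm (v i) + 1.
have V1 : 1 <= V by rewrite /V lerDr; apply: sumr_ge0 => i _; apply: nrm_ge0.
pose P : R := p.+1%:R.
have P1 : 1 <= P by rewrite ler1n.
(* Chosen so that [P * (s * eta * V) = s * e / 2], the bound on the initial residual passed to
   [picard_zero]. *)
pose eta := e / (2 * P * V).
have eta0 : 0 < eta by rewrite divr_gt0 // !mulr_gt0 //; lra.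
have small1 : near2 x (fun ab => forall j i, nrm (H j i ab.1 ab.2 - ((F j)^`M(i)).@[x]) < eta).
  by apply: filt_forall => j; apply: filt_forall => i; apply: Hlim.
have small2 : near2 x (fun ab => forall j l, j \in S -> l \in S ->
    nrm (\sum_i H j i ab.1 ab.2 * Q i l - (j == l)%:R) <= (2 * P)^-1).
  apply: filt_forall => j; apply: filt_forall => l.
  have [jS|jS] := boolP (j \in S); last by apply: filtT.
  have [lS|lS] := boolP (l \in S); last by apply: filtT.
  have h : flim (near2 x) (fun ab => \sum_i H j i ab.1 ab.2 * Q i l) (j == l)%:R.
    by rewrite -hQ //; apply: flim_sum => i _ _; apply: flimM => //; apply: flim_cst.
  have p0 : 0 < (2 * P)^-1 by rewrite invr_gt0; lra.
  by apply: filtS (h _ p0) => ab hab _ _; apply: ltW.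
have [r [r0 hr]] := filtI small1 small2.
pose q : R := \sum_i \sum_l nrm (Q i l).
have q0 : 0 <= q by do 2![apply: sumr_ge0 => ? _]; apply: nrm_ge0.
have qQ i l : nrm (Q i l) <= q.
  apply: le_trans (_ : _ <= \sum_l nrm (Q i l)) _; first exact: (nrm_le_sum (fun l => Q i l)).
  rewrite /q (bigD1 i) //= lerDl; do 2![apply: sumr_ge0 => ? _]; apply: nrm_ge0.
have D0 : 0 < V + q * e + 1 by have := mulr_ge0 q0 (ltW e0); lra.
(* The second bound keeps [x + s v + Q c] in the ball of radius [r], where the Hadamard factors are
   close to the gradients at [x]. *)
pose s := Num.min e (r / (V + q * e + 1)).
have s0 : 0 < s by rewrite lt_min e0 divr_gt0.
have sr : s * V + s * (q * e) < r.
  have : s * (V + q * e + 1) <= r by rewrite -ler_pdivlMr // ge_min lexx orbT.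
  lra.
have vV i : nrm (toC s * v i) <= s * V.
  rewrite nrmM nrm_toC gtr0_norm // ler_pM2l //.
  by apply: le_trans (nrm_le_sum v i) _; rewrite lerDl.
have sqe : 0 <= s * (q * e) by rewrite !mulr_ge0 // ltW.
have inball (c : 'I_p -> C) : \sum_j nrm (c j) <= s * e ->
    forall i, nrm (x i + toC s * v i + \sum_l Q i l * c l - x i) < r.
  move=> hc i; apply: le_lt_trans sr.
  rewrite (_ : _ - _ = toC s * v i + \sum_l Q i l * c l); last by ring.
  apply: le_trans (nrmD _ _) _; apply: lerD => //.
  apply: le_trans (nrm_sum _ _ _) _; rewrite mulrCA.
  apply: le_trans (_ : _ <= \sum_l q * nrm (c l)) _.
    by apply: ler_sum => l _; rewrite nrmM ler_wpM2r ?nrm_ge0.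
  by rewrite -mulr_sumr ler_wpM2l.
have [||c [hc Fc]] := @picard_zero p N S F Q (fun i => x i + toC s * v i) (s * e / 2) H hH.
- have E2 : 2 * (s * e / 2) = s * e by field.
  rewrite E2 => c c' hc hc' j l jS lS.
  have [_ ] := hr _ _ (inball _ hc) (inball _ hc').
  by apply.
- have Fj j : j \in S -> nrm (F j).@[fun i => x i + toC s * v i] <= s * eta * V.
    move=> jS; have [hd _ _] := hH j.
    rewrite -[X in nrm X]subr0 -(Fx j jS) hd.
    have -> : \sum_i H j i (fun i => x i + toC s * v i) x * (x i + toC s * v i - x i) =
       \sum_i (H j i (fun i => x i + toC s * v i) x - ((F j)^`M(i)).@[x]) * (toC s * v i).
      have h : \sum_i ((F j)^`M(i)).@[x] * (toC s * v i) = 0.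
        by under eq_bigr do rewrite mulrCA; rewrite -mulr_sumr hv // mulr0.
      rewrite -[LHS]subr0 -[X in _ - X]h -sumrB; apply: eq_bigr => i _; ring.
    apply: le_trans (nrm_sum _ _ _) _.
    apply: le_trans (_ : _ <= \sum_i s * eta * nrm (v i)) _.
      apply: ler_sum => i _; rewrite !nrmM nrm_toC gtr0_norm // mulrA (mulrC s).
      rewrite ler_wpM2r ?nrm_ge0 // ler_pM2r //; apply: ltW.
      have b1 i' : nrm (x i' + toC s * v i' - x i') < r.
        by rewrite addrAC subrr add0r; have := vV i'; lra.
      have b2 i' : nrm (x i' - x i') < r by rewrite subrr nrm0.
      by have [h _] := hr _ _ b1 b2; apply: h.
    rewrite -mulr_sumr; apply: ler_wpM2l; first by apply: mulr_ge0; exact: ltW.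
    by rewrite /V lerDl.
  have sV0 : 0 <= s * eta * V.
    apply: mulr_ge0; last lra.
    by apply: mulr_ge0; exact: ltW.
  apply: le_trans (_ : _ <= \sum_(j in S) s * eta * V) _; first exact: ler_sum.
  rewrite big_mkcond /=; apply: le_trans (_ : _ <= \sum_(j < p) s * eta * V) _.
    apply: ler_sum => j _; by case: ifP.
  rewrite sumr_const card_ord -[X in X <= _]mulr_natl.
  have -> : s * e / 2 = P * (s * eta * V) by rewrite /eta; field; lra.
  apply: ler_wpM2r => //.
  by rewrite ler_nat.
exists s, c; split.
- by rewrite s0 ge_min lexx.
- by move=> j; apply: le_trans (hc j) _; lra.
- by move=> j jS; apply: Fc.
Qed.

(** The filter of ordinary convergence, the one occurring in [cvg_to]; its limits are also limits
    along [om]. *)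
Definition frechet (P : nat -> Prop) := exists k0, forall k, (k0 <= k)%N -> P k.

#[local] Instance frechet_filter : filt frechet.
Proof.
split=> [|P Q [a ha] [b hb]|P Q PQ [a ha]].
- by exists 0%N.
- exists (maxn a b) => k; rewrite geq_max => /andP[ka kb].
  by split; [exact: ha|exact: hb].
- by exists a => k /ha; apply: PQ.
Qed.

Lemma frechet_om (P : nat -> Prop) : frechet P -> om P.
Proof. by move=> [k0 h]; apply: om_ev h. Qed.

Lemma flim_frechet_om u l : flim frechet u l -> flim om u l.
Proof. by move=> h e e0; apply: frechet_om; apply: h. Qed.

Lemma flim_inv_nat (g : nat -> R) : (forall k, 0 <= g k <= k.+1%:R^-1) ->
  flim frechet (fun k => toC (g k)) 0.
Proof.
move=> hg e e0; have [k0 _ hk0] := om_ex (om_natr e^-1) 0%N.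
exists k0 => k hk; rewrite subr0 nrm_toC; have /andP[g0 g1] := hg k.
rewrite ger0_norm //; apply: le_lt_trans g1 _; rewrite -[ltRHS]invrK ltf_pV2 ?posrE ?invr_gt0 //.
by apply: lt_trans hk0 _; rewrite ltr_nat.
Qed.

(** Applying the previous step with [e = 1 / (m + 1)] realizes any kernel vector as a Bouligand
    tangent vector, with [ts = 1 / s]. The right inverse is supported on [cols], so the other
    coordinates move exactly along [v]; coordinates that must stay 0 therefore do. *)
Lemma kernel_curve p N (S : {set 'I_p}) (cols : {set 'I_N}) (F : 'I_p -> {mpoly C[N]})
    (x v : 'I_N -> C) :
  (forall j, j \in S -> (F j).@[x] = 0) ->
  indep S cols (fun j i => ((F j)^`M(i)).@[x]) ->
  (forall j, j \in S -> \sum_i ((F j)^`M(i)).@[x] * v i = 0) ->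
  exists (xs : nat -> 'I_N -> C) (ts : nat -> R),
    [/\ forall m, 0 < ts m,
     forall m j, j \in S -> (F j).@[xs m] = 0,
     forall m i, i \notin cols -> xs m i = x i + (toC (ts m))^-1 * v i,
     forall i, flim frechet (fun m => xs m i) (x i) &
     forall i, flim frechet (fun m => toC (ts m) * (xs m i - x i)) (v i)].
Proof.
move=> Fx ind hv.
have [Q [Q0 hQ]] := indep_rinv ind.
have e0 (m : nat) : 0 < m.+1%:R^-1 :> R by rewrite invr_gt0.
have [s hs] := choice (fun m => kernel_curve_step Fx hQ hv (e0 m)).
have [c hc] := choice hs.
pose A m i : C := \sum_l Q i l * c m l.
pose q i : R := \sum_l nrm (Q i l).
have nA m i : nrm (A m i) <= q i * (s m * m.+1%:R^-1).
  have [_ h _] := hc m.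
  apply: le_trans (nrm_sum _ _ _) _; rewrite /q mulr_suml; apply: ler_sum => l _.
  by rewrite nrmM ler_wpM2l ?nrm_ge0.
have sb m : 0 < s m <= m.+1%:R^-1 by have [h _ _] := hc m.
have s0 m : 0 < s m by have /andP[] := sb m.
have sC m : toC (s m) != 0 by rewrite toC_eq0 gt_eqF.
have q0 i : 0 <= q i by apply: sumr_ge0 => l _; apply: nrm_ge0.
have slim : flim frechet (fun m => toC (s m)) 0.
  by apply: flim_inv_nat => k; have /andP[h1 h2] := sb k; rewrite ltW.
have ilim : flim frechet (fun m => toC (m.+1%:R^-1)) 0.
  by apply: flim_inv_nat => k; rewrite lexx andbT ltW.
have Dlim i : flim frechet (fun m => (toC (s m))^-1 * A m i) 0.
  apply: (flim_squeeze (g := fun m => q i * m.+1%:R^-1)).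
    rewrite -(mulr0 (toC (q i))); apply: flim_ext (flimZ (toC (q i)) ilim) => m.
    by rewrite rmorphM.
  apply: filtT => m; rewrite subr0 nrmM nrmV nrm_toC gtr0_norm //.
  by rewrite mulrC ler_pdivrMr // -mulrA [_^-1 * _]mulrC.
have Alim i : flim frechet (fun m => A m i) 0.
  rewrite -(mul0r 0); apply: flim_ext (flimM slim (Dlim i)) => m.
  by rewrite mulrA mulfV // mul1r.
exists (fun m i => x i + toC (s m) * v i + A m i), (fun m => (s m)^-1); split.
- by move=> m; rewrite invr_gt0.
- by move=> m j jS; have [_ _ h] := hc m; apply: h.
- move=> m i ic; rewrite /A big1 ?addr0; last by move=> l _; rewrite Q0 // mul0r.
  by rewrite fmorphV invrK.
- move=> i; have := flimD (flimD (flim_cst (x i)) (flimM slim (flim_cst (v i)))) (Alim i).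
  by rewrite mul0r !addr0; apply.
- move=> i; rewrite -[X in flim _ _ X]addr0.
  apply: flim_ext (flimD (flim_cst (v i)) (Dlim i)) => m.
  by rewrite fmorphV; field.
Qed.

(** * The squared norm and coordinatewise convergence *)

Lemma normsqE N (x : 'rV[C]_N) : normsq x = toC (\sum_i nrm (x ord0 i) ^+ 2).
Proof.
by rewrite /normsq rmorph_sum; apply: eq_bigr => i _; rewrite normC_nrm rmorphXn.
Qed.

Lemma normsq_coord N (x : 'rV[C]_N) i (r : R) :
  0 <= r -> normsq x < toC (r ^+ 2) -> nrm (x ord0 i) < r.
Proof.
move=> r0; rewrite normsqE ltr_toC => h; rewrite -(@ltr_pXn2r _ 2) ?nnegrE ?nrm_ge0 //.
apply: le_lt_trans h; rewrite (bigD1 i) //= lerDl; apply: sumr_ge0 => j _.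
by rewrite exprn_ge0 // nrm_ge0.
Qed.

Lemma normsq_small N (e : R) : 0 < e -> exists d : R, 0 < d /\
  forall x : 'rV[C]_N, (forall i, nrm (x ord0 i) < d) -> normsq x < toC e.
Proof.
move=> e0; pose d := Num.min 1 (e / N.+1%:R).
have d0 : 0 < d by rewrite lt_min ltr01 divr_gt0.
exists d; split=> // x hx; rewrite normsqE ltr_toC.
apply: le_lt_trans (_ : \sum_(i < N) (e / N.+1%:R) < e).
  apply: ler_sum => i _; have := hx i; rewrite lt_min => /andP[h1 h2].
  rewrite expr2; apply: le_trans (_ : nrm (x ord0 i) * 1 <= _); last by rewrite mulr1 ltW.
  by rewrite ler_wpM2l ?nrm_ge0 // ltW.
rewrite sumr_const card_ord -[X in X < _]mulr_natr -mulrA gtr_pMr //.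
by rewrite mulrC ltr_pdivrMr // mul1r ltr_nat.
Qed.

Lemma cvg_toP N (u : nat -> 'rV[C]_N) y :
  cvg_to u y <-> forall i, flim frechet (fun k => u k ord0 i) (y ord0 i).
Proof.
split=> [h i e e0|h e' /toC_surj[e e0 ->{e'}]].
  have e2 : 0 < toC (e ^+ 2) by rewrite -(rmorph0 toC) ltr_toC exprn_gt0.
  have [k0 hk] := h _ e2; exists k0 => k /hk hk1.
  by have := normsq_coord i (ltW e0) hk1; rewrite !mxE.
have [d [d0 hd]] := normsq_small N e0.
have [k0 hk0] := filt_forall (F := frechet) (fun i => h i d d0).
by exists k0 => k /hk0 hk; apply: hd => i; rewrite !mxE.
Qed.

(** * Slices and Newton boundaries *)

Definition sproj n (m : 'X_{1..n.+1}) : 'X_{1..n} := [multinom m (lift ord0 i) | i < n].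

(** The parameter [t] has weight 0, so an initial form for this weight keeps every power of [t]. *)
Definition ext0 n (w : 'I_n -> nat) (i : 'I_n.+1) : nat :=
  if unlift ord0 i is Some j then w j else 0%N.

Definition ptf n (t : C) (z : 'I_n -> C) (i : 'I_n.+1) : C :=
  if unlift ord0 i is Some j then z j else t.

Lemma ext0_lift n (w : 'I_n -> nat) j : ext0 w (lift ord0 j) = w j.
Proof. by rewrite /ext0 liftK. Qed.

Lemma ptf_lift n t (z : 'I_n -> C) j : ptf t z (lift ord0 j) = z j.
Proof. by rewrite /ptf liftK. Qed.

Lemma ptf0 n t (z : 'I_n -> C) : ptf t z ord0 = t.
Proof. by rewrite /ptf unlift_none. Qed.

Lemma wdot_ext0 n (w : 'I_n -> nat) m : wdot (ext0 w) m = wdot w (sproj m).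
Proof.
rewrite /wdot big_ord_recl /ext0 unlift_none mul0n add0n.
by apply: eq_bigr => i _; rewrite liftK mnmE.
Qed.

Lemma slice_meval n (F : {mpoly C[n.+1]}) t z : (slice F t).@[z] = F.@[ptf t z].
Proof.
rewrite comp_mpoly_meval; apply: meval_eq => i.
rewrite tnth_mktuple /ptf; case: (unlift ord0 i) => [j|]; first exact: mevalXU.
by rewrite mevalC.
Qed.

Lemma sliceX n (m : 'X_{1..n.+1}) t :
  slice ('X_[m] : {mpoly C[n.+1]}) t = t ^+ m ord0 *: 'X_[sproj m].
Proof.
rewrite /slice comp_mpolyX big_ord_recl tnth_mktuple unlift_none.
rewrite -rmorphXn /= mul_mpolyC; congr (_ *: _).
by rewrite mpolyXE_id; apply: eq_bigr => i _; rewrite tnth_mktuple liftK mnmE.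
Qed.

Lemma sliceE n (F : {mpoly C[n.+1]}) t :
  slice F t = \sum_(m <- msupp F) F@_m *: (t ^+ m ord0 *: 'X_[sproj m]).
Proof.
rewrite {1}[F]mpolyE /slice raddf_sum /=; apply: eq_bigr => m _.
by rewrite comp_mpolyZ -sliceX.
Qed.

Lemma slice_deriv n (F : {mpoly C[n.+1]}) t i :
  (slice F t)^`M(i) = slice (F^`M(lift ord0 i)) t.
Proof.
have -> : F^`M(lift ord0 i) = \sum_(m <- msupp F) F@_m *: ('X_[m])^`M(lift ord0 i).
  by rewrite {1}[F]mpolyE raddf_sum; apply: eq_bigr => m _; apply: mderivZ.
rewrite sliceE raddf_sum /slice raddf_sum /=; apply: eq_bigr => m _.
rewrite mderivZ comp_mpolyZ; congr (_ *: _); rewrite mderivZ.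
rewrite !mderivX comp_mpolyZ -/(slice _ t) sliceX mnmE scalerA mulrC -scalerA.
congr (_ *: _); rewrite mnmBE mnm1E eq_sym (negbTE (neq_lift _ _)) subn0.
congr (_ *: 'X_[_]); apply/mnmP => j; rewrite !(mnmE, mnmBE, mnm1E).
by rewrite (inj_eq lift_inj).
Qed.

Lemma mfilterZ n (p : pred 'X_{1..n}) c (F : {mpoly C[n]}) :
  mfilter p (c *: F) = c *: mfilter p F.
Proof.
apply/mpolyP => m; rewrite mcoeffZ !mfilter_coeff mcoeffZ.
by case: (p m); rewrite ?mulr0.
Qed.

Lemma mfilter_slice n (p : pred 'X_{1..n}) (F : {mpoly C[n.+1]}) t :
  mfilter p (slice F t) = slice (mfilter (fun m => p (sproj m)) F) t.
Proof.
rewrite sliceE mfilter_sum [in RHS]/mfilter /slice raddf_sum /=.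
rewrite [RHS]big_mkcond; apply: eq_bigr => m _.
rewrite mfilterZ mfilterX; case: ifP => _; last by rewrite !scaler0.
by rewrite comp_mpolyZ -/(slice _ t) sliceX.
Qed.

Lemma msupp_slice n (F : {mpoly C[n.+1]}) t m :
  m \in msupp (slice F t) -> exists2 m', m' \in msupp F & sproj m' = m.
Proof.
rewrite mcoeff_msupp => h; apply: contrapT => hn; move/eqP: h; apply.
rewrite sliceE raddf_sum /= big_seq big1 // => m' m'F.
rewrite !mcoeffZ mcoeffX; case: eqP => [E|_]; last by rewrite !mulr0.
by exfalso; apply: hn; exists m'.
Qed.

(** For a special [t] the terms of least weight of [F] may cancel in the slice. The exponent [m1]
    witnesses that the minimum is still attained, and then taking the face function commutes with
    slicing. *)
Lemma face_slice n (w : 'I_n -> nat) (F : {mpoly C[n.+1]}) t m0 m1 :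
  m0 \in msupp F -> (forall m, m \in msupp F -> (wdot (ext0 w) m0 <= wdot (ext0 w) m)%N) ->
  m1 \in msupp (slice F t) -> (wdot w m1 <= wdot (ext0 w) m0)%N ->
  face_fun w (slice F t) = slice (wpart (ext0 w) (wdot (ext0 w) m0) F) t.
Proof.
move=> m0F hmin m1S m10.
have hminS m : m \in msupp (slice F t) -> (wdot (ext0 w) m0 <= wdot w m)%N.
  by move=> /msupp_slice[m' m'F <-]; rewrite -wdot_ext0; apply: hmin.
have -> : wpart (ext0 w) (wdot (ext0 w) m0) F =
    mfilter (fun m => wdot w (sproj m) == wdot (ext0 w) m0) F.
  by apply: eq_mfilter => m _; rewrite wdot_ext0.
rewrite -(mfilter_slice (fun m => wdot w m == wdot (ext0 w) m0)) /face_fun -/(mfilter _ _); apply: eq_mfilter => m mS.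
apply/allP/eqP => [h|-> m' /hminS //].
by apply/eqP; rewrite eqn_leq hminS // andbT; apply: leq_trans m10; apply: h.
Qed.

(** Each coefficient of a slice is a polynomial in [t], which allows counting the values of [t]
    where it vanishes. *)
Lemma slice_coeff n (F : {mpoly C[n.+1]}) t m :
  (slice F t)@_m =
  (\sum_(m' <- msupp F | sproj m' == m) F@_m' *: 'X^(m' ord0)).[t].
Proof.
rewrite sliceE raddf_sum /= horner_sum [RHS]big_mkcond /=; apply: eq_bigr => m' _.
rewrite !mcoeffZ mcoeffX; case: eqP => _; last by rewrite !mulr0.
by rewrite mulr1 hornerZ hornerXn.
Qed.

Lemma nonroot_small (p : {poly C}) (d : R) : p != 0 -> 0 < d ->
  exists t : C, `|t| < toC d /\ p.[t] != 0.
Proof.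
move=> p0 d0; apply: contrapT => hn.
(* Infinitely many distinct candidates; the shift by 2 makes the modulus strictly smaller than [d]
   already for [k = 0]. *)
pose t (k : nat) : C := toC (d / k.+2%:R).
have tinj : injective t.
  move=> k l /complexI /(mulfI (lt0r_neq0 d0)) /invr_inj /eqP.
  by rewrite eqr_nat => /eqP[].
have rt k : root p (t k).
  apply/negPn/negP => h; apply: hn; exists (t k); split=> //.
  rewrite normC_nrm nrm_toC ger0_norm ?divr_ge0 ?ltW // ltr_toC.
  by rewrite ltr_pdivrMr // ltr_pMr // ltr1n.
have := @max_poly_roots _ p [seq t k | k <- iota 0 (size p)] p0.
rewrite size_map size_iota ltnn => h; have : false; last by [].
apply: h; last by rewrite (map_inj_uniq tinj) iota_uniq.
by apply/allP => _ /mapP[k _ ->].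
Qed.

Lemma msupp_slice_ex n (F : {mpoly C[n.+1]}) (d : R) m : 0 < d -> m \in msupp F ->
  exists t : C, `|t| < toC d /\ sproj m \in msupp (slice F t).
Proof.
move=> d0 mF.
set p : {poly C} := \sum_(m' <- msupp F | sproj m' == sproj m) F@_m' *: 'X^(m' ord0).
have p0 : p != 0.
  have E : p`_(m ord0) = F@_m.
    rewrite /p coef_sum big_mkcond (bigD1_seq m) //= eqxx coefZ coefXn eqxx mulr1 big1 ?addr0 //.
    move=> m' m'm; case: eqP => // E; rewrite coefZ coefXn.
    case: eqP => [e0|_]; last by rewrite mulr0.
    move: m'm; rewrite (_ : m' = m) ?eqxx //; apply/mnmP => i.
    case: (unliftP ord0 i) => [j ->|->//].
    by have := congr1 (fun M : 'X_{1..n} => M j) E; rewrite !mnmE.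
  by apply/eqP => z; move: E; rewrite z coef0 => /esym/eqP; rewrite -[_ == 0]negbK -mcoeff_msupp mF.
have [t [td pt]] := nonroot_small p0 d0.
by exists t; split=> //; rewrite mcoeff_msupp slice_coeff.
Qed.

Lemma Gamma_plus_supp n (g : {mpoly C[n]}) m : m \in msupp g -> Gamma_plus g (expR m).
Proof.
move=> mg; exists (fun m' => (m' == m)%:R); split; first by move=> m'; rewrite ler0n.
have h (f : 'X_{1..n} -> R) : \sum_(m' <- msupp g) (m' == m)%:R * f m' = f m.
  rewrite (bigD1_seq m) //= eqxx mul1r big1 ?addr0 // => m' /negbTE ->.
  by rewrite mul0r.
split=> [|i]; last by rewrite (h (fun m => expR m i)).
by have := h (fun _ => 1); under eq_bigr do rewrite mulr1.
Qed.

Lemma Gamma_plus_wdot n (g : {mpoly C[n]}) (w : 'I_n -> nat) x d :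
  Gamma_plus g x -> (forall m, m \in msupp g -> (d <= wdot w m)%N) ->
  d%:R <= wdotR (fun i => (w i)%:R) x.
Proof.
move=> [lam [l0 [l1 lx]]] hd.
have wdE m : wdotR (fun i => (w i)%:R) (expR m) = (wdot w m)%:R.
  by rewrite /wdotR /wdot natr_sum; apply: eq_bigr => i _; rewrite natrM.
apply: le_trans (_ : _ <= \sum_(m <- msupp g) lam m * (wdot w m)%:R) _.
  rewrite -[leLHS]mul1r -[X in X * _ <= _]l1 mulr_suml big_seq [leRHS]big_seq; apply: ler_sum => m mg.
  by apply: ler_wpM2l => //; rewrite ler_nat; apply: hd.
under eq_bigr do rewrite -wdE /wdotR mulr_sumr.
rewrite exchange_big /=; apply: ler_sum => i _.
under eq_bigr do rewrite mulrCA.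
by rewrite -mulr_sumr ler_wpM2l.
Qed.

(** A face cut out by a positive weight is compact, since its points have nonnegative coordinates
    and a fixed weight. *)
Lemma Newton_boundary_min n (g : {mpoly C[n]}) (w : 'I_n -> nat) m :
  positive_weight w -> m \in msupp g ->
  (forall m', m' \in msupp g -> (wdot w m <= wdot w m')%N) -> Newton_boundary g (expR m).
Proof.
move=> w0 mg hmin.
have wdE : wdotR (fun i => (w i)%:R) (expR m) = (wdot w m)%:R.
  by rewrite /wdotR /wdot natr_sum; apply: eq_bigr => i _; rewrite natrM.
exists (fun i => (w i)%:R); split; first by move=> i; rewrite ler0n.
split; last first.
  split; first exact: Gamma_plus_supp.
  by move=> y hy; rewrite wdE; apply: Gamma_plus_wdot hy hmin.
(* Here [y i <= w i * y i <= wdotR w y], because [w i] is at least 1, and the last term is the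
   minimum. *)
exists (wdot w m)%:R => y [hy ymin] i.
have y0 j : 0 <= y j.
  have [lam [l0 [_ lx]]] := hy; apply: le_trans (lx j); apply: sumr_ge0 => m' _.
  by rewrite mulr_ge0 // ler0n.
rewrite -wdE; apply: le_trans (ymin _ (Gamma_plus_supp mg)).
rewrite /wdotR (bigD1 i) //=; apply: le_trans (_ : _ <= (w i)%:R * y i) _.
  by rewrite ler_peMl // ler1n w0.
by rewrite lerDl; apply: sumr_ge0 => j _; rewrite mulr_ge0 // ler0n.
Qed.

(* The weight [W * w + 1] is positive, and for large [W] its minima on the
   support are minima of [w]. *)
Lemma Newton_min n (F : {mpoly C[n.+1]}) (d : R) :
  (forall t t' : C, `|t| < toC d -> `|t'| < toC d ->
     forall x, Newton_boundary (slice F t) x <-> Newton_boundary (slice F t') x) ->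
  forall t (w : 'I_n -> nat) m, `|t| < toC d -> m \in msupp F ->
  exists2 m', m' \in msupp (slice F t) & (wdot w m' <= wdot (ext0 w) m)%N.
Proof.
move=> hN t w m td mF.
have d0 : 0 < d by rewrite -ltr_toC; apply: le_lt_trans td; rewrite rmorph0.
(* At [t1] the exponent of [m] does not cancel, so the minimum there is at most the weight of [m];
   constancy of the Newton boundary carries this to [t]. *)
have [t1 [t1d m1]] := msupp_slice_ex d0 mF.
set a := sproj m in m1.
(* As [W] exceeds the degree of [a], minimality of [b] for [w'] gives
   [W * wdot w b < W * (wdot w a + 1)], hence [wdot w b <= wdot w a]. *)
pose W := (mdeg a).+1; pose w' (i : 'I_n) := (W * w i + 1)%N.
have w'E b : wdot w' b = (W * wdot w b + mdeg b)%N.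
  rewrite /wdot mdegE big_distrr -big_split /=; apply: eq_bigr => i _.
  by rewrite mulnDl mul1n mulnA.
have [b bs hb] : exists2 b, b \in msupp (slice F t1) &
    forall b', b' \in msupp (slice F t1) -> (wdot w' b <= wdot w' b')%N.
  have ex0 : exists k, has (fun b => wdot w' b == k) (msupp (slice F t1)).
    by exists (wdot w' a); apply/hasP; exists a.
  case: (ex_minnP ex0) => k /hasP[b bs /eqP bk] hk; exists b => // b' b's.
  by rewrite bk; apply: hk; apply/hasP; exists b'.
have w'0 : positive_weight w' by move=> i; rewrite /w' addn1.
(* Only membership of [b] in the Newton polyhedron at [t] is kept: were all exponents of that slice
   heavier than [b], the polyhedron could not contain [b]. *)
have [v [_ [_ [hG _]]]] := (hN _ _ t1d td _).1 (Newton_boundary_min w'0 bs hb).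
have bw : (wdot w b <= wdot w a)%N.
  have := hb _ m1; rewrite !w'E => h.
  have : (W * wdot w b < W * (wdot w a).+1)%N.
    by apply: leq_ltn_trans (leq_addr _ _) (leq_ltn_trans h _); rewrite mulnS addnC ltn_add2r.
  by rewrite ltn_pmul2l.
apply: contrapT => hn.
have hlow m' : m' \in msupp (slice F t) -> ((wdot w b).+1 <= wdot w m')%N.
  move=> m's; rewrite ltnNge; apply/negP => h; apply: hn; exists m' => //.
  by rewrite wdot_ext0; apply: leq_trans h bw.
have := Gamma_plus_wdot hG hlow.
rewrite (_ : wdotR _ _ = (wdot w b)%:R) ?ler_nat ?ltnn //.
by rewrite /wdotR /wdot natr_sum; apply: eq_bigr => i _; rewrite natrM.
Qed.

(** * Independence of the gradients of the initial forms *)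

Definition zcoords n (A : {set 'I_n}) : {set 'I_n.+1} := [set lift ord0 i | i in A].

Lemma zcoords_lift n (A : {set 'I_n}) i : (lift ord0 i \in zcoords A) = (i \in A).
Proof. by rewrite mem_imset //; apply: lift_inj. Qed.

Lemma zcoords0 n (A : {set 'I_n}) : (ord0 \in zcoords A) = false.
Proof. by apply/imsetP => -[i _ /eqP]; rewrite (negbTE (neq_lift _ _)). Qed.

Definition supported n (I : {set 'I_n}) (m : 'X_{1..n.+1}) :=
  [forall i, (m (lift ord0 i) != 0%N) ==> (i \in I)].

(** The restriction to the coordinate subspace of [I], kept as a polynomial in all the variables. *)
Definition restr n (I : {set 'I_n}) (F : {mpoly C[n.+1]}) := mfilter (supported I) F.

(** Combinatorial form of not vanishing identically on the product of the [t]-line with the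
    coordinate subspace of [I]. *)
Definition nonvan n (I : {set 'I_n}) (F : {mpoly C[n.+1]}) := has (supported I) (msupp F).

Lemma supportedP n (I : {set 'I_n}) (m : 'X_{1..n.+1}) :
  reflect (forall i, i \in zcoords (~: I) -> m i = 0%N) (supported I m).
Proof.
apply: (iffP forallP) => [h _ /imsetP[i iI ->]|h i].
  apply/eqP; apply: contraTT iI => mi; have := h i; rewrite mi /= => iI.
  by rewrite inE iI.
apply/implyP; apply: contraNT => iI; rewrite h // zcoords_lift inE //.
Qed.

Lemma supportedPn n (I : {set 'I_n}) (m : 'X_{1..n.+1}) :
  ~~ supported I m -> exists2 i, m (lift ord0 i) != 0%N & i \notin I.
Proof.
move=> /negP h; apply: contrapT => hn; apply: h; apply/forallP => i.
by apply/implyP => mi; apply: contrapT => /negP iI; apply: hn; exists i.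
Qed.

Lemma supported_subU n (I : {set 'I_n}) (m : 'X_{1..n.+1}) j : supported I m -> supported I (m - U_(j))%MM.
Proof.
by move=> /supportedP h; apply/supportedP => i iI; rewrite mnmBE h.
Qed.

Lemma mevalX_eq0 N (m : 'X_{1..N}) (x : 'I_N -> C) i :
  m i != 0%N -> x i = 0 -> ('X_[m] : {mpoly C[N]}).@[x] = 0.
Proof.
by move=> mi xi; rewrite mevalX (bigD1 i) //= xi expr0n (negbTE mi) mul0r.
Qed.

Lemma restr_linear n (I : {set 'I_n}) (Th : {linear {mpoly C[n.+1]} -> {mpoly C[n.+1]}}) F x :
  (forall m, ~~ supported I m -> (Th 'X_[m]).@[x] = 0) -> (Th F).@[x] = (Th (restr I F)).@[x].
Proof.
move=> h; rewrite /restr /mfilter linear_sum raddf_sum /= meval_linear [RHS]big_mkcond.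
apply: eq_bigr => m _; case: ifPn => [_|/h ->]; last by rewrite mulr0.
by rewrite linearZ /= mevalZ.
Qed.

Lemma restr_meval n (I : {set 'I_n}) F (x : 'I_n.+1 -> C) :
  (forall i, i \in zcoords (~: I) -> x i = 0) -> F.@[x] = (restr I F).@[x].
Proof.
move=> x0; apply: (restr_linear (Th := idfun)) => m /= hm.
apply: contrapT => h; move/negP: hm; apply; apply/supportedP => i /x0 xi.
by apply/eqP; apply: contrapT => /negP mi; apply: h; apply: mevalX_eq0 mi xi.
Qed.

Lemma restr_deriv n (I : {set 'I_n}) F (x : 'I_n.+1 -> C) j :
  (forall i, i \in zcoords (~: I) -> x i = 0) -> j \notin zcoords (~: I) ->
  (F^`M(j)).@[x] = ((restr I F)^`M(j)).@[x].
Proof.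
move=> x0 jI; apply: (restr_linear (Th := mderiv j)) => m /= hm.
apply: contrapT => h; move/negP: hm; apply; apply/supportedP => i iI.
apply/eqP; apply: contrapT => /negP mi; apply: h.
rewrite mderivX mevalZ (@mevalX_eq0 _ _ _ i) ?mulr0 ?x0 //.
rewrite mnmBE mnm1E; have [ji|_] := eqVneq j i; last by rewrite subn0.
by move: jI; rewrite ji iI.
Qed.

Lemma restr_supp n (I : {set 'I_n}) F m :
  m \in msupp (restr I F) = supported I m && (m \in msupp F).
Proof. exact: mfilter_supp. Qed.

Lemma nonvanN_meval n (I : {set 'I_n}) F (x : 'I_n.+1 -> C) :
  ~~ nonvan I F -> (forall i, i \in zcoords (~: I) -> x i = 0) -> F.@[x] = 0.
Proof.
move=> /hasPn h x0; rewrite (restr_meval _ x0) mevalE big_seq big1 // => m.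
by rewrite restr_supp => /andP[mI /h]; rewrite mI.
Qed.

Lemma supported_linear n (I : {set 'I_n}) (Th : {linear {mpoly C[n.+1]} -> {mpoly C[n.+1]}})
    P x x' :
  (forall m, m \in msupp P -> supported I m) ->
  (forall m, supported I m -> (Th 'X_[m]).@[x] = (Th 'X_[m]).@[x']) ->
  (Th P).@[x] = (Th P).@[x'].
Proof.
move=> hP hm; rewrite !meval_linear big_seq [RHS]big_seq; apply: eq_bigr => m mP.
by rewrite hm // hP.
Qed.

Lemma supported_mevalX n (I : {set 'I_n}) m (x x' : 'I_n.+1 -> C) :
  supported I m -> (forall i, i \notin zcoords (~: I) -> x i = x' i) ->
  ('X_[m] : {mpoly C[n.+1]}).@[x] = ('X_[m]).@[x'].
Proof.
move=> /supportedP hm xx; rewrite !mevalX; apply: eq_bigr => i _.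
by have [/hm ->|/xx ->] := boolP (i \in zcoords (~: I)).
Qed.

Lemma supported_meval n (I : {set 'I_n}) P (x x' : 'I_n.+1 -> C) :
  (forall m, m \in msupp P -> supported I m) ->
  (forall i, i \notin zcoords (~: I) -> x i = x' i) -> P.@[x] = P.@[x'].
Proof.
move=> hP xx; apply: (supported_linear (Th := idfun) hP) => m hm /=.
exact: supported_mevalX hm xx.
Qed.

Lemma supported_deriv n (I : {set 'I_n}) P (x x' : 'I_n.+1 -> C) j :
  (forall m, m \in msupp P -> supported I m) ->
  (forall i, i \notin zcoords (~: I) -> x i = x' i) -> (P^`M(j)).@[x] = (P^`M(j)).@[x'].
Proof.
move=> hP xx; apply: (supported_linear (Th := mderiv j) hP) => m hm /=.
rewrite mderivX !mevalZ; congr (_ * _); exact: supported_mevalX (supported_subU j hm) xx.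
Qed.

Lemma supported_deriv0 n (I : {set 'I_n}) P (x : 'I_n.+1 -> C) j :
  (forall m, m \in msupp P -> supported I m) -> j \in zcoords (~: I) -> (P^`M(j)).@[x] = 0.
Proof.
move=> hP jI; rewrite (meval_linear (mderiv j)) big_seq big1 // => m /hP /supportedP hm.
by rewrite /= mderivX hm // scale0r meval0 mulr0.
Qed.

(** The body of [Newton_admissible] with its two constants exposed, since they enter the size of the
    neighbourhood. *)
Definition admissible_with n k0 (f : 'I_k0 -> {mpoly C[n.+1]}) (R0 d : R) :=
  0 < R0 /\ 0 < d /\
  (forall k (t t' : C), `|t| < toC d -> `|t'| < toC d ->
    forall x, Newton_boundary (slice (f k) t) x <-> Newton_boundary (slice (f k) t') x) /\
  (forall (t : C), `|t| < toC d -> forall S : {set 'I_k0}, S != set0 ->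
     nondegenerate_ci S (fun k => slice (f k) t) /\
     exists Rt : R, R0 < Rt /\ tameness_radius S (fun k => slice (f k) t) Rt).

Definition wmin N (w : 'I_N -> nat) (F : {mpoly C[N]}) (m : 'X_{1..N}) :=
  m \in msupp F /\ forall m', m' \in msupp F -> (wdot w m <= wdot w m')%N.

Lemma wmin_exists n (w : 'I_n.+1 -> nat) (I : {set 'I_n}) F :
  nonvan I F -> exists m, wmin w (restr I F) m.
Proof.
move=> /hasP[a aF aI].
have ex0 : exists k, has (fun b => wdot w b == k) (msupp (restr I F)).
  by exists (wdot w a); apply/hasP; exists a; rewrite ?restr_supp ?aI.
case: (ex_minnP ex0) => k /hasP[b bs /eqP bk] hk; exists b; split=> // b' b's.
by rewrite bk; apply: hk; apply/hasP; exists b'.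
Qed.

(** Giving a large weight to the variables outside [I] makes the initial form of the restriction to
    [I] a face function of the whole polynomial, hence of the slice at [t = a ord0]. Non-degeneracy
    applies if [I'] is empty, and local tameness with the variables of [I'] fixed otherwise. *)
Lemma initial_form_indep n k0 (f : 'I_k0 -> {mpoly C[n.+1]}) (R0 d : R)
    (I I' : {set 'I_n}) (S : {set 'I_k0}) (w0 : 'I_n.+1 -> nat) (mk : 'I_k0 -> 'X_{1..n.+1})
    (a : 'I_n.+1 -> C) :
  admissible_with f R0 d -> I' \subset I ->
  (forall k, k \in S -> I' != set0 -> ~~ nonvan I' (f k)) ->
  (forall i, (w0 i == 0%N) = (i \notin zcoords (I :\: I'))) ->
  `|a ord0| < toC d ->
  (forall i, i \in I -> a (lift ord0 i) != 0) ->
  \sum_(i in I') nrm (a (lift ord0 i)) ^+ 2 < R0 ->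
  (forall k, k \in S -> wmin w0 (restr I (f k)) (mk k)) ->
  let P k := wpart w0 (wdot w0 (mk k)) (restr I (f k)) in
  (forall k, k \in S -> (P k).@[a] = 0) ->
  indep S (zcoords (I :\: I')) (fun k i => ((P k)^`M(i)).@[a]).
Proof.
move=> [R00 [d0 [hN hT]]] sub hvan hw ad aI aR hmk P hP.
have [->|Sn0] := eqVneq S set0; first by move=> c _ j; rewrite inE.
(* Larger than every minimal weight, so a monomial involving a variable outside [I] is never
   minimal. *)
pose W := (\sum_k wdot w0 (mk k)).+1.
have hW k : (wdot w0 (mk k) < W)%N by rewrite ltnS (bigD1 k) //= leq_addr.
pose w (i : 'I_n) := if i \in I then w0 (lift ord0 i) else W.
have w00 : w0 ord0 = 0%N by apply/eqP; rewrite hw zcoords0.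
have wE m : supported I m -> wdot (ext0 w) m = wdot w0 m.
  move=> /supportedP hm; rewrite /wdot !big_ord_recl w00 /ext0 unlift_none !mul0n.
  congr (_ + _)%N; apply: eq_bigr => i _; rewrite liftK /w; case: ifPn => // iI.
  by rewrite hm ?muln0 // zcoords_lift inE.
have wW m : ~~ supported I m -> (W <= wdot (ext0 w) m)%N.
  move=> /supportedPn[i mi iI].
  rewrite /wdot (bigD1 (lift ord0 i)) //= ext0_lift /w (negbTE iI).
  by apply: leq_trans (leq_addr _ _); rewrite leq_pmulr // lt0n.
have minE k : k \in S -> forall m, m \in msupp (f k) ->
    (wdot (ext0 w) (mk k) <= wdot (ext0 w) m)%N.
  move=> /hmk[mkS hmin] m mF; move: (mkS); rewrite restr_supp => /andP[mks _].
  rewrite wE //; have [ms|/wW h] := boolP (supported I m).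
    by rewrite wE //; apply: hmin; rewrite restr_supp ms.
  by apply: ltnW; apply: leq_trans (hW k) h.
pose t := a ord0.
have faceE k : k \in S -> face_fun w (slice (f k) t) = slice (P k) t.
  move=> kS; have [mkS hmin] := hmk k kS; move: (mkS); rewrite restr_supp => /andP[mks mkF].
  have [m1 m1S m1le] := Newton_min (hN k) w ad mkF.
  have -> := face_slice mkF (minE k kS) m1S m1le.
  suff -> : P k = wpart (ext0 w) (wdot (ext0 w) (mk k)) (f k) by [].
  rewrite /P /wpart /restr mfilter_filter (wE _ mks); apply: eq_mfilter => m mF /=.
  have [ms|/wW h] := boolP (supported I m); first by rewrite (wE _ ms) andbT.
  by rewrite andbF gtn_eqF // (leq_trans (hW k)).
(* The hypotheses speak of points of the full torus. The initial forms do not involve the variables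
   outside [I], so these may be given the value 1. *)
pose z (i : 'I_n) : C := if i \in I then a (lift ord0 i) else 1.
have Psupp k m : m \in msupp (P k) -> supported I m.
  by rewrite mfilter_supp restr_supp => /and3P[].
have az i : i \notin zcoords (~: I) -> a i = ptf t z i.
  case: (unliftP ord0 i) => [j ->|->]; last by rewrite ptf0.
  by rewrite zcoords_lift inE negbK ptf_lift /z => ->.
have zt : in_torus z by move=> i; rewrite /z; case: ifP => [/aI //|_]; apply: oner_neq0.
have face0 k : k \in S -> (face_fun w (slice (f k) t)).@[z] = 0.
  by move=> kS; rewrite faceE // slice_meval -(supported_meval (@Psupp k) az) hP.
have faceD k i : k \in S -> ((face_fun w (slice (f k) t))^`M(i)).@[z] =
    if i \in I then ((P k)^`M(lift ord0 i)).@[a] else 0.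
  move=> kS; rewrite faceE // slice_deriv slice_meval.
  rewrite -(supported_deriv _ (@Psupp k) az); case: ifPn => // iI.
  by apply: (supported_deriv0 _ (@Psupp k)); rewrite zcoords_lift inE.
have concl (A : {set 'I_n}) : (forall i, i \in ~: A -> i \in I -> i \in I :\: I') ->
    row_free (jac_out S (fun k => face_fun w (slice (f k) t)) A z) ->
    indep S (zcoords (I :\: I')) (fun k i => ((P k)^`M(i)).@[a]).
  move=> hA rf c hc.
  have : row_free (rowsmx S (~: A)
      (fun k i => ((face_fun w (slice (f k) t))^`M(i)).@[z])).
    rewrite (_ : rowsmx _ _ _ = jac_out S (fun k => face_fun w (slice (f k) t)) A z) //.
    by apply/matrixP => j i; rewrite !mxE in_setC; case: (i \in A).
  move=> /indepP; apply => i iA.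
  under eq_bigr => k kS do rewrite faceD //.
  have [iI|iI] := boolP (i \in I); last by rewrite big1 // => k _; rewrite mulr0.
  by apply: hc; rewrite zcoords_lift; apply: hA.
have [nd [Rt [RRt [Rt0 tame]]]] := hT t ad S Sn0.
have wpos i : i \notin I' -> (0 < w i)%N.
  move=> iI'; rewrite /w; case: ifPn => // iI.
  by rewrite lt0n hw negbK zcoords_lift inE iI' iI.
have [I'0|I'n0] := eqVneq I' set0.
  apply: (concl set0); first by move=> i _ iI; rewrite !inE I'0 inE iI.
  apply: nd zt _ => // i; apply: wpos; by rewrite I'0 inE.
apply: (concl I'); first by move=> i; rewrite !inE => -> ->.
apply: (tame I' I'n0 _ w _ _ (fun i => a (lift ord0 i))) => //.
- move=> k kS y hy; rewrite slice_meval; apply: (@nonvanN_meval _ I'); first exact: hvan.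
  by move=> _ /imsetP[i iI ->]; rewrite ptf_lift hy // -in_setC.
(* Tameness is stated for nonzero weights: a monomial of [f k] must involve a variable outside [I'],
   and such a variable has positive weight. *)
- have [k kS] := set0Pn _ Sn0; have [mkS _] := hmk k kS.
  move: mkS; rewrite restr_supp => /andP[_ mkF].
  have := hvan k kS I'n0 => /hasPn /(_ _ mkF) /supportedPn[i _ /wpos].
  by exists i.
- move=> i; have [iI'|/wpos] := boolP (i \in I'); last by rewrite lt0n => /negbTE.
  rewrite /w (subsetP sub _ iI'); apply/eqP/eqP; rewrite hw zcoords_lift inE iI' //.
- by move=> i iI'; apply: aI; apply: (subsetP sub).
- under eq_bigr do rewrite normC_nrm -rmorphXn.
  by rewrite -rmorph_sum ltr_toC; apply: lt_trans aR RRt.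
- by move=> i iI'; rewrite /z (subsetP sub _ iI').
Qed.

(** * Smoothness of the strata *)

(** A relation with coefficients [c] among the rows of [G] becomes one with coefficients [c / rho]
    among the rescaled rows. *)
Lemma indep_scale p N (S : {set 'I_p}) (cols : {set 'I_N}) (G : 'I_p -> 'I_N -> C)
    (rho : 'I_p -> C) (s : 'I_N -> C) :
  (forall j, rho j != 0) -> indep S cols (fun j i => rho j * s i * G j i) -> indep S cols G.
Proof.
move=> r0 h c hc j jS; have : (c j / rho j) = 0.
  apply: (h (fun j => c j / rho j)) => // i ic.
  transitivity (s i * \sum_(l in S) c l * G l i); last by rewrite hc // mulr0.
  rewrite mulr_sumr; apply: eq_bigr => l _.
  by have := r0 l => rl; field.
by move/eqP; rewrite mulf_eq0 invr_eq0 (negbTE (r0 j)) orbF => /eqP.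
Qed.

(** The inverse of [1 + \sum_x (e x)^-1] is positive and below each [e x], also when [T] is
    empty. *)
Lemma common_radius (T : finType) (P : T -> R -> Prop) :
  (forall x e e', e' <= e -> P x e -> P x e') ->
  (forall x, exists e, 0 < e /\ P x e) -> exists e, 0 < e /\ forall x, P x e.
Proof.
move=> mono h; have [e he] := choice h.
pose s : R := \sum_x (e x)^-1.
have e0 x : 0 < (e x)^-1 by rewrite invr_gt0; have [] := he x.
have s1 : 0 < 1 + s by apply: ltr_wpDr => //; apply: sumr_ge0 => x _; apply: ltW.
exists (1 + s)^-1; split=> [|x]; first by rewrite invr_gt0.
have [ex0 hx] := he x; apply: mono hx.
rewrite -[leRHS]invrK lef_pV2 ?posrE // /s (bigD1 x) //= addrCA lerDl.
by apply: addr_ge0 => //; apply: sumr_ge0 => y _; apply: ltW.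
Qed.

Lemma zcoordsC n (I : {set 'I_n}) i : i \in zcoords I -> i \notin zcoords (~: I).
Proof. by move=> /imsetP[j jI ->]; rewrite zcoords_lift inE negbK. Qed.

(** Smoothness of the strata in a form uniform in [I] and [S]. Independence is required in the
    variables indexed by [I] alone, without the derivative in [t]. *)
Definition gradients_indep n k0 (f : 'I_k0 -> {mpoly C[n.+1]}) (e : R) :=
  forall (I : {set 'I_n}) (S : {set 'I_k0}) (x : 'I_n.+1 -> C),
    (forall k, k \in S -> nonvan I (f k)) ->
    (forall i, nrm (x i) < e) -> (forall i, (x (lift ord0 i) != 0) = (i \in I)) ->
    (forall k, k \in S -> (f k).@[x] = 0) ->
    indep S (zcoords I) (fun k i => ((f k)^`M(i)).@[x]).

(** Otherwise bad points tend to the origin for some fixed [I] and [S]. Their tropical limit has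
    independent gradients of initial forms, and independence is an open condition preserved by
    rescaling. *)
Lemma admissible_gradients n k0 (f : 'I_k0 -> {mpoly C[n.+1]}) (R0 d : R) :
  admissible_with f R0 d ->
  exists e : R, 0 < e /\ gradients_indep f e.
Proof.
move=> hf.
pose Good (IS : {set 'I_n} * {set 'I_k0}) (e : R) := forall x : 'I_n.+1 -> C,
    (forall k, k \in IS.2 -> nonvan IS.1 (f k)) ->
    (forall i, nrm (x i) < e) -> (forall i, (x (lift ord0 i) != 0) = (i \in IS.1)) ->
    (forall k, k \in IS.2 -> (f k).@[x] = 0) ->
    indep IS.2 (zcoords IS.1) (fun k i => ((f k)^`M(i)).@[x]).
suff [e [e0 he]] : exists e, 0 < e /\ forall IS, Good IS e.
  by exists e; split=> // I S x; apply: (he (I, S)).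
apply: common_radius => [IS e e' ee' h x h1 h2|[I S]].
  by apply: h => // i; apply: lt_le_trans (h2 i) ee'.
apply: contrapT => hbad.
have bad (k : nat) : exists x : 'I_n.+1 -> C,
    [/\ forall k, k \in S -> nonvan I (f k), forall i, nrm (x i) < k.+1%:R^-1,
     forall i, (x (lift ord0 i) != 0) = (i \in I),
     forall k, k \in S -> (f k).@[x] = 0 &
     ~ indep S (zcoords I) (fun k i => ((f k)^`M(i)).@[x])].
  apply: contrapT => hk; apply: hbad; exists k.+1%:R^-1; split; first by rewrite invr_gt0.
  by move=> x h1 h2 h3 h4; apply: contrapT => h5; apply: hk; exists x.
have [x hx] := choice bad.
have nv k : k \in S -> nonvan I (f k) by have [h _ _ _ _] := hx 0%N; apply: h.
have x0 i : flim om (fun k => x k i) 0.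
  apply: (flim_squeeze (g := fun k => k.+1%:R^-1)).
    by apply: flim_frechet_om; apply: flim_inv_nat => k; rewrite lexx andbT ltW // invr_gt0.
  by apply: filtT => k; rewrite subr0; have [_ h _ _ _] := hx k; apply: ltW.
have xn0 k i : i \in zcoords I -> x k i != 0.
  by move=> /imsetP[j jI ->]; have [_ _ h _ _] := hx k; rewrite h.
have xI k i : i \in zcoords (~: I) -> x k i = 0.
  move=> /imsetP[j jI ->]; have [_ _ h _ _] := hx k.
  by apply/eqP; apply: contraTT jI; rewrite h inE negbK.
pose M := flatten [seq (msupp (f k) : seq _) | k <- enum 'I_k0].
have fM k : {subset msupp (restr I (f k)) <= M}.
  move=> m; rewrite restr_supp => /andP[_ mf]; apply/flattenP.
  by exists (msupp (f k)) => //; apply: map_f; rewrite mem_enum.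
have [l [w [a [hw [l0 [ha [a0 [heq hlt]]]]]]]] :=
  tropical_limit M x0 (fun i _ => erefl) xn0.
have trop : tropical (mem M) x l w a by split.
have nact i : i \notin zcoords I -> a i = 0.
  move=> iI; apply: (flim_unique _ (ha i)); apply: flim_ext (x0 i) => k.
  by rewrite l0 // ex0 rmorph1 mulr1.
have [mk hmk] : exists mk : 'I_k0 -> 'X_{1..n.+1}, forall k, k \in S -> wmin w (restr I (f k)) (mk k).
  have h k : exists m, k \in S -> wmin w (restr I (f k)) m.
    have [/nv /(wmin_exists w)[m hm]|kS] := boolP (k \in S); first by exists m.
    by exists 0%MM.
  by have [mk hmk] := choice h; exists mk.
pose P k := wpart w (wdot w (mk k)) (restr I (f k)).
have P0 k : k \in S -> (P k).@[a] = 0.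
  move=> kS; have [mkS hmin] := hmk k kS.
  apply: (flim_unique _ (tropical_eval trop (@fM k) mkS hmin)).
  apply: flim_ext (flim_cst 0) => m; rewrite -(restr_meval _ (@xI m)).
  by have [_ _ _ h _] := hx m; rewrite h // mulr0.
have [R00 [d0 _]] := hf.
have indP : indep S (zcoords I) (fun k i => ((P k)^`M(i)).@[a]).
  rewrite -(setD0 I); apply: (@initial_form_indep _ _ f R0 d I set0 S w mk a) => //.
  - exact: sub0set.
  - by move=> k _; rewrite eqxx.
  - by move=> i; rewrite setD0.
  - by rewrite nact ?zcoords0 // normr0 -(rmorph0 toC) ltr_toC.
  - by move=> i iI; apply: a0; rewrite zcoords_lift.
  - by rewrite big_set0.
have hG k i : k \in S -> i \in zcoords I -> flim om (fun m =>
    toC (ex (pairR (l m) (mk k))) * toC (ex (- l m i)) * ((f k)^`M(i)).@[x m])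
    ((P k)^`M(i)).@[a].
  move=> kS iI; have [mkS hmin] := hmk k kS.
  apply: flim_ext (tropical_deriv i trop (@fM k) mkS hmin) => m.
  rewrite exD toCM; congr (_ * _); apply/esym.
  exact: (restr_deriv _ (@xI m) (zcoordsC iI)).
have [m _ hm] := om_ex (indep_open indP hG) 0%N.
have [_ _ _ _] := hx m; apply; apply: indep_scale hm => j.
by rewrite toC_eq0 ex_neq0.
Qed.

(** * Secants and tangent spaces *)

(* Secant directions are tangent in the limit: the secant [v = (x - y') / tau]
   is replaced by [v'], whose vanishing coordinates are weighted so that Euler's
   relation for the initial forms applies, and then corrected into the kernel. *)
Lemma secant_correction n k0 (f : 'I_k0 -> {mpoly C[n.+1]}) (R0 d e : R)
    (I I' : {set 'I_n}) (K : {set 'I_k0}) (y : 'I_n.+1 -> C) (x x' : nat -> 'I_n.+1 -> C)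
    (tau : nat -> R) :
  admissible_with f R0 d ->
  gradients_indep f e ->
  I' \subset I ->
  (forall i, (y (lift ord0 i) != 0) = (i \in I')) ->
  (forall i, nrm (y i) < e) -> nrm (y ord0) < d ->
  \sum_(i in I') nrm (y (lift ord0 i)) ^+ 2 < R0 ->
  (forall k, k \in K -> (f k).@[y] = 0) ->
  (forall m i, (x m (lift ord0 i) != 0) = (i \in I)) ->
  (forall m i, (x' m (lift ord0 i) != 0) = (i \in I')) ->
  (forall m k, k \in K -> (f k).@[x m] = 0) ->
  (forall m k, k \in K -> (f k).@[x' m] = 0) ->
  (forall i, flim om (fun m => x m i) (y i)) ->
  (forall i, flim om (fun m => x' m i) (y i)) ->
  (forall m, 0 < tau m) -> (forall m i, nrm (x m i - x' m i) <= tau m) ->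
  (flim om (fun m => toC (tau m)) 0) ->
  exists u : nat -> 'I_n.+1 -> C,
    [/\ forall i, flim om (fun m => u m i - (toC (tau m))^-1 * (x m i - x' m i)) 0,
     forall m i, i \notin I -> u m (lift ord0 i) = 0 &
     om (fun m => forall k, k \in K -> nonvan I (f k) ->
       \sum_i ((f k)^`M(i)).@[x m] * u m i = 0)].
Proof.
move=> hf hsm sub yI ye yd yR yK xI x'I xK x'K xy x'y tau0 htau taulim.
pose act := zcoords (I :\: I').
have tauC m : toC (tau m) != 0 by rewrite toC_eq0 gt_eqF.
have y0 i : i \in act -> y i = 0.
  move=> /imsetP[j]; rewrite inE => /andP[jI' _] ->.
  by apply/eqP; apply: contraNT jI'; rewrite yI.
have x'0 m i : i \in act -> x' m i = 0.
  move=> /imsetP[j]; rewrite inE => /andP[jI' _] ->.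
  by apply/eqP; apply: contraNT jI'; rewrite x'I.
have xn0 m i : i \in act -> x m i != 0.
  by move=> /imsetP[j]; rewrite inE => /andP[_ jI] ->; rewrite xI.
have xZ m i : i \in zcoords (~: I) -> x m i = 0.
  by move=> /imsetP[j]; rewrite inE => jI ->; apply/eqP; apply: contraNT jI; rewrite xI.
have x'Z m i : i \in zcoords (~: I) -> x' m i = 0.
  move=> /imsetP[j]; rewrite inE => jI ->; apply/eqP; apply: contraNT jI; rewrite x'I.
  exact: (subsetP sub).
(* The exponents [U_(i)] are included so that coordinates with different weights are known to have
   different orders of magnitude. *)
pose M := [seq U_(i)%MM | i <- enum 'I_n.+1] ++
  flatten [seq (msupp (f k) : seq _) | k <- enum 'I_k0].
have fM k : {subset msupp (restr I (f k)) <= M}.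
  move=> m; rewrite restr_supp => /andP[_ mf]; rewrite mem_cat; apply/orP; right.
  by apply/flattenP; exists (msupp (f k)) => //; apply: map_f; rewrite mem_enum.
have UM i : U_(i)%MM \in M by rewrite mem_cat map_f ?mem_enum.
have [l [w [a [hw [l0 [ha [a0 [heq hlt]]]]]]]] := tropical_limit M xy y0 xn0.
have trop : tropical (mem M) x l w a by split.
have ay i : i \notin act -> a i = y i.
  move=> iI; apply: (flim_unique _ (ha i)); apply: flim_ext (xy i) => k.
  by rewrite l0 // ex0 rmorph1 mulr1.
pose S := [set k in K | nonvan I (f k)].
(* [K1] collects the equations vanishing on the coordinate subspace of [I'], treated by tameness;
   [K2] collects the others, treated by smoothness along the smaller stratum. *)
pose K1 := [set k in S | ~~ nonvan I' (f k)].
pose K2 := [set k in S | nonvan I' (f k)].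
have [mk hmk] : exists mk : 'I_k0 -> 'X_{1..n.+1}, forall k, k \in S -> wmin w (restr I (f k)) (mk k).
  have h k : exists m, k \in S -> wmin w (restr I (f k)) m.
    have [kS|kS] := boolP (k \in S); last by exists 0%MM.
    by move: kS; rewrite inE => /andP[_ /(wmin_exists w)[m hm]]; exists m.
  by have [mk hmk] := choice h; exists mk.
pose P k := wpart w (wdot w (mk k)) (restr I (f k)).
pose D m k := pairR (l m) (mk k).
have SK k : k \in S -> k \in K by rewrite inE => /andP[].
have P0 k : k \in S -> (P k).@[a] = 0.
  move=> kS; have [mkS hmin] := hmk k kS.
  apply: (flim_unique _ (tropical_eval trop (@fM k) mkS hmin)).
  apply: flim_ext (flim_cst 0) => m; rewrite -(restr_meval _ (@xZ m)).
  by rewrite xK ?mulr0 // SK.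
have indP : indep K1 act (fun k i => ((P k)^`M(i)).@[a]).
  apply: (@initial_form_indep _ _ f R0 d I I' K1 w mk a) => //.
  - by move=> k; rewrite inE => /andP[_ h].
  - by rewrite ay ?zcoords0 // normC_nrm ltr_toC.
  - move=> i iI; have [ia|ia] := boolP (lift ord0 i \in act); first exact: a0.
    rewrite ay // yI; move: ia; rewrite zcoords_lift inE iI andbT negbK //.
  - rewrite (eq_bigr (fun i => nrm (y (lift ord0 i)) ^+ 2)) // => i iI.
    by rewrite ay // zcoords_lift inE iI.
  - by move=> k; rewrite inE => /andP[kS _]; apply: hmk.
  - by move=> k; rewrite inE => /andP[kS _]; apply: P0.
have indN : indep K2 (zcoords I') (fun k i => ((f k)^`M(i)).@[y]).
  apply: hsm => // k; rewrite !inE => /andP[/andP[kK _] h] //.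
  exact: yK.
have dlim k i : k \in S -> i \notin zcoords (~: I) ->
    flim om (fun m => toC (ex (D m k - l m i)) * ((f k)^`M(i)).@[x m]) ((P k)^`M(i)).@[a].
  move=> kS iI; have [mkS hmin] := hmk k kS.
  apply: flim_ext (tropical_deriv i trop (@fM k) mkS hmin) => m.
  by congr (_ * _); apply/esym; exact: (restr_deriv _ (@xZ m) iI).
have dcont k i : flim om (fun m => ((f k)^`M(i)).@[x m]) ((f k)^`M(i)).@[y].
  exact: flim_meval.
have actI i : i \in act -> i \in zcoords I.
  by move=> /imsetP[j]; rewrite inE => /andP[_ jI] ->; rewrite zcoords_lift.
have actN i : i \in act -> i \notin zcoords (~: I) by move=> /actI /zcoordsC.
(* Column factors comparing the size of [x m i] with the length [tau m] of the secant; they stay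
   bounded because [x' m i = 0] on [act], so that [|x m i| <= tau m]. *)
pose s m i : C := if i \in act then (toC (tau m))^-1 * toC (ex (- l m i)) else 1.
have hs i : exists b : C, flim om (fun m => s m i) b.
  have [ia|ia] := boolP (i \in act); last first.
    by exists 1; apply: flim_ext (flim_cst 1) => m; rewrite /s (negbTE ia).
  have na : 0 < nrm (a i) by rewrite nrm_gt0 a0.
  have na2 : nrm (a i) / 2 < nrm (a i) by lra.
  apply: (@om_flim _ (nrm (a i) / 2)^-1).
  apply: filtS (flim_nrm_gt (ha i) na2) => m; rewrite /s ia !nrmM nrmV !nrm_toC.
  rewrite !gtr0_norm ?ex_gt0 // exN => hx.
  rewrite -invfM lef_pV2 ?posrE ?mulr_gt0 ?ex_gt0 ?invr_gt0 //.
  apply: ltW; apply: lt_le_trans hx _; apply: ler_wpM2r; first exact: ltW (ex_gt0 _).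
  by have := htau m i; rewrite x'0 // subr0.
have [si hsi] := choice hs.
have sx m i : i \in act -> (toC (tau m))^-1 * x m i = s m i * (x m i * toC (ex (l m i))).
  move=> ia; rewrite /s ia exN fmorphV.
  have : toC (ex (l m i)) != 0 by rewrite toC_eq0 ex_neq0.
  by move=> h; have := tauC m => h'; field; rewrite h h'.
(* Coordinates in [act] comparable with [tau] (those with [si i != 0]) all have the same weight, as
   a smaller weight would mean a larger order of magnitude than [tau]. The scalar [th] is the
   inverse of that weight, or 0 if there is no such coordinate. *)
have [th hth] : exists th : C, forall i, i \in act -> si i != 0 -> th * (w i)%:R = 1.
  have [[j [ja sj]]|hn] := pselect (exists j, j \in act /\ si j != 0); last first.
    by exists 0 => i ia sn; exfalso; apply: hn; exists i.
  have wE i : wdot w (U_(i)%MM : 'X_{1..n.+1}) = w i.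
    rewrite /wdot (bigD1 i) //= mnm1E eqxx muln1 big1 ?addn0 // => b bi.
    by rewrite mnm1E eq_sym (negbTE bi) muln0.
  have nolt i1 i2 : i1 \in act -> i2 \in act -> si i2 != 0 -> ~~ (w i1 < w i2)%N.
    move=> a1 a2 s2; apply/negP => h12; move/negP: s2; apply.
    have inf := hlt U_(i1)%MM U_(i2)%MM (UM _) (UM _); rewrite !wE in inf.
    have : flim om (fun m => s m i2) 0.
      rewrite -(mulr0 (si i1)); apply: flim_ext (flimM (hsi i1) (flim_exN (inf h12))) => m.
      rewrite !pairRU /s a1 a2 -mulrA -toCM -exD; congr (_ * toC (ex _)); ring.
    by move=> h; apply/eqP; apply: flim_unique h; apply: hsi.
  exists (w j)%:R^-1 => i ia sin.
  have -> : w i = w j.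
    by apply/eqP; rewrite eqn_leq leqNgt (nolt _ _ ja ia sin) leqNgt (nolt _ _ ia ja sj).
  by rewrite mulVf // pnatr_eq0 hw negbK.
pose v m i : C := (toC (tau m))^-1 * (x m i - x' m i).
(* On comparable coordinates [th * w i = 1] and [v'] agrees with [v]; on the other coordinates of
   [act] both tend to 0. *)
pose v' m i : C := if i \in act then th * (w i)%:R * ((toC (tau m))^-1 * x m i) else v m i.
have vb i : exists b : C, flim om (fun m => v m i) b.
  apply: (@om_flim _ 1); apply: filtT => m; rewrite nrmM nrmV nrm_toC gtr0_norm //.
  by rewrite mulrC ler_pdivrMr // mul1r.
have v'v i : flim om (fun m => v' m i - v m i) 0.
  have [ia|ia] := boolP (i \in act); last first.
    by apply: flim_ext (flim_cst 0) => m; rewrite /v' (negbTE ia) subrr.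
  have h : flim om (fun m => (th * (w i)%:R - 1) * (s m i * (x m i * toC (ex (l m i))))) 0.
    have -> : 0 = (th * (w i)%:R - 1) * (si i * a i) :> C.
      have [->|sn] := eqVneq (si i) 0; first by rewrite mul0r mulr0.
      by rewrite hth // subrr mul0r.
    by apply: flimZ; apply: flimM.
  by apply: flim_ext h => m; rewrite /v' ia /v x'0 // subr0 -sx // mulrBl mul1r.
(* The factor [tau] cancels the one in [s] on the columns of [act], and makes the rows of [K1] tend
   to 0 on the remaining columns of [I]. *)
pose rho m k : C := if k \in K1 then toC (tau m) * toC (ex (D m k)) else 1.
have rho0 m k : rho m k != 0.
  rewrite /rho; case: ifP => _; last exact: oner_neq0.
  by rewrite mulf_neq0 // toC_eq0 ex_neq0.
pose G m k i := rho m k * s m i * ((f k)^`M(i)).@[x m].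
pose G0 k i : C := if k \in K1 then (if i \in act then ((P k)^`M(i)).@[a] else 0)
  else si i * ((f k)^`M(i)).@[y].
have K1S k : k \in K1 -> k \in S by rewrite inE => /andP[].
have exDl m k i : i \notin act -> D m k - l m i = D m k.
  by move=> ia; rewrite l0 // subr0.
have hG k i : k \in S -> i \in zcoords I -> flim om (fun m => G m k i) (G0 k i).
  move=> kS iI; rewrite /G0; have [k1|k1] := boolP (k \in K1); last first.
    apply: flim_ext (flimM (hsi i) (dcont k i)) => m.
    by rewrite /G /rho (negbTE k1) mul1r.
  have [ia|ia] := boolP (i \in act).
    apply: flim_ext (dlim k i kS (zcoordsC iI)) => m.
    rewrite /G /rho k1 /s ia exD toCM.
    by have := tauC m => h; field.
  rewrite -(mul0r ((P k)^`M(i)).@[a]); apply: flim_ext (flimM taulim (dlim k i kS (zcoordsC iI))) => m.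
  by rewrite /G /rho k1 /s (negbTE ia) exDl // mulr1 mulrA.
have siN i : i \notin act -> si i = 1.
  move=> ia; apply: (flim_unique _ (hsi i)); apply: flim_ext (flim_cst 1) => m.
  by rewrite /s (negbTE ia).
(* The limit matrix is block triangular: the columns of [I'] see only [K2], and once those
   coefficients vanish the columns of [act] give the independence of [K1]. *)
have indG0 : indep S (zcoords I) G0.
  move=> c hc.
  have c2 k : k \in K2 -> c k = 0.
    apply: indN => i iI'; have ia : i \notin act.
      by move: iI' => /imsetP[j jI' ->]; rewrite zcoords_lift inE jI'.
    have iI : i \in zcoords I.
      by move: iI' => /imsetP[j jI' ->]; rewrite zcoords_lift (subsetP sub).
    rewrite -[RHS](hc i iI) [RHS](big_setID K1) /= [X in _ = X + _]big1 ?add0r.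
      have -> : K2 = S :\: K1.
        by apply/setP => j; rewrite !inE; case: (j \in K); case: (nonvan I _); case: (nonvan I' _).
      apply: eq_bigr => j; rewrite inE => /andP[k1 _].
      by rewrite /G0 (negbTE k1) siN // mul1r.
    by move=> j; rewrite inE => /andP[_ k1]; rewrite /G0 k1 (negbTE ia) mulr0.
  have c1 k : k \in K1 -> c k = 0.
    apply: indP => i ia; rewrite -[RHS](hc i (actI _ ia)) [RHS](big_setID K1) /=.
    rewrite [X in _ = _ + X]big1 ?addr0.
      have -> : S :&: K1 = K1 by apply/setIidPr; apply/subsetP => j /K1S.
      by apply: eq_bigr => j k1; rewrite /G0 k1 ia.
    move=> j; rewrite !inE => /andP[k1 kS]; rewrite c2 ?mul0r //.
    by rewrite !inE kS /=; move: k1; rewrite kS negbK.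
  move=> k kS; have [k1|k1] := boolP (k \in K1); first exact: c1.
  by apply: c2; move: k1; rewrite !inE; move: kS; rewrite inE => -> /=; rewrite negbK.
have hr k : k \in S -> flim om (fun m => - (rho m k * \sum_i ((f k)^`M(i)).@[x m] * v' m i)) 0.
  move=> kS; rewrite -[X in flim _ _ X]oppr0; apply: flimN.
  have [k1|k1] := boolP (k \in K1).
    (* On [act] the residual tends to [th] times the Euler sum of the initial form, which is 0 as
       that form vanishes at [a]; the other terms tend to 0 because [x] and [x'] have the same
       limit. *)
    pose lim i : C := if i \in act then th * (w i)%:R * (a i * ((P k)^`M(i)).@[a]) else 0.
    have slim : \sum_i lim i = 0.
      transitivity (th * \sum_i (w i)%:R * (a i * ((P k)^`M(i)).@[a])).
        rewrite mulr_sumr; apply: eq_bigr => i _; rewrite /lim.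
        case: ifPn => ia; first by rewrite -mulrA.
        have /eqP -> : w i == 0%N by rewrite hw.
        by rewrite mul0r mulr0.
      by rewrite wpart_euler -/(P k) P0 // !mulr0.
    rewrite -[X in flim _ _ X]slim; apply: (flim_ext (u := fun m => \sum_i
       (if i \in act then th * (w i)%:R * ((x m i * toC (ex (l m i))) *
           (toC (ex (D m k - l m i)) * ((f k)^`M(i)).@[x m]))
        else toC (ex (D m k - l m i)) * ((f k)^`M(i)).@[x m] * (x m i - x' m i)))).
      move=> m; rewrite mulr_sumr; apply: eq_bigr => i _; rewrite /rho k1 /v' /v.
      have := tauC m => h; case: ifPn => ia; last by rewrite exDl //; field.
      have := ex_neq0 (l m i); rewrite -toC_eq0 => h'.
      by rewrite exD toCM exN fmorphV; field; rewrite h h'.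
    apply: flim_sum => i _ _; rewrite /lim; have [ia|ia] := boolP (i \in act).
      by apply: flimZ; apply: flimM => //; apply: dlim => //; apply: actN.
    have [iZ|iZ] := boolP (i \in zcoords (~: I)).
      by apply: flim_ext (flim_cst 0) => m; rewrite xZ // x'Z // subrr mulr0.
    rewrite -[X in flim _ _ X](mulr0 ((P k)^`M(i)).@[a]) -[X in flim _ _ (_ * X)](subrr (y i)).
    by apply: flimM; [apply: dlim|apply: flimB].
  (* Since [f k] vanishes at both ends of the secant, its Hadamard factors annihilate [v]; they
     differ from the gradient at [x] by a quantity tending to 0. *)
  have [H [hH dH cH]] := hadamard (f k).
  pose E m := \sum_i (((f k)^`M(i)).@[x m] * (v' m i - v m i) +
     (((f k)^`M(i)).@[x m] - H i (x m) (x' m)) * v m i).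
  apply: (flim_ext (u := E)) => [m|].
    have : \sum_i H i (x m) (x' m) * v m i = 0.
      rewrite /v; under eq_bigr do rewrite mulrCA.
      by rewrite -mulr_sumr -hH xK ?x'K ?SK // subrr mulr0.
    rewrite /rho (negbTE k1) mul1r => h; rewrite -[RHS]subr0 -[X in _ = _ - X]h -sumrB.
    by apply: eq_bigr => i _; ring.
  have z : \sum_(i < n.+1) (0 : C) = 0 by rewrite big1.
  rewrite -[X in flim _ _ X]z; apply: flim_sum => i _ _; have [b hb] := vb i.
  have Hlim : flim om (fun m => H i (x m) (x' m)) ((f k)^`M(i)).@[y].
    by rewrite -dH; apply: cH.
  have := flimD (flimM (dcont k i) (v'v i)) (flimM (flimB (dcont k i) Hlim) hb).
  by rewrite mulr0 subrr mul0r addr0; apply.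
have [u [u0 [uI hu]]] := solve_indep indG0 hG hr.
(* The correction [u] solves the rescaled system and is therefore multiplied by the column factors,
   which are bounded. *)
exists (fun m i => v' m i + s m i * u m i); split.
- move=> i; rewrite -[X in flim _ _ X]addr0 -[X in flim _ _ (_ + X)](mulr0 (si i)).
  apply: flim_ext (flimD (v'v i) (flimM (hsi i) (u0 i))) => m.
  by rewrite /v; ring.
- move=> m i iI; rewrite uI ?zcoords_lift // mulr0 addr0 /v' /v.
  have iZ : lift ord0 i \in zcoords (~: I) by rewrite zcoords_lift inE.
  case: ifP => [/actN|_]; first by rewrite iZ.
  by rewrite xZ // x'Z // subrr mulr0.
- apply: filtS hu => m [_ hu] k kK kI; have kS : k \in S by rewrite inE kK.
  have := hu k kS; rewrite /G => E.
  apply: (mulfI (rho0 m k)); rewrite mulr0; under eq_bigr do rewrite mulrDr.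
  rewrite big_split /= mulrDr; apply/eqP; rewrite addrC addr_eq0; apply/eqP; rewrite -E.
  by rewrite mulr_sumr; apply: eq_bigr => i _; ring.
Qed.

(** * The toric stratification *)

Definition stratum n k0 (f : 'I_k0 -> {mpoly C[n.+1]}) (eps : R)
    (IK : {set 'I_n} * {set 'I_k0}) (x : 'rV[C]_n.+1) :=
  IK.2 != set0 /\ toric_stratum f IK.1 IK.2 x /\ normsq x < toC eps.

Definition coords N (x : 'rV[C]_N) (i : 'I_N) : C := x ord0 i.

(** The equations of the stratum that are not automatic on the coordinate subspace of [I]. *)
Definition essential n k0 (f : 'I_k0 -> {mpoly C[n.+1]}) (I : {set 'I_n}) (K : {set 'I_k0}) :=
  [set k in K | nonvan I (f k)].

(** The inequations on the coordinates and on the [f k], as well as the bound on the norm, are open;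
    near a point of the stratum only the equations remain. *)
Lemma stratum_local n k0 (f : 'I_k0 -> {mpoly C[n.+1]}) (eps : R) I K x :
  stratum f eps (I, K) x -> exists r : R, 0 < r /\ forall y : 'rV[C]_n.+1,
    (forall i, nrm (y ord0 i - x ord0 i) < r) ->
    (forall i, i \notin I -> y ord0 (lift ord0 i) = 0) ->
    (forall k, k \in essential f I K -> evr (f k) y = 0) -> stratum f eps (I, K) y.
Proof.
move=> [/= Kn0 [[xI xK] xU]].
have n1 : near2 (coords x) (fun ab => forall i, i \in I -> ab.1 (lift ord0 i) != 0).
  apply: filt_forall => i; have [iI|iI] := boolP (i \in I); last by apply: filtT.
  have x0 : coords x (lift ord0 i) != 0 by rewrite /coords xI.
  by apply: filtS (flim_neq0 (near2_fst _ _) x0) => ab h _.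
have n2 : near2 (coords x) (fun ab => forall k, k \notin K -> (f k).@[ab.1] != 0).
  apply: filt_forall => k; have [kK|kK] := boolP (k \in K); first by apply: filtT.
  have x0 : (f k).@[coords x] != 0 by rewrite [X in X != 0]/(evr (f k) x) xK.
  apply: filtS (flim_neq0 _ x0) => [ab h _|]; first exact: h.
  by apply: flim_meval => i; apply: near2_fst.
have n3 : near2 (coords x) (fun ab => \sum_i nrm (ab.1 i) ^+ 2 < eps).
  have h : flim (near2 (coords x)) (fun ab => \sum_i toC (nrm (ab.1 i)) ^+ 2)
      (\sum_i toC (nrm (coords x i)) ^+ 2).
    by apply: flim_sum => i _ _; apply: flimX; apply: flim_nrm; apply: near2_fst.
  have d0 : 0 < eps - \sum_i nrm (coords x i) ^+ 2.
    by rewrite subr_gt0 -ltr_toC -normsqE.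
  apply: filtS (h _ d0) => ab.
  under eq_bigr do rewrite -rmorphXn; under [X in _ - X]eq_bigr do rewrite -rmorphXn.
  rewrite -!rmorph_sum -rmorphB nrm_toC => hab.
  by have := ler_norm (\sum_i nrm (ab.1 i) ^+ 2 - \sum_i nrm (coords x i) ^+ 2); lra.
have [r [r0 hr]] := filtI (filtI n1 n2) n3.
exists r; split=> // y hy yI yS.
have rr i : nrm (coords x i - coords x i) < r by rewrite subrr nrm0.
have [[/= h1 h2] h3] := hr (coords y) (coords x) hy rr.
split=> //; split=> /=; last by rewrite normsqE ltr_toC.
split=> [i|k].
  by have [/h1 //|/yI ->] := boolP (i \in I); rewrite eqxx.
have [kK|/h2 /negbTE //] := boolP (k \in K).
have [nv|nv] := boolP (nonvan I (f k)); first by rewrite yS ?eqxx // inE kK.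
apply/eqP; apply: (nonvanN_meval nv) => _ /imsetP[i iI ->]; apply: yI.
by move: iI; rewrite inE.
Qed.

(** Allows local equations to be indexed by the codimension [c]; full row rank gives [c <= N], and
    [N - (N - c)] is rewritten to [c]. *)
Lemma complex_submanifold_intro N (X : 'rV[C]_N -> Prop) :
  (forall x, X x -> exists (c : nat) (h : 'I_c -> {mpoly C[N]}) (r : C), 0 < r /\
    (forall y, normsq (y - x) < r -> (X y <-> forall j, evr (h j) y = 0)) /\
    row_free (\matrix_(j < c, i < N) evr ((h j)^`M(i)) x)) -> complex_submanifold X.
Proof.
move=> H x /H[c [h [r [r0 [hX hrf]]]]].
have cN : (c <= N)%N by move: hrf => /eqP <-; apply: rank_leq_col.
exists (N - c)%N, r.
have [h' [h1 h2]] : exists h' : 'I_(N - (N - c)) -> {mpoly C[N]},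
    (forall y, normsq (y - x) < r -> (X y <-> forall j, evr (h' j) y = 0)) /\
    row_free (\matrix_(j < N - (N - c), i < N) evr ((h' j)^`M(i)) x).
  by rewrite subKn //; exists h.
by exists h'; rewrite leq_subr.
Qed.

Lemma stratum_submanifold n k0 (f : 'I_k0 -> {mpoly C[n.+1]}) (eps e : R) IK :
  gradients_indep f e -> 0 < e -> eps <= e ^+ 2 -> complex_submanifold (stratum f eps IK).
Proof.
case: IK => I K hg e0 epse; apply: complex_submanifold_intro => x hx.
have [r [r0 hr]] := stratum_local hx.
have [/= Kn0 [[xI xK] xU]] := hx.
pose S := essential f I K.
have ind : indep S (zcoords I) (fun k i => ((f k)^`M(i)).@[coords x]).
  apply: hg => // [k|i|k].
  - by rewrite inE => /andP[].
  - apply: normsq_coord (ltW e0) _; apply: lt_le_trans xU _.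
    by rewrite ler_toC.
  - by rewrite inE => /andP[kK _]; apply/eqP; rewrite [_ == _]xK.
pose h (j : 'I_(#|~: I| + #|S|)) : {mpoly C[n.+1]} :=
  match split j with
  | inl a => 'X_(lift ord0 (@enum_val _ (mem (~: I)) a))
  | inr b => f (@enum_val _ (mem S) b)
  end.
have hl a : h (lshift _ a) = 'X_(lift ord0 (@enum_val _ (mem (~: I)) a)).
  by rewrite /h -[lshift _ a]/(unsplit (inl a)) unsplitK.
have hrs b : h (rshift _ b) = f (@enum_val _ (mem S) b).
  by rewrite /h -[rshift _ b]/(unsplit (inr b)) unsplitK.
exists (#|~: I| + #|S|)%N, h, (toC (r ^+ 2)); split.
  by rewrite -(rmorph0 toC) ltr_toC exprn_gt0.
split=> [y hy|].
  split=> [[/= _ [[yI yK] _]] j|hz].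
    case: (split_ordP j) => [a ->|b ->].
      rewrite hl /evr mevalXU; apply/eqP; have := enum_valP a; rewrite inE.
      by apply: contraNT; rewrite yI.
    rewrite hrs; apply/eqP; rewrite yK; have := enum_valP b.
    by rewrite inE => /andP[].
  apply: hr => [i|i iI|k kS].
  - by have := normsq_coord i (ltW r0) hy; rewrite !mxE.
  - have iC : i \in ~: I by rewrite inE.
    by have := hz (lshift _ (enum_rank_in iC i)); rewrite hl /evr mevalXU enum_rankK_in.
  - by have := hz (rshift _ (enum_rank_in kS k)); rewrite hrs enum_rankK_in.
apply: inj_row_free => v hv.
have col i : \sum_a v ord0 (lshift _ a) * evr ((h (lshift _ a))^`M(i)) x +
    \sum_b v ord0 (rshift _ b) * evr ((f (@enum_val _ (mem S) b))^`M(i)) x = 0.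
  have := congr1 (fun M : 'rV[C]_n.+1 => M ord0 i) hv; rewrite !mxE big_split_ord /= => E.
  rewrite -[RHS]E.
  by congr (_ + _); apply: eq_bigr => j _; rewrite !mxE ?hrs.
have dX a i : evr ((h (lshift _ a))^`M(i)) x =
    (lift ord0 (@enum_val _ (mem (~: I)) a) == i)%:R.
  rewrite hl /evr mderivX mnm1E; case: eqP => [->|_]; last by rewrite scale0r meval0.
  by rewrite scale1r -{1}[U_(i)%MM]add0m addmK mpolyX0 meval1.
(* Block triangular Jacobian: on the columns of [I] the coordinate equations contribute nothing, so
   the coefficients of the gradients vanish first. Each column outside [I] then isolates one
   coordinate equation. *)
have vr b : v ord0 (rshift _ b) = 0.
  have : rsubmx v *m rowsmx S (zcoords I) (fun k i => ((f k)^`M(i)).@[coords x]) = 0.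
    apply/rowP => i; rewrite !mxE; under eq_bigr do rewrite !mxE.
    have [iI|iI] := boolP (i \in zcoords I); last by rewrite big1 // => l _; rewrite mulr0.
    rewrite -[RHS](col i) [X in _ = X + _]big1 ?add0r // => a _; rewrite dX.
    case: eqP => [E|_]; last by rewrite mulr0.
    by move: iI (enum_valP a); rewrite -E zcoords_lift inE => ->.
  have /indepP rf := ind; move/eqP; rewrite mulmx_free_eq0 // => /eqP /rowP /(_ b).
  by rewrite !mxE.
have vl a : v ord0 (lshift _ a) = 0.
  have := col (lift ord0 (@enum_val _ (mem (~: I)) a)).
  rewrite [X in _ + X]big1 ?addr0; last by move=> b _; rewrite vr mul0r.
  rewrite (bigD1 a) //= dX eqxx mulr1 big1 ?addr0 // => a' a'a.
  by rewrite dX (inj_eq lift_inj) (inj_eq enum_val_inj) (negbTE a'a) mulr0.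
by apply/rowP => j; rewrite mxE; case: (split_ordP j) => l ->.
Qed.

(** The kernel of the gradients lies in the tangent cone, by [kernel_curve]; this is the inclusion
    used for condition (b). *)
Lemma stratum_tangent n k0 (f : 'I_k0 -> {mpoly C[n.+1]}) (eps e : R) I K x (q : 'rV[C]_n.+1) :
  gradients_indep f e -> 0 < e -> eps <= e ^+ 2 -> stratum f eps (I, K) x ->
  (forall i, i \notin I -> q ord0 (lift ord0 i) = 0) ->
  (forall k, k \in K -> nonvan I (f k) ->
     \sum_i ((f k)^`M(i)).@[coords x] * q ord0 i = 0) ->
  tangent_space (stratum f eps (I, K)) x q.
Proof.
move=> hg e0 epse hx qI qK.
have [r [r0 hr]] := stratum_local hx.
have [/= Kn0 [[xI xK] xU]] := hx.
have fx k : k \in essential f I K -> (f k).@[coords x] = 0.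
  by rewrite inE => /andP[kK _]; apply/eqP; rewrite [_ == _]xK.
have [zs [ts [ts0 fz zc zx zq]]] :
  exists (zs : nat -> 'I_n.+1 -> C) (ts : nat -> R),
    [/\ forall m, 0 < ts m,
     forall m j, j \in essential f I K -> (f j).@[zs m] = 0,
     forall m i, i \notin zcoords I -> zs m i = coords x i + (toC (ts m))^-1 * coords q i,
     forall i, flim frechet (fun m => zs m i) (coords x i) &
     forall i, flim frechet (fun m => toC (ts m) * (zs m i - coords x i)) (coords q i)].
  apply: kernel_curve => // [|k].
    apply: hg => // [k|i].
      by rewrite inE => /andP[].
    apply: normsq_coord (ltW e0) _; apply: lt_le_trans xU _.
    by rewrite ler_toC.
  by rewrite inE => /andP[kK nv]; apply: qK.
have [m0 hm0] : frechet (fun m => forall i, nrm (zs m i - coords x i) < r).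
  by apply: filt_forall => i; apply: zx.
(* The first [m0] points are dropped so that the whole curve stays where the equations describe the
   stratum. *)
have shift u b : flim frechet u b -> flim frechet (fun m => u (m0 + m)%N) b.
  move=> h d d0; have [k1 hk1] := h d d0; exists k1 => k hk; apply: hk1.
  exact: leq_trans hk (leq_addl _ _).
exists (fun m => \row_i zs (m0 + m)%N i), (fun m => toC (ts (m0 + m)%N)); split.
  move=> m; split; last by rewrite -(rmorph0 toC) ltr_toC.
  apply: hr => [i|i iI|k kS].
  - by rewrite mxE; apply: hm0; apply: leq_addr.
  - rewrite mxE zc ?zcoords_lift // /coords qI // mulr0 addr0.
    by apply/eqP; apply: contraNT iI; rewrite xI.
  - by rewrite /evr -[RHS](fz (m0 + m)%N k kS); apply: meval_eq => i; rewrite mxE.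
split; apply/cvg_toP => i.
  by apply: flim_ext (shift _ _ (zx i)) => m; rewrite mxE.
by apply: flim_ext (shift _ _ (zq i)) => m; rewrite !mxE.
Qed.

(** Diagonal extraction: the definition of [set_cvg] speaks of genuine subsequences, while the
    construction only gives properties along [om]. *)
Lemma om_subsequence (P : nat -> nat -> Prop) : (forall j, om (P j)) ->
  exists phi : nat -> nat, (forall j, (phi j < phi j.+1)%N) /\ forall j, P j (phi j).
Proof.
move=> h.
have [g hg] := choice (fun jn : nat * nat => (let: ex_intro2 k a b := om_ex (h jn.1) jn.2 in
  ex_intro (fun k => (jn.2 <= k)%N /\ P jn.1 k) k (conj a b))).
pose phi := fix phi j := if j is i.+1 then g (j, (phi i).+1) else g (0%N, 0%N).
exists phi; split=> [j|[|j]]; first by have [] := hg (j.+1, (phi j).+1).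
  by have [] := hg (0%N, 0%N).
by have [] := hg (j.+1, (phi j).+1).
Qed.

Lemma stratum_whitney n k0 (f : 'I_k0 -> {mpoly C[n.+1]}) (R0 d e eps : R) j j' y :
  admissible_with f R0 d -> gradients_indep f e -> 0 < e ->
  eps <= e ^+ 2 -> eps <= d ^+ 2 -> eps <= R0 -> stratum f eps j' y ->
  whitney_b_at (stratum f eps j) (stratum f eps j') y.
Proof.
case: j j' => [I K] [I' K'] hf hg e0 epse epsd epsR hy xs ys hxy xsy ysy T L hT hL v Lv.
have [R00 [d0 _]] := hf.
have [/= _ [[yI yK] yU]] := hy.
have xsX m : stratum f eps (I, K) (xs m) by have [] := hxy m.
have xsI m i : (xs m ord0 (lift ord0 i) != 0) = (i \in I) by have [_ [[h _] _]] := xsX m.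
have xsK m k : (evr (f k) (xs m) == 0) = (k \in K) by have [_ [[_ h] _]] := xsX m.
have ysY m : stratum f eps (I', K') (ys m) by have [_ []] := hxy m.
have ysI m i : (ys m ord0 (lift ord0 i) != 0) = (i \in I') by have [_ [[h _] _]] := ysY m.
have ysK m k : (evr (f k) (ys m) == 0) = (k \in K') by have [_ [[_ h] _]] := ysY m.
have lx i : flim om (fun m => coords (xs m) i) (coords y i).
  by apply: flim_frechet_om; apply: (cvg_toP _ _).1 xsy i.
have ly i : flim om (fun m => coords (ys m) i) (coords y i).
  by apply: flim_frechet_om; apply: (cvg_toP _ _).1 ysy i.
(* Nonvanishing of a coordinate is open and vanishing of an equation is closed, so the existence of
   the sequences forces [I'] inside [I] and [K] inside [K']. *)
have sub : I' \subset I.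
  apply/subsetP => i iI'; have yi : coords y (lift ord0 i) != 0 by rewrite /coords yI.
  by have [m _] := om_ex (flim_neq0 (lx _) yi) 0%N; rewrite /coords xsI.
have subK k : k \in K -> k \in K'.
  move=> kK; rewrite -yK; apply/eqP.
  apply: (@flim_unique _ om _ (fun m => (f k).@[coords (xs m)])); first exact: flim_meval.
  by apply: flim_ext (flim_cst 0) => m; apply/esym/eqP; rewrite [_ == _]xsK.
pose tau m := \sum_i nrm (coords (xs m) i - coords (ys m) i).
have htau m i : nrm (coords (xs m) i - coords (ys m) i) <= tau m.
  exact: (nrm_le_sum (fun i => coords (xs m) i - coords (ys m) i)).
have tau0 m : 0 < tau m.
  rewrite lt0r sumr_ge0 ?andbT => [|i _]; last exact: nrm_ge0.
  apply/eqP => t0; have [_ [_ /eqP]] := hxy m; apply; apply/rowP => i.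
  apply/eqP; rewrite -subr_eq0 -nrm_eq0 eq_le nrm_ge0 andbT -t0; exact: htau.
have tlim : flim om (fun m => toC (tau m)) 0.
  have h : flim om (fun m => \sum_i toC (nrm (coords (xs m) i - coords (ys m) i)))
      (\sum_(i < n.+1) 0).
    apply: flim_sum => i _ _; rewrite -[X in flim _ _ X](rmorph0 toC) -nrm0 -(subrr (coords y i)).
    by apply: flim_nrm; apply: flimB.
  by move: h; rewrite big1 //; apply: flim_ext => m; rewrite rmorph_sum.
have [u [uv uI uK]] :
  exists u : nat -> 'I_n.+1 -> C,
    [/\ forall i, flim om (fun m => u m i - (toC (tau m))^-1 *
          (coords (xs m) i - coords (ys m) i)) 0,
     forall m i, i \notin I -> u m (lift ord0 i) = 0 &
     om (fun m => forall k, k \in K -> nonvan I (f k) ->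
       \sum_i ((f k)^`M(i)).@[coords (xs m)] * u m i = 0)].
  apply: (@secant_correction _ _ f R0 d e I I' K (coords y) _ _ tau hf hg sub) => //.
  - move=> i; apply: normsq_coord (ltW e0) _; apply: lt_le_trans yU _; by rewrite ler_toC.
  - apply: normsq_coord (ltW d0) _; apply: lt_le_trans yU _; by rewrite ler_toC.
  - apply: lt_le_trans epsR; move: yU; rewrite normsqE ltr_toC; apply: le_lt_trans.
    rewrite big_ord_recl /=; apply: ler_wpDl; first by rewrite exprn_ge0 // nrm_ge0.
    rewrite big_mkcond /=; apply: ler_sum => i _; case: ifP => // _.
    by rewrite exprn_ge0 // nrm_ge0.
  - by move=> k kK; apply/eqP; rewrite [_ == _]yK subK.
  - by move=> m k kK; apply/eqP; rewrite [_ == _]xsK.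
  - by move=> m k kK; apply/eqP; rewrite [_ == _]ysK subK.
have [vs [hvs vsv]] := hL.1 v Lv.
have [c hc] := choice hvs.
have tauC m : toC (tau m) != 0 by rewrite toC_eq0 gt_eqF.
have lvs i : flim om (fun m => vs m ord0 i) (v ord0 i).
  by apply: flim_frechet_om; apply: (cvg_toP _ _).1 vsv i.
(* Since [(x - y) / tau] has 1-norm equal to 1, the modulus of [b m] is the 1-norm of [vs m], which
   is bounded; so [b] has a limit along [om]. *)
pose b m := c m * toC (tau m).
have [b0 hb] : exists b0, flim om b b0.
  have h : flim om (fun m => \sum_i toC (nrm (vs m ord0 i))) (\sum_i toC (nrm (v ord0 i))).
    by apply: flim_sum => i _ _; apply: flim_nrm.
  apply: om_flim; apply: filtS (flim_bounded h) => m; move/ltW.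
  rewrite -rmorph_sum nrm_toC; apply: le_trans.
  rewrite nrmM nrm_toC gtr0_norm // mulr_sumr ger0_norm; last first.
    by apply: sumr_ge0 => i _; apply: nrm_ge0.
  by apply: ler_sum => i _; rewrite hc !mxE nrmM.
(* [vs m] is [b m] times the normalized secant; replacing the secant by its tangent correction [u m]
   changes the limit by 0. *)
pose q m : 'rV[C]_n.+1 := \row_i (b m * u m i).
have qlim i : flim om (fun m => q m ord0 i) (v ord0 i).
  have := flimD (flimM hb (uv i)) (lvs i); rewrite mulr0 add0r => lim.
  apply: flim_ext (lim _ _) => m; rewrite mxE hc !mxE /b /coords.
  by have := tauC m => h; field.
have qT : om (fun m => tangent_space (stratum f eps (I, K)) (xs m) (q m)).
  apply: filtS uK => m hm; apply: (stratum_tangent hg e0 epse) => //.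
    by move=> i iI; rewrite mxE uI // mulr0.
  move=> k kK nv; under eq_bigr do rewrite mxE mulrCA.
  by rewrite -mulr_sumr hm // mulr0.
have hP l : om (fun m => tangent_space (stratum f eps (I, K)) (xs m) (q m) /\
    forall i, nrm (q m ord0 i - v ord0 i) < l.+1%:R^-1).
  apply: filtI => //; apply: filt_forall => i; apply: qlim; by rewrite invr_gt0.
have [phi [hphi Pphi]] := om_subsequence hP.
apply: (hT.2 phi (fun l => q (phi l)) v hphi) => [l|]; first by have [] := Pphi l.
apply/cvg_toP => i; apply: (flim_squeeze (g := fun l => l.+1%:R^-1)).
  by apply: flim_inv_nat => l; rewrite lexx andbT ltW // invr_gt0.
by apply: filtT => l; have [_ h] := Pphi l; apply: ltW.
Qed.

Theorem theorem3p2 (n k0 : nat) (f : 'I_k0 -> {mpoly C[n.+1]}) :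
  (0 < k0)%N ->
  (forall k (c : C), f k != c%:MP) ->
  (forall k (t : C), evr (f k) (pt t (fun _ => 0)) = 0) ->
  Newton_admissible f ->
  exists eps : R, 0 < eps /\
    let U := fun x : 'rV[C]_n.+1 => normsq x < toC eps in
    let Vf := fun x : 'rV[C]_n.+1 => evr (\prod_(k < k0) f k) x = 0 in
    whitney_stratification
      (fun IK : {set 'I_n} * {set 'I_k0} => fun x =>
         IK.2 != set0 /\ toric_stratum f IK.1 IK.2 x /\ U x)
      (fun x => Vf x /\ U x)
    /\
    exists (J : finType) (X : J -> 'rV[C]_n.+1 -> Prop),
      whitney_stratification X (fun x => Vf x /\ U x) /\
      exists j, forall x, X j x <-> (U x /\ forall i : 'I_n, x ord0 (lift ord0 i) = 0).
Proof.
move=> k00 _ f0 [R0 [d hf]].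
have [R00 [d0 _]] := hf.
have [e [e0 hg]] := admissible_gradients hf.
(* The ball is defined by a squared norm, so the radii [e] and [d] are squared, whereas [R0] already
   bounds a sum of squares. *)
pose eps := Num.min R0 (Num.min (e ^+ 2) (d ^+ 2)).
have epsR : eps <= R0 by rewrite ge_min lexx.
have epse : eps <= e ^+ 2 by rewrite !ge_min lexx !orbT.
have epsd : eps <= d ^+ 2 by rewrite !ge_min lexx !orbT.
exists eps; split; first by rewrite !lt_min R00 !exprn_gt0.
move=> U Vf.
have VfE x : evr (\prod_(k < k0) f k) x = \prod_(k < k0) evr (f k) x.
  exact: rmorph_prod.
have W : whitney_stratification (stratum f eps) (fun x => Vf x /\ U x).
  split; first move=> [I K] x [/= /set0Pn[k kK] [[_ xK] xU]].
    by split=> //; rewrite /Vf VfE (bigD1 k) //=; move: kK; rewrite -xK => /eqP ->; rewrite mul0r.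
  split; first move=> x [xV xU].
    exists ([set i | x ord0 (lift ord0 i) != 0], [set k | evr (f k) x == 0]); split=> /=.
      move/eqP: xV; rewrite VfE => /prodf_eq0[k _ hk].
      by apply/set0Pn; exists k; rewrite inE.
    by split=> //; split=> [i|k]; rewrite inE.
  split; first move=> [I K] [I' K'] x [/= _ [[h1 h2] _]] [/= _ [[h1' h2'] _]].
    by congr (_, _); apply/setP => i; rewrite -?h1 -?h1' -?h2 -?h2'.
  split; first by move=> IK; apply: stratum_submanifold hg e0 epse.
  by move=> j j' y _ hy; apply: stratum_whitney hf hg e0 epse epsd epsR hy.
split; first exact: W.
(* The [t]-axis is the stratum with no nonzero [z]-coordinate and all equations, since every [f k]
   vanishes on it; [0 < k0] makes this set of equations nonempty. *)
exists _, (stratum f eps); split=> //; exists (set0, [set: 'I_k0]) => x.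
split=> [[/= _ [[xI _] xU]]|[xU x0]].
  by split=> // i; apply/eqP; rewrite -[_ == _]negbK xI inE.
split=> /=; first by apply/set0Pn; exists (Ordinal k00); rewrite inE.
split=> //; split=> [i|k]; first by rewrite x0 eqxx inE.
rewrite inE; apply/eqP; rewrite -[RHS](f0 k (x ord0 ord0)); congr evr.
by apply/rowP => i; rewrite mxE; case: (unliftP ord0 i) => [j ->|->].
Qed.
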